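(* Let $\pi \in I^{\mathsf{fpf}}_\mathbb{Z}$. Then $\mathfrak{fb}_\pi$ is an isomorphism of $\mathfrak{q}_n$-crystals $\displaystyle\bigsqcup_{\sigma\in I^{\mathsf{fpf}}_\mathbb{Z}} \mathcal{R}^{\mathsf{Sp}}_n(\sigma) \to \bigsqcup_{\sigma\in I^{\mathsf{fpf}}_\mathbb{Z}} \mathcal{R}^{\mathsf{Sp}}_n(\sigma)$.
   Context: Fix a positive integer $n$. Let $S_\mathbb{Z}$ be the permutations of $\mathbb{Z}$ fixing all but finitely many integers, $s_i=(i,i+1)$, and $1_{\mathsf{fpf}}$ the permutation $i\mapsto i-(-1)^i$ of $\mathbb{Z}$. $I^{\mathsf{fpf}}_\mathbb{Z}$ is the $S_\mathbb{Z}$-conjugacy class of $1_{\mathsf{fpf}}$. An fpf-involution word for $\pi\in I^{\mathsf{fpf}}_\mathbb{Z}$ is a minimal-length word $i_1\cdots i_l$ with $\pi=s_{i_l}\cdots s_{i_1}1_{\mathsf{fpf}}s_{i_1}\cdots s_{i_l}$; $\mathcal{R}^{\mathsf{Sp}}(\pi)$ is the set of these, and $\mathcal{R}^{\mathsf{Sp}}_n(\pi)$ is the set of $n$-tuples $(w^1,\dots,w^n)$ of strictly increasing words whose concatenation lies in $\mathcal{R}^{\mathsf{Sp}}(\pi)$. It carries Hiroshima's $\mathfrak{q}_n$-crystal structure: weight = factor lengths; $e_i,f_i$ ($i\in[n-1]$) are the Morse–Schilling operators (pair letters of $w^{i+1}$, from largest to smallest, with the smallest unpaired larger letter of $w^i$;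 $f_i$ removes the largest unpaired letter $x$ of $w^i$ and adds to $w^{i+1}$ the smallest $y\ge x$ not present, or gives $0$; $e_i$ removes the smallest unpaired letter $y$ of $w^{i+1}$ and adds to $w^i$ the largest $x\le y$ not present, or gives $0$); $f_{\overline1}(w)=0$ if $w^1=\emptyset$ or $\min w^2\le\min w^1$, otherwise with $x=\min w^1$ it moves $x$ from $w^1$ to $w^2$ if $x+1\notin w^1$, and if $x+1\in w^1$ it removes $x+1$ from $w^1$ and adds $x-1$ to the start of $w^2$; $e_{\overline1}(w)=0$ if $w^2=\emptyset$ or $\min w^1\le\min w^2$, otherwise with $x=\min w^2$ it moves $x$ to $w^1$ if $x$ is even, and if $x$ is odd it removes $x$ from $w^2$ and adds $x+2$ to $w^1$. Fpf-involution Little bumps: for $\pi\in I^{\mathsf{fpf}}_\mathbb{Z}$, a $\pi$-marked fpf-involution word is a pair $(w,i)$ such that deleting the $i$th letter of $w$ gives an element of $\mathcal{R}^{\mathsf{Sp}}(\pi)$; it is fpf-reduced if $w$ is an fpf-involution word, and semi-reduced if it is not fpf-reduced but $w$ is a reduced word for some $\sigma\in S_\mathbb{Z}$ with $\sigma^{-1}1_{\mathsf{fpf}}\sigma=\pi$. If $(w,i)$ is neither, there is a unique $j\ne i$ such that $(w,j)$ is also a $\pi$-marked fpf-involution word; if $(w,i)$ is semi- or fpf-reduced set $j=i$. Define $\textsf{fpush}(w,i)=(v,j)$, where $v$ is $w$ with its $j$th letter increased by one. For an fpf-involution word $w$, if $(w,i)$ is a $\pi$-marked fpf-involution word for some $i$,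 let $N>0$ be minimal with $\textsf{fpush}^N(w,i)=(v,j)$ fpf-reduced and set $\mathfrak{fb}_\pi(w)=v$; otherwise $\mathfrak{fb}_\pi(w)=w$. Since $\mathfrak{fb}_\pi$ preserves descent sets of words, it is extended to factorizations: $\mathfrak{fb}_\pi(w^1,\dots,w^n)=(v^1,\dots,v^n)$ where $v^1\cdots v^n=\mathfrak{fb}_\pi(w^1\cdots w^n)$ and $\ell(v^i)=\ell(w^i)$. *)

(* Defs.v *)
From mathcomp Require Import all_boot all_order all_algebra.
From Stdlib Require Import ClassicalEpsilon.
Set Implicit Arguments. Unset Strict Implicit. Unset Printing Implicit Defensive.
Import Order.TTheory GRing.Theory Num.Theory.
Local Open Scope ring_scope.

Definition pb (P : Prop) : bool :=
  if excluded_middle_informative P then true else false.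

Definition s (i : int) (x : int) : int :=
  if x == i then i + 1 else if x == i + 1 then i else x.

Definition one_fpf (x : int) : int := if (2 %| x)%Z then x - 1 else x + 1.

Definition finitary_perm (sigma tau : int -> int) : Prop :=
  cancel sigma tau /\ cancel tau sigma /\
  exists N : nat, forall x : int, (N < `|x|)%N -> sigma x = x.

Definition in_Ifpf (pi : int -> int) : Prop :=
  exists sigma tau, finitary_perm sigma tau /\
    forall x, pi x = tau (one_fpf (sigma x)).

Fixpoint conjw (w : seq int) (f : int -> int) : int -> int :=
  match w with
  | [::] => f
  | i :: w' => conjw w' (fun x => s i (f (s i x)))
  end.

Definition fpf_inv_word (pi : int -> int) (w : seq int) : Prop :=
  (forall x, conjw w one_fpf x = pi x) /\
  forall w' : seq int, (forall x, conjw w' one_fpf x = pi x) -> (size w <= size w')%N.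

(* R^Sp_n(pi): n-tuples of strictly increasing words whose concatenation is
   an fpf-involution word for pi (factor k of the paper is entry k-1) *)
Definition RSp_n (n : nat) (pi : int -> int) (ws : seq (seq int)) : Prop :=
  size ws = n /\ all (sorted (fun a b : int => a < b)) ws /\
  fpf_inv_word pi (flatten ws).

(* the disjoint union over sigma in I^fpf_Z (sigma is determined by ws) *)
Definition RSp_union (n : nat) (ws : seq (seq int)) : Prop :=
  exists sigma, in_Ifpf sigma /\ RSp_n n sigma ws.

Definition leZ (a b : int) : bool := a <= b.
Definition minZ (u : seq int) : int := head 0 (sort leZ u).
Definition maxZ (u : seq int) : int := last 0 (sort leZ u).
Definition insZ (y : int) (u : seq int) : seq int := sort leZ (y :: u).

Fixpoint find_up (k : nat) (y : int) (u : seq int) : int :=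
  match k with 0%N => y | k'.+1 => if y \in u then find_up k' (y + 1) u else y end.
Fixpoint find_down (k : nat) (y : int) (u : seq int) : int :=
  match k with 0%N => y | k'.+1 => if y \in u then find_down k' (y - 1) u else y end.
Definition next_absent (x : int) (u : seq int) := find_up (size u).+1 x u.
Definition prev_absent (x : int) (u : seq int) := find_down (size u).+1 x u.

(* Morse--Schilling pairing of (a, b) = (w^i, w^{i+1}): letters of b, from
   largest to smallest, are paired with the smallest unpaired larger letter
   of a.  Returns (unpaired letters of a, unpaired letters of b). *)
Definition pair_step (acc : seq int * seq int) (y : int) : seq int * seq int :=
  let: (U, V) := acc in
  match [seq x <- U | y < x] with
  | [::] => (U, y :: V)
  | L => (rem (minZ L) U, V)
  end.
Definition unpaired (a b : seq int) : seq int * seq int :=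
  foldl pair_step (a, [::]) (rev (sort leZ b)).

Definition upd (ws : seq (seq int)) (k : nat) (u : seq int) := set_nth [::] ws k u.

(* f_i, e_i for 1 <= i <= n-1 (acting on factors i and i+1) *)
Definition f_op (i : nat) (ws : seq (seq int)) : option (seq (seq int)) :=
  let a := nth [::] ws i.-1 in let b := nth [::] ws i in
  let U := (unpaired a b).1 in
  if U is [::] then None else
  let x := maxZ U in
  Some (upd (upd ws i.-1 (rem x a)) i (insZ (next_absent x b) b)).

Definition e_op (i : nat) (ws : seq (seq int)) : option (seq (seq int)) :=
  let a := nth [::] ws i.-1 in let b := nth [::] ws i in
  let V := (unpaired a b).2 in
  if V is [::] then None else
  let y := minZ V in
  Some (upd (upd ws i (rem y b)) i.-1 (insZ (prev_absent y a) a)).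

(* f_{bar 1}, e_{bar 1} (acting on factors 1 and 2); min of an empty word is
   +infinity *)
Definition f_bar (ws : seq (seq int)) : option (seq (seq int)) :=
  let a := nth [::] ws 0 in let b := nth [::] ws 1 in
  if a is [::] then None else
  if (b != [::]) && (minZ b <= minZ a) then None else
  let x := minZ a in
  if x + 1 \notin a then Some (upd (upd ws 0 (rem x a)) 1 (x :: b))
  else Some (upd (upd ws 0 (rem (x + 1) a)) 1 ((x - 1) :: b)).

Definition e_bar (ws : seq (seq int)) : option (seq (seq int)) :=
  let a := nth [::] ws 0 in let b := nth [::] ws 1 in
  if b is [::] then None else
  if (a != [::]) && (minZ a <= minZ b) then None else
  let x := minZ b in
  if (2 %| x)%Z then Some (upd (upd ws 1 (rem x b)) 0 (insZ x a))
  else Some (upd (upd ws 1 (rem x b)) 0 (insZ (x + 2) a)).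

Definition wt (ws : seq (seq int)) : seq nat := map size ws.

Definition delete (i : nat) (w : seq int) : seq int := take i w ++ drop i.+1 w.

Definition marked (pi : int -> int) (w : seq int) (i : nat) : Prop :=
  (i < size w)%N /\ fpf_inv_word pi (delete i w).

Definition fpf_reduced (w : seq int) : Prop := fpf_inv_word (conjw w one_fpf) w.

Definition perm_of_word (w : seq int) : int -> int :=
  foldr (fun i f x => s i (f x)) id w.

Definition reduced_word (w : seq int) : Prop :=
  forall w', (forall x, perm_of_word w' x = perm_of_word w x) -> (size w <= size w')%N.

Definition semi_reduced (pi : int -> int) (w : seq int) : Prop :=
  ~ fpf_reduced w /\
  exists sigma : int -> int, (forall x, sigma x = perm_of_word w x) /\
    reduced_word w /\
    (forall x, perm_of_word (rev w) (one_fpf (sigma x)) = pi x).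

Definition fpush (pi : int -> int) (p : seq int * nat) : seq int * nat :=
  let: (w, i) := p in
  let j := if pb (fpf_reduced w) || pb (semi_reduced pi w) then i
           else nth i [seq j <- iota 0 (size w) | (j != i) && pb (marked pi w j)] 0 in
  (set_nth 0 w j (nth 0 w j + 1), j).

Definition fb_from (pi : int -> int) (w : seq int) (i : nat) : seq int :=
  match excluded_middle_informative
          (exists N, pb ((0 < N)%N /\ fpf_reduced (iter N (fpush pi) (w, i)).1)) with
  | left H => (iter (ex_minn H) (fpush pi) (w, i)).1
  | right _ => w
  end.

Definition fb (pi : int -> int) (w : seq int) : seq int :=
  match excluded_middle_informative (exists i, pb (marked pi w i)) with
  | left H => fb_from pi w (ex_minn H)
  | right _ => w
  end.

Definition fbn (pi : int -> int) (ws : seq (seq int)) : seq (seq int) :=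
  reshape (map size ws) (fb pi (flatten ws)).

(* Main.v *)
(** A Little bump is a first return map: pushing a marked word is a bijection
    of the set of words marked for pi, it raises the sum of the letters by one,
    and a word whose marked letter is even and far away from the other letters
    is reduced, so every orbit returns to the reduced words in both directions.
    Running the push map in parallel on two words that differ by a
    Coxeter-Knuth move (or by the symplectic move on the first two letters)
    shows that bumps commute with these moves; they also preserve descents.
    Each crystal operator is a composite of such moves, along a path which is
    determined by descents alone: f_i factors through the row insertion of the
    paired letters of the second word into the first one, and f_bar applies the
    initial move and then carries a letter through the first word. The operators
    e are the partial inverses of the operators f. *)
Require Import Defs.
From mathcomp Require Import all_boot all_order all_algebra.
From mathcomp Require Import zify.
From Stdlib Require Import FunctionalExtensionality ClassicalEpsilon.
Set Implicit Arguments. Unset Strict Implicit. Unset Printing Implicit Defensive.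
Import Order.TTheory GRing.Theory Num.Theory.
Local Open Scope ring_scope.

(** * Conjugation words and strong exchange *)

(** The pairing rule compares values of letters, which a bump changes, so it cannot be transported
    directly; positions, lengths and comparisons of adjacent letters can. Each operator is therefore
    recast as a list of positions at which moves are made, depending only on the lengths of the
    factors and, for [f_op], on one integer that is read off from ascents and descents of
    intermediate words. A move of a given type at a given position has at most one outcome, so equal
    lists of positions give equal results. When two related words are pushed in parallel the pushes
    do not stay in step: where letters of the moved block collide, one of the words may need extra
    pushes. The words passed meanwhile are not reduced, so the first returns still correspond.
    Minimality of length is replaced by the decidable condition [red] that every letter is an ascent
    of the involution built so far; strong exchange makes the two equivalent. *)

Notation nthZ := (@nth int 0).
Notation setZ := (@set_nth int 0).

Ltac splits := repeat match goal with
  |- context [if ?b then _ else _] =>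
    lazymatch b with context [if _ then _ else _] => fail | _ => destruct b eqn:? end
  end.

(* [lia] after discarding the boolean hypotheses it cannot use: it would
   otherwise split on each of them. *)
Ltac lia_clear := repeat match goal with
  | H : is_true ?b |- _ =>
    lazymatch b with
    | leq _ _ => fail | @Order.le _ _ _ _ => fail | @Order.lt _ _ _ _ => fail
    | @eq_op _ _ _ => fail | negb _ => fail | andb _ _ => fail | orb _ _ => fail
    | _ => clear H
    end
  | H : @eq (list _) _ _ |- _ => clear H
  | H : forall _, _ |- _ => clear H
  end; lia.

Definition cj (c : int) (f : int -> int) : int -> int := fun x => s c (f (s c x)).
Definition transp (p q x : int) : int :=
  if x == p then q else if x == q then p else x.
Definition cjt (p q : int) (f : int -> int) : int -> int :=
  fun x => transp p q (f (transp p q x)).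
Definition conj_fpf (w : seq int) : int -> int := conjw w one_fpf.
(** For a fixed-point-free involution f the strict inequality excludes the proper descents and also
    the case f c = c + 1, in which conjugation by s_c changes nothing. *)
Fixpoint up (f : int -> int) (w : seq int) : bool :=
  if w is c :: w' then (f c < f (c + 1)) && up (cj c f) w' else true.
Definition red (w : seq int) : bool := up one_fpf w.
Definition fpf (f : int -> int) : Prop :=
  (forall x, f (f x) = x) /\ (forall x, f x <> x).

Lemma sK a x : s a (s a x) = x.
Proof. rewrite /s. splits; lia. Qed.

Lemma s_fst c : s c c = c + 1.
Proof. by rewrite /s eqxx. Qed.

Lemma s_snd c : s c (c + 1) = c.
Proof. rewrite /s; splits; lia. Qed.

Lemma s_inj a x y : s a x = s a y -> x = y.
Proof. by move=> E; rewrite -(sK a x) E sK. Qed.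

Lemma s_lt (a p q : int) : p < q -> (p == a) && (q == a + 1) = false -> s a p < s a q.
Proof. rewrite /s. splits; lia. Qed.

Lemma dvd2E (x : int) : (2 %| x)%Z = ((x %% 2)%Z == 0).
Proof. by apply/dvdz_mod0P/eqP. Qed.

(** Base case of the exchange property: the only inversions of the base involution are its own
    two-cycles. *)
Lemma one_fpf_desc (p q : int) : p < q -> one_fpf q < one_fpf p -> one_fpf p = q.
Proof. rewrite /one_fpf !dvd2E. splits; lia. Qed.

Lemma fpf_one : fpf one_fpf.
Proof. split=> x; rewrite /one_fpf !dvd2E; splits; lia. Qed.

Lemma cjK c : involutive (cj c).
Proof.
by move=> f; apply: functional_extensionality => x; rewrite /cj !sK.
Qed.

Lemma fpf_cj c f : fpf f -> fpf (cj c f).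
Proof.
move=> [fK fN]; split=> x; rewrite /cj; first by rewrite sK fK sK.
by move=> E; apply: (fN (s c x)); rewrite -[in RHS]E sK.
Qed.

Lemma conjw_cat u v f : conjw (u ++ v) f = conjw v (conjw u f).
Proof. by elim: u f => //= a u IH f; rewrite IH. Qed.

Lemma conjw_inj w f g : conjw w f = conjw w g -> f = g.
Proof.
elim: w f g => //= c w IH f g /IH; rewrite -/(cj c f) -/(cj c g) => E.
by rewrite -(cjK c f) E cjK.
Qed.

Lemma conj_fpf_cat u v : conj_fpf (u ++ v) = conjw v (conj_fpf u).
Proof. by rewrite /conj_fpf conjw_cat. Qed.

Lemma conj_fpf_rcons u c : conj_fpf (rcons u c) = cj c (conj_fpf u).
Proof. by rewrite -cats1 conj_fpf_cat. Qed.

Lemma up_cat f u v : up f (u ++ v) = up f u && up (conjw u f) v.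
Proof. by elim: u f => //= c u IH f; rewrite IH andbA. Qed.

Lemma red_cat u v : red (u ++ v) = red u && up (conj_fpf u) v.
Proof. exact: up_cat. Qed.

Lemma red_rcons u c : red (rcons u c) = red u && (conj_fpf u c < conj_fpf u (c + 1)).
Proof. by rewrite -cats1 red_cat /= andbT. Qed.

Lemma fpf_conjw w f : fpf f -> fpf (conjw w f).
Proof. by elim: w f => //= c w IH f /(fpf_cj c)/IH. Qed.

Lemma fpf_C w : fpf (conj_fpf w).
Proof. exact/fpf_conjw/fpf_one. Qed.

Lemma cj_fix c f : fpf f -> f c = c + 1 -> cj c f = f.
Proof.
move=> [fK fN] E; apply: functional_extensionality => x.
have E' : f (c + 1) = c by rewrite -E fK.
have E1 : f x = c -> x = c + 1 by move=> H; rewrite -(fK x) H E.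
have E2 : f x = c + 1 -> x = c by move=> H; rewrite -(fK x) H E'.
by rewrite /cj {2}/s; case: ifP => [/eqP->|?]; [|case: ifP => [/eqP->|?]];
  rewrite /s; splits; lia.
Qed.

Lemma up_step c f : fpf f -> f c < f (c + 1) ->
  cj c f (c + 1) < cj c f c /\ cj c f c <> c + 1.
Proof.
move=> [fK fN] H.
have Es : s c c = c + 1 by rewrite /s eqxx.
have Es' : s c (c + 1) = c by rewrite -[in LHS]Es sK.
have Hn : (f c == c) && (f (c + 1) == c + 1) = false.
  by apply/negP => /andP[/eqP/fN].
rewrite /cj Es Es'; split; first exact: s_lt.
move=> E; have E1 : f (c + 1) = c by rewrite -(sK c (f _)) E.
by have := fK (c + 1); rewrite E1; lia.
Qed.

Lemma delete_cat1 u v j : (j < size u)%N -> delete j (u ++ v) = delete j u ++ v.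
Proof.
move=> H; rewrite /delete take_cat H drop_cat -[RHS]catA; congr (_ ++ _).
case: ltnP => H1 //; have -> : j.+1 = size u by lia.
by rewrite subnn drop0 drop_size.
Qed.

Lemma delete_cat2 u v j : delete (size u + j) (u ++ v) = u ++ delete j v.
Proof.
rewrite /delete take_cat drop_cat.
have -> : (size u + j < size u)%N = false by lia.
have -> : ((size u + j).+1 < size u)%N = false by lia.
by rewrite -addnS !addKn catA.
Qed.

Lemma delete_mid u c v : delete (size u) (u ++ c :: v) = u ++ v.
Proof. by rewrite -[size u]addn0 delete_cat2 /delete /= drop0. Qed.

Lemma size_delete j w : (j < size w)%N -> size (delete j w) = (size w).-1.
Proof. by move=> H; rewrite size_cat size_take size_drop H; lia. Qed.

Lemma mid_nth (w : seq int) i : (i < size w)%N ->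
  w = take i w ++ nthZ w i :: drop i.+1 w.
Proof. by move=> H; rewrite -drop_nth // cat_take_drop. Qed.

Lemma transp_s c p q x : transp (s c p) (s c q) (s c x) = s c (transp p q x).
Proof. by rewrite /transp !(inj_eq (@s_inj c)); case: ifP => // _; case: ifP. Qed.

Lemma cj_cjt c p q f : cj c (cjt p q f) = cjt (s c p) (s c q) (cj c f).
Proof.
apply: functional_extensionality => x; rewrite /cj /cjt -transp_s.
by have := transp_s c (s c p) (s c q) x; rewrite !sK => <-.
Qed.

(** The cycles {p, c}, {q, c + 1} become {p, c + 1}, {q, c} whether one swaps the values c, c + 1 or
    their partners p, q. *)
Lemma cj_cjt_val c p q f : fpf f -> f p = c -> f q = c + 1 -> p <> c -> p <> c + 1 ->
  q <> c -> q <> c + 1 -> p <> q -> cj c f = cjt p q f.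
Proof.
move=> [fK fN] Ep Eq N1 N2 N3 N4 N5; apply: functional_extensionality => x.
have E1 : f c = p by rewrite -Ep fK.
have E2 : f (c + 1) = q by rewrite -Eq fK.
have F1 : f x = p -> x = c by move=> H; rewrite -(fK x) H Ep.
have F2 : f x = q -> x = c + 1 by move=> H; rewrite -(fK x) H Eq.
have F3 : f x = c -> x = p by move=> H; rewrite -(fK x) H E1.
have F4 : f x = c + 1 -> x = q by move=> H; rewrite -(fK x) H E2.
have S0 z : z <> c -> z <> c + 1 -> s c z = z by rewrite /s; splits; lia.
have S1 : s c c = c + 1 by rewrite /s eqxx.
have S2 : s c (c + 1) = c by rewrite /s; splits; lia.
have T0 z : z <> p -> z <> q -> transp p q z = z by rewrite /transp; splits; lia.
have T1 : transp p q p = q by rewrite /transp eqxx.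
have T2 : transp p q q = p by rewrite /transp eqxx; splits; lia.
rewrite /cj /cjt; have [->|/eqP X1] := eqVneq x p.
  by rewrite T1 Eq (S0 p) // Ep S1 T0 //; lia.
have [->|/eqP X2] := eqVneq x q.
  by rewrite T2 Ep (S0 q) // Eq S2 T0 //; lia.
have [->|/eqP X3] := eqVneq x c.
  by rewrite S1 (T0 c) ?E1 ?E2 ?T1 ?S0 //; lia.
have [->|/eqP X4] := eqVneq x (c + 1).
  by rewrite S2 (T0 (c + 1)) ?E1 ?E2 ?T2 ?S0 //; lia.
rewrite (S0 x) // (T0 x) // (S0 (f x)) ?(T0 (f x)) //.
- by move=> /F1.
- by move=> /F2.
- by move=> /F3.
- by move=> /F4.
Qed.

(* Trace the wires p, q back through w: the letter at which they (or their
   partners) cross is the one to delete; in the base involution no two wires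
   of different cycles are inverted, so the crossing exists. *)
Lemma strong_exchange w (p q : int) : p < q -> conj_fpf w q < conj_fpf w p -> conj_fpf w p <> q ->
  exists2 j, (j < size w)%N & conj_fpf (delete j w) = cjt p q (conj_fpf w).
Proof.
elim/last_ind: w p q => [|w c IH] p q pq; first by move=> /(one_fpf_desc pq).
have [yK yN] := fpf_C (rcons w c); have F := fpf_C (rcons w c).
move: yK yN F; set y := conj_fpf (rcons w c) => yK yN F lt_y ne_y.
have Ey : conj_fpf w = cj c y by rewrite /y conj_fpf_rcons cjK.
have E x : conj_fpf w (s c x) = s c (y x) by rewrite Ey /cj sK.
have [/andP[/eqP ep /eqP eq]|n1] := boolP ((p == c) && (q == c + 1)).
  exists (size w); rewrite ?size_rcons // -cats1 delete_mid cats0 Ey.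
  by rewrite ep eq.
have [/andP[/eqP ep /eqP eq]|n2] := boolP ((y q == c) && (y p == c + 1)).
  exists (size w); rewrite ?size_rcons // -cats1 delete_mid cats0 Ey.
  have Ec : y c = q by rewrite -ep yK.
  have Ec1 : y (c + 1) = p by rewrite -eq yK.
  have N1 : p <> c by move=> e; move: ne_y; rewrite e Ec.
  have N2 : p <> c + 1 by move=> e; move: (yN p); rewrite eq e.
  have N3 : q <> c by move=> e; move: (yN q); rewrite ep e.
  have N4 : q <> c + 1 by move=> e; move: ne_y; rewrite eq e.
  have -> : cjt p q y = cjt q p y.
    by apply: functional_extensionality => x; rewrite /cjt /transp; splits; lia.
  by apply: cj_cjt_val => //; lia.
have [] := IH (s c p) (s c q).
- by apply: s_lt => //; apply/negbTE.
- by rewrite !E; apply: s_lt => //; apply/negbTE.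
- by rewrite E => /s_inj.
move=> j lt_j Ej; exists j; first by rewrite size_rcons; lia.
rewrite -cats1 delete_cat1 // cats1 conj_fpf_rcons Ej cj_cjt !sK.
by rewrite Ey cjK.
Qed.

(** The last letter of a reduced word is a proper descent of its involution, so exchange removes a
    letter from the competing word and leaves a word for the shorter involution. *)
Lemma red_min w w' : red w -> conj_fpf w' = conj_fpf w -> (size w <= size w')%N.
Proof.
elim/last_ind: w w' => [//|w c IH] w'; rewrite red_rcons => /andP[rw lt] E.
have [d1 d2] := up_step (fpf_C w) lt; rewrite -conj_fpf_rcons -E in d1 d2.
have [|j lt_j Ej] := @strong_exchange w' c (c + 1) _ d1 d2; first lia.
have := IH (delete j w') rw; rewrite Ej E conj_fpf_rcons size_delete //.
move=> /(_ (cjK _ _)); rewrite size_rcons; lia.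
Qed.

Lemma desc_cases f c : fpf f -> [\/ f c < f (c + 1), f c = c + 1 |
  f (c + 1) < f c /\ f c <> c + 1].
Proof.
move=> [fK fN]; have N : f c <> f (c + 1).
  by move=> /(congr1 f); rewrite !fK; lia.
case: (ltgtP (f c) (f (c + 1))) => // H; first by constructor 1.
by have [E|/eqP N'] := eqVneq (f c) (c + 1); [constructor 2|constructor 3].
Qed.

(** A last letter that is not an ascent either acts trivially or, by exchange, undoes an earlier
    letter; in both cases a shorter word exists. *)
Lemma min_red w : (forall w', conj_fpf w' = conj_fpf w -> (size w <= size w')%N) -> red w.
Proof.
elim/last_ind: w => [//|w c IH] H; rewrite red_rcons IH /=.
  case: (desc_cases c (fpf_C w)) => [//|E|[d1 d2]].
    have := H w; rewrite conj_fpf_rcons cj_fix ?size_rcons; [|exact: fpf_C|by []].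
    by move=> /(_ erefl); lia.
  have [|j lt_j Ej] := @strong_exchange w c (c + 1) _ d1 d2; first lia.
  have := H (delete j w); rewrite Ej conj_fpf_rcons size_rcons size_delete //.
  by move=> /(_ erefl); lia.
move=> w' E; have := H (rcons w' c); rewrite !conj_fpf_rcons E !size_rcons.
by move=> /(_ erefl).
Qed.

Lemma fpf_inv_wordE pi w : fpf_inv_word pi w <-> red w /\ conj_fpf w = pi.
Proof.
split=> [[E m]|[r <-]].
  have {}E : conj_fpf w = pi by apply: functional_extensionality.
  by split=> //; apply: min_red => w'; rewrite E => E'; apply: m => x; rewrite -E'.
split=> // w' E; apply: red_min => //.
exact: functional_extensionality.
Qed.

Lemma fpf_reducedE w : fpf_reduced w <-> red w.
Proof. by rewrite /fpf_reduced fpf_inv_wordE; split=> [[]|]. Qed.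

Lemma red_same_size w w' : red w -> conj_fpf w' = conj_fpf w -> size w' = size w -> red w'.
Proof.
move=> r E S; apply: min_red => w'' E'; rewrite S; apply: red_min => //.
by rewrite E' E.
Qed.

(** * Words of ordinary permutations: exchange and parity of the length *)

Definition word_perm := perm_of_word.

Lemma word_perm_cat u v : word_perm (u ++ v) = word_perm u \o word_perm v.
Proof.
apply: functional_extensionality => x; rewrite /word_perm /perm_of_word /=.
by elim: u => //= c u ->.
Qed.

Lemma word_perm_rcons u c x : word_perm (rcons u c) x = word_perm u (s c x).
Proof. by rewrite -cats1 word_perm_cat. Qed.

Lemma word_perm_revK w x : word_perm (rev w) (word_perm w x) = x.
Proof.
elim: w x => //= c w IH x; rewrite rev_cons word_perm_rcons /= -/(word_perm w) sK; exact: IH.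
Qed.

Lemma word_perm_inj w x y : word_perm w x = word_perm w y -> x = y.
Proof. by move=> E; rewrite -(word_perm_revK w x) E word_perm_revK. Qed.

Lemma conjwE w f x : conjw w f x = word_perm (rev w) (f (word_perm w x)).
Proof.
elim/last_ind: w x => //= w c IH x; rewrite -cats1 conjw_cat /= IH.
by rewrite cats1 rev_rcons word_perm_rcons.
Qed.

Lemma conjw_P w w' f : word_perm w = word_perm w' -> conjw w f = conjw w' f.
Proof.
move=> E; apply: functional_extensionality => x; rewrite !conjwE E.
set y := f _; apply: (@word_perm_inj w).
have K v z : word_perm v (word_perm (rev v) z) = z by rewrite -{1}(revK v) word_perm_revK.
by rewrite K E K.
Qed.

Lemma exchange_P w (p q : int) : p < q -> word_perm w q < word_perm w p ->
  exists2 j, (j < size w)%N & word_perm (delete j w) = word_perm w \o transp p q.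
Proof.
elim/last_ind: w p q => [|w c IH] p q pq; first by rewrite /word_perm /=; lia.
rewrite !word_perm_rcons => lt.
have [/andP[/eqP ep /eqP eq]|n1] := boolP ((p == c) && (q == c + 1)).
  exists (size w); rewrite ?size_rcons // -cats1 delete_mid cats0.
  apply: functional_extensionality => x; rewrite cats1 /= word_perm_rcons ep eq.
  by rewrite -[transp _ _ _]/(s c x) sK.
have [|j lt_j Ej] := IH (s c p) (s c q) _ lt.
  by apply: s_lt => //; apply/negbTE.
exists j; first by rewrite size_rcons; lia.
rewrite -cats1 delete_cat1 // cats1; apply: functional_extensionality => x.
by rewrite cats1 /= !word_perm_rcons Ej /= transp_s.
Qed.

(** Let c be the last letter of one word. If c is a descent of the other word, exchange removes one
    letter from each; otherwise c undoes an earlier letter of its own word, which loses two. The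
    result serves to recognise semi-reduced words. *)
Lemma parity_P u u' : word_perm u = word_perm u' -> odd (size u) = odd (size u').
Proof.
have [n] := ubnP (size u + size u'); elim: n u u' => // n IH u u' lt_n E.
have step v v' c : (size (rcons v c) + size v' < n.+1)%N ->
    word_perm (rcons v c) = word_perm v' -> odd (size (rcons v c)) = odd (size v').
  rewrite size_rcons => lt Ev.
  have [H|H] := boolP (word_perm v' (c + 1) < word_perm v' c).
    have [|j lt_j Ej] := @exchange_P v' c (c + 1) _ H; first lia.
    have := IH v (delete j v'); rewrite Ej size_delete //.
    have -> : word_perm v = word_perm v' \o transp c (c + 1).
      apply: functional_extensionality => x; rewrite -Ev /= word_perm_rcons.
      by rewrite -[transp _ _ _]/(s c x) sK.
    by move=> /(_ _ erefl); lia.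
  have H' : word_perm v (c + 1) < word_perm v c.
    have N : word_perm v' (c + 1) <> word_perm v' c by move=> /word_perm_inj; lia.
    have : word_perm v' c < word_perm v' (c + 1) by lia.
    by rewrite -Ev !word_perm_rcons s_fst s_snd.
  have [|j lt_j Ej] := @exchange_P v c (c + 1) _ H'; first lia.
  have := IH (delete j v) v'; rewrite Ej size_delete // -Ev.
  have -> : word_perm (rcons v c) = word_perm v \o transp c (c + 1).
    by apply: functional_extensionality => x; rewrite word_perm_rcons.
  by move=> /(_ _ erefl); lia.
case: (lastP u) lt_n E => [|v c] lt_n E; last exact: step.
case: (lastP u') lt_n E => [|v c] lt_n E //.
by symmetry; apply: step => //; rewrite addnC.
Qed.

(** * Marked words and the push map *)

Definition marks (pi : int -> int) (w : seq int) (i : nat) : Prop :=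
  [/\ (i < size w)%N, red (delete i w) & conj_fpf (delete i w) = pi].

Lemma markedE pi w i : marked pi w i <-> marks pi w i.
Proof.
rewrite /marked fpf_inv_wordE; split=> [[? [? ?]]|[? ? ?]]; first by split.
by split.
Qed.

Lemma pbP (Q : Prop) : reflect Q (pb Q).
Proof. by rewrite /pb; case: excluded_middle_informative => h; constructor. Qed.

(** After the common suffix is cancelled, the prefix before j has the involution of the same prefix
    with letter i deleted and letter j appended. There letter j is an ascent, so it is a proper
    descent of the result. *)
Lemma marks_desc pi w i j : marks pi w i -> marks pi w j -> (i < j)%N ->
  conj_fpf (take j w) (nthZ w j + 1) < conj_fpf (take j w) (nthZ w j) /\
  conj_fpf (take j w) (nthZ w j) <> nthZ w j + 1.
Proof.
move=> [lt_i ri Ci] [lt_j rj Cj] ij.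
have Ew := mid_nth lt_j; move: Ew ri Ci rj Cj.
set W := take j w; set d := nthZ w j; set x := drop j.+1 w => Ew.
have SW : size W = j by rewrite size_take lt_j.
rewrite Ew -[in delete j _]SW delete_mid delete_cat1 ?SW //.
have lt_iW : (i < size W)%N by rewrite SW.
have EW := mid_nth lt_iW.
set u := take i W in EW; set c := nthZ W i in EW; set v := drop i.+1 W in EW.
have -> : delete i W = u ++ v by [].
rewrite -cat_rcons !red_cat red_rcons !conj_fpf_cat => /andP[/andP[_ lt] _] Ei _ Ej.
have E : conj_fpf (rcons (u ++ v) d) = conj_fpf W by apply: (@conjw_inj x); rewrite Ei Ej.
by rewrite -E conj_fpf_rcons; apply: up_step; [exact: fpf_C|rewrite conj_fpf_cat].
Qed.

(** Deleting the last of three marks keeps the middle letter, which is a descent of its prefix on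
    account of the first mark; what remains is not reduced. *)
Lemma marks_third pi w i j k : marks pi w i -> marks pi w j -> marks pi w k ->
  (i < j)%N -> (j < k)%N -> False.
Proof.
move=> mi mj marks ij jk; have [d _] := marks_desc mi mj ij.
case: mj => lt_j _ _; case: marks => lt_k r _.
have SW : size (take j w) = j by rewrite size_take lt_j.
move: r; rewrite {1}(mid_nth lt_j).
have -> : k = (size (take j w) + (k - j.+1).+1)%N by rewrite SW; lia.
rewrite delete_cat2 red_cat /delete /= => /and3P[_ lt _].
by have := lt_trans d lt; rewrite ltxx.
Qed.

Lemma mark_other_uniq pi w i j k : marks pi w i -> marks pi w j -> marks pi w k ->
  j <> i -> k <> i -> j = k.
Proof.
move=> mi mj marks ji ki; have T := @marks_third pi w.
case: (ltngtP j k) => // jk; case: (ltngtP i j) => // ij; case: (ltngtP i k) => // ik;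
  by [exfalso; (apply: (T i j k) + apply: (T j i k) + apply: (T j k i)
     + apply: (T i k j) + apply: (T k i j) + apply: (T k j i)) | lia].
Qed.

Lemma marks_two pi w i j : marks pi w i -> marks pi w j -> i <> j ->
  red w = false /\ conj_fpf w <> pi.
Proof.
wlog ij : i j / (i < j)%N.
  move=> H mi mj ne; case: (ltngtP i j) => // lt; first exact: (H i j).
  by apply: (H j i) => // E; apply: ne.
move=> mi mj _; have [d1 d2] := marks_desc mi mj ij.
case: mj d1 d2 => lt_j _ Cj; have Ew := mid_nth lt_j; move: Ew Cj.
rewrite -[delete j w]/(take j w ++ drop j.+1 w).
move: (take j w) (nthZ w j : int) (drop j.+1 w) => W d x -> <- d1 d2.
rewrite red_cat !conj_fpf_cat /=; split.
  by apply/negP => /and3P[_ lt _]; have := lt_trans d1 lt; rewrite ltxx.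
move=> /conjw_inj E; have := congr1 (fun f => f d) E.
rewrite /= s_fst => E2.
have H := (fpf_C W).2 d; move: E2 H d1 d2; rewrite /s; splits; lia.
Qed.

(** W is U with one reflection upwards. While v is read, its letters move the pair p, q. A letter d
    that swaps the pair, or the pair of its values, performs the same reflection and may be deleted.
    Otherwise W d stays reduced: if d were no ascent of W, exchange would undo the reflection and
    yield a word for U d with fewer letters than U d. *)
Lemma red_reflect U W (p q : int) v : red (U ++ v) -> red W -> size W = (size U).+1 ->
  p < q -> conj_fpf U p < conj_fpf U q -> conj_fpf W = cjt p q (conj_fpf U) ->
  red (W ++ v) \/ exists2 j, (j < size v)%N & conj_fpf (W ++ delete j v) = conj_fpf (U ++ v).
Proof.
elim: v U W p q => [|d v IH] U W p q rU rW SW pq lt E; first by left; rewrite cats0.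
have F := fpf_C U; case: (F) => fK fN.
have [/andP[/eqP ep /eqP eq]|n1] := boolP ((p == d) && (q == d + 1)).
  by right; exists 0%N => //; rewrite /delete /= drop0 !conj_fpf_cat E ep eq.
have [/andP[/eqP ep /eqP eq]|n2] := boolP ((conj_fpf U p == d) && (conj_fpf U q == d + 1)).
  right; exists 0%N => //; rewrite /delete /= drop0 !conj_fpf_cat E /=.
  congr (conjw v _); symmetry.
  have Ed : conj_fpf U d = p by rewrite -ep fK.
  have Ed1 : conj_fpf U (d + 1) = q by rewrite -eq fK.
  apply: cj_cjt_val => // e.
  - by move: (fN p); rewrite ep e.
  - by move: lt; rewrite ep eq -[in d + 1]e ; move: Ed1; rewrite -e; move: eq ep pq; lia.
  - by move: eq; rewrite e Ed; move: pq; lia.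
  - by move: (fN q); rewrite eq e.
  - by move: pq; lia.
have pq' : s d p < s d q by apply: s_lt => //; apply/negbTE.
have C1 x : conj_fpf (rcons U d) (s d x) = s d (conj_fpf U x) by rewrite conj_fpf_rcons /cj sK.
have lt' : conj_fpf (rcons U d) (s d p) < conj_fpf (rcons U d) (s d q).
  by rewrite !C1; apply: s_lt => //; apply/negbTE.
have E' : conj_fpf (rcons W d) = cjt (s d p) (s d q) (conj_fpf (rcons U d)).
  by rewrite !conj_fpf_rcons E cj_cjt.
rewrite -cat_rcons in rU.
have rUd : red (rcons U d) by move: rU; rewrite red_cat => /andP[].
have rWd : red (rcons W d).
  rewrite red_rcons rW /=.
  have [gK gN] := fpf_C (rcons U d).
  set p' := s d p in pq' lt' E'; set q' := s d q in pq' lt' E'.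
  set X := conj_fpf (rcons U d) in lt' E' gK gN.
  have N1 : X q' <> p' by move=> e; move: (gK q') lt'; rewrite e => e'; lia.
  have N2 : X p' <> q' by move=> e; move: (gK p') lt'; rewrite e => e'; lia.
  have D1 : conj_fpf (rcons W d) q' < conj_fpf (rcons W d) p' /\ conj_fpf (rcons W d) p' <> q'.
    have T1 : transp p' q' p' = q' by rewrite /transp eqxx.
    have T2 : transp p' q' q' = p' by rewrite /transp eqxx; splits; lia.
    rewrite E' /cjt T1 T2 /transp; have := gN p'; have := gN q'; splits; lia.
  have B : cjt p' q' (conj_fpf (rcons W d)) = X.
    apply: functional_extensionality => x; rewrite E' /cjt.
    have TK z : transp p' q' (transp p' q' z) = z by rewrite /transp; splits; lia.
    by rewrite !TK.
  case: (desc_cases d (fpf_C W)) => [//|e|[d1 d2]]; exfalso.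
    have := D1; rewrite conj_fpf_rcons cj_fix //; last exact: fpf_C.
    move=> [e1 e2]; have [j lt_j Ej] := strong_exchange pq' e1 e2.
    have := red_min rUd (w' := delete j W); rewrite Ej -/X.
    rewrite -B conj_fpf_rcons cj_fix //; last exact: fpf_C.
    by rewrite size_delete // size_rcons => /(_ erefl); lia.
  have [|j lt_j Ej] := @strong_exchange W d (d + 1) _ d1 d2; first lia.
  have Ej' : conj_fpf (delete j W) = conj_fpf (rcons W d) by rewrite Ej conj_fpf_rcons.
  case: D1; rewrite -Ej' => e1 e2.
  have [k lt_k Ek] := strong_exchange pq' e1 e2.
  have := red_min rUd (w' := delete k (delete j W)); rewrite Ek Ej' -/X B.
  rewrite (size_delete lt_k) (size_delete lt_j) size_rcons => /(_ erefl).
  by move: lt_j; lia.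
have := IH (rcons U d) (rcons W d) _ _ rU rWd _ pq' lt' E'.
rewrite !size_rcons SW => /(_ erefl) [H|[j lt_j Ej]].
  by left; rewrite -cat_rcons.
right; exists j.+1 => //.
have -> : delete j.+1 (d :: v) = d :: delete j v by [].
by rewrite -!cat_rcons.
Qed.

(** The cases follow the action of the marked letter on its prefix: an ascent is followed through
    the suffix as a reflection, a two-cycle changes nothing, and a proper descent is exchanged with
    an earlier letter, which becomes the other mark. *)
Lemma mark_cases pi w i : marks pi w i ->
  [\/ red w, conj_fpf w = pi | exists2 j, j <> i & marks pi w j].
Proof.
move=> [lt_i]; have Su : size (take i w) = i by rewrite size_take lt_i.
have Ew := mid_nth lt_i; move: Su Ew.
set u := take i w; set a := nthZ w i; set v := drop i.+1 w => Su Ew.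
rewrite Ew -Su delete_mid => r E.
case: (desc_cases a (fpf_C u)) => [lt|e|[d1 d2]].
- have ru : red u by move: r; rewrite red_cat => /andP[].
  have rr : red (rcons u a) by rewrite red_rcons ru.
  have Hl : a < a + 1 by lia.
  case: (red_reflect r rr (size_rcons u a) Hl lt (conj_fpf_rcons u a)).
    by rewrite cat_rcons; constructor 1.
  case=> j lt_j Ej; constructor 3; exists (size u + j.+1)%N; first lia.
  have Dj : delete (size u + j.+1) (u ++ a :: v) = rcons u a ++ delete j v.
    by rewrite delete_cat2 cat_rcons.
  split; rewrite ?Dj; first by rewrite size_cat /=; lia.
    apply: (red_same_size r Ej).
    by rewrite size_cat size_rcons (size_delete lt_j) size_cat; lia.
  by rewrite Ej.
- by constructor 2; rewrite conj_fpf_cat /= -/(cj a (conj_fpf u)) cj_fix -?conj_fpf_cat //; apply: fpf_C.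
- have [|j lt_j Ej] := @strong_exchange u a (a + 1) _ d1 d2; first lia.
  constructor 3; exists j; first lia.
  have EC : conj_fpf (delete j (u ++ a :: v)) = conj_fpf (u ++ v).
    rewrite delete_cat1 // conj_fpf_cat Ej conj_fpf_cat /= -/(cj a _).
    by rewrite -[cjt _ _ _]/(cj a (conj_fpf u)) cjK.
  split; first by rewrite size_cat; lia.
    apply: (red_same_size r EC); rewrite size_delete; last by rewrite size_cat; lia.
    by rewrite !size_cat /=; lia.
  by rewrite EC.
Qed.

(** Reducedness for the permutation: a word of the same permutation has at least as many letters as
    [delete i w], and parity rules out exactly that many. *)
Lemma semiE pi w i : marks pi w i -> semi_reduced pi w <-> conj_fpf w = pi.
Proof.
move=> m; split=> [[_ [sg [Es [_ E]]]]|E].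
  by apply: functional_extensionality => x; rewrite /conj_fpf conjwE -E Es.
case: m => lt_i r Cd; split.
  move=> /fpf_reducedE rw; have := red_min rw (w' := delete i w).
  by rewrite Cd E size_delete // => /(_ erefl); lia.
exists (word_perm w); split=> //; split=> [w' E'|x]; last by rewrite -E /conj_fpf conjwE.
have E2 : word_perm w' = word_perm w by apply: functional_extensionality.
have := red_min r (w' := w'); rewrite Cd -E /conj_fpf (conjw_P _ E2) size_delete //.
by move=> /(_ erefl); have := parity_P E2; lia.
Qed.

(** * The push map as a bijection of marked words *)

Definition inc (w : seq int) (j : nat) : seq int := setZ w j (nthZ w j + 1).

Lemma delete_set w j x : (j < size w)%N -> delete j (setZ w j x) = delete j w.
Proof.
move=> lt; have SZ : size (setZ w j x) = size w by rewrite size_set_nth; lia.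
rewrite /delete; congr (_ ++ _); apply: (@eq_from_nth _ 0).
- by rewrite !size_take SZ.
- move=> k; rewrite size_take SZ lt => H.
  by rewrite !nth_take // nth_set_nth /=; case: eqP; lia.
- by rewrite !size_drop SZ.
- by move=> k _; rewrite !nth_drop nth_set_nth /=; case: eqP; lia.
Qed.

Lemma size_set_in w j (x : int) : (j < size w)%N -> size (setZ w j x) = size w.
Proof. by move=> lt; rewrite size_set_nth; lia. Qed.

Lemma marks_set pi w j x : (j < size w)%N -> marks pi (setZ w j x) j <-> marks pi w j.
Proof. by move=> lt; rewrite /marks delete_set // size_set_in. Qed.

Lemma fpush_alone pi w i : marks pi w i -> (forall j, marks pi w j -> j = i) ->
  fpush pi (w, i) = (inc w i, i).
Proof.
move=> m H; rewrite /fpush.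
have -> // : pb (fpf_reduced w) || pb (semi_reduced pi w).
case: (mark_cases m) => [r|E|[j ne /H //]].
  by apply/orP; left; apply/pbP/fpf_reducedE.
by apply/orP; right; apply/pbP/(semiE m).
Qed.

Lemma fpush_other pi w i j : marks pi w i -> marks pi w j -> j <> i ->
  fpush pi (w, i) = (inc w j, j).
Proof.
move=> mi mj ne; rewrite /fpush; have [r nC] := marks_two mj mi ne.
have -> : pb (fpf_reduced w) || pb (semi_reduced pi w) = false.
  apply/norP; split; apply/pbP; first by rewrite fpf_reducedE r.
  by move/(semiE mi).
set l := [seq _ <- _ | _].
have jl : j \in l.
  rewrite mem_filter mem_iota; case: (mj) => -> _ _.
  by rewrite leq0n !andbT; apply/andP; split; [apply/eqP|apply/pbP/markedE].
have : nth i l 0 \in l by apply: mem_nth; case: (l) jl.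
rewrite {2}/l mem_filter /= => /andP[/andP[/eqP ne' /pbP/markedE mj'] _].
by rewrite (mark_other_uniq mi mj' mj).
Qed.

Lemma marks_dec pi w i : marks pi w i ->
  (forall j, marks pi w j -> j = i) \/ exists2 j, j <> i & marks pi w j.
Proof.
move=> m; case: (excluded_middle_informative (exists2 j, j <> i & marks pi w j)); first by right.
by move=> N; left=> j mj; have [//|/eqP ne] := eqVneq j i; case: N; exists j.
Qed.

Lemma fpushP pi w i : marks pi w i ->
  exists j, [/\ marks pi w j, fpush pi (w, i) = (inc w j, j) &
   (j <> i) \/ (j = i /\ forall j, marks pi w j -> j = i)].
Proof.
move=> m; case: (marks_dec m) => [H|[j ne mj]]; last first.
  by exists j; split=> //; [exact: fpush_other|left].
by exists i; split=> //; [exact: fpush_alone|right].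
Qed.

Definition marked_pair pi (p : seq int * nat) := marks pi p.1 p.2.

Lemma marks_lt pi w i : marks pi w i -> (i < size w)%N. Proof. by case. Qed.

Lemma marked_pair_fpush pi p : marked_pair pi p -> marked_pair pi (fpush pi p).
Proof.
case: p => w i m; have [j [mj -> _]] := fpushP m.
by apply/marks_set => //; apply: marks_lt mj.
Qed.

Lemma marked_pair_iter pi n p : marked_pair pi p -> marked_pair pi (iter n (fpush pi) p).
Proof. by elim: n => //= n IH /IH/marked_pair_fpush. Qed.

Lemma set_nthK w j (x y : int) : (j < size w)%N ->
  setZ (setZ w j x) j y = setZ w j y.
Proof. by move=> lt; rewrite set_set_nth eqxx. Qed.

Lemma set_nth_id (w : seq int) j : (j < size w)%N -> setZ w j (nthZ w j) = w.
Proof.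
move=> lt; apply: (@eq_from_nth _ 0); first by rewrite size_set_in.
by move=> k _; rewrite nth_set_nth /=; case: eqP => [->|].
Qed.

Lemma incK w j : (j < size w)%N ->
  setZ (inc w j) j (nthZ (inc w j) j - 1) = w.
Proof.
move=> lt; rewrite /inc nth_set_nth /= eqxx set_nthK // -[RHS](set_nth_id lt).
by congr (setZ _ _ _); lia.
Qed.

Lemma decK w j : (j < size w)%N -> inc (setZ w j (nthZ w j - 1)) j = w.
Proof.
move=> lt; rewrite /inc nth_set_nth /= eqxx set_nthK // -[RHS](set_nth_id lt).
by congr (setZ _ _ _); lia.
Qed.

Lemma fpush_inj pi p q : marked_pair pi p -> marked_pair pi q -> fpush pi p = fpush pi q -> p = q.
Proof.
case: p q => [w i] [w' i'] m m' E; change (marks pi w i) in m; change (marks pi w' i') in m'.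
have [j [mj Ep hj]] := fpushP m; have [j' [mj' Ep' hj']] := fpushP m'.
move: E; rewrite Ep Ep' => -[Ew Ej]; rewrite -Ej in mj' hj' Ew *.
have {Ew}Ew : w = w' by rewrite -(incK (marks_lt mj)) Ew incK //; apply: marks_lt mj'.
rewrite -Ew in m' mj' hj' *; congr (_, _).
case: hj hj' => [ne|[<- H]] [ne'|[<- H']] //.
- by apply: (mark_other_uniq mj) => // e; [apply: ne|apply: ne'].
- exact: H'.
- by symmetry; apply: H.
Qed.

(** Lower the marked letter; it stays a mark because its value does not enter the condition. The
    previous mark is the other mark of the lowered word if there is one, and the same position
    otherwise. *)
Lemma fpush_surj pi q : marked_pair pi q -> exists2 p, marked_pair pi p & fpush pi p = q.
Proof.
case: q => v j m; have lt := marks_lt m; rewrite /= in lt.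
set w := setZ v j (nthZ v j - 1).
have mj : marks pi w j by apply/marks_set.
case: (marks_dec mj) => [H|[i ne mi]].
  by exists (w, j) => //; rewrite fpush_alone // decK.
exists (w, i) => //; rewrite (fpush_other mi mj) ?decK // => e; exact: ne.
Qed.

(** * First return of the push map *)

Lemma word_perm_fix w (x : int) : (forall y, y \in w -> y <> x /\ y + 1 <> x) -> word_perm w x = x.
Proof.
elim: w => //= c w IH H; rewrite -/(word_perm w x) IH.
  have [h1 h2] := H c (mem_head _ _); rewrite /s; splits; lia.
by move=> y yw; apply: H; rewrite inE yw orbT.
Qed.

Lemma conj_fpf_fix w (x : int) :
  (forall y, y \in w -> (y <> x /\ y + 1 <> x) /\ (y <> one_fpf x /\ y + 1 <> one_fpf x)) ->
  conj_fpf w x = one_fpf x.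
Proof.
move=> H; rewrite /conj_fpf conjwE (@word_perm_fix w x); last by move=> y /H[].
by rewrite word_perm_fix // => y; rewrite mem_rev => /H[].
Qed.

(** The last letter c of v' is a proper descent of the common involution. Were all letters of v
    farther than 2 from c, none would touch c, c + 1 or their partners in [c - 1, c + 2], and the
    involution would agree there with the base one, which has no proper descent. Exchange then
    removes c from v' and a letter from v. *)
Lemma red_letters_near v v' : red v -> red v' -> conj_fpf v = conj_fpf v' ->
  forall x, x \in v' -> exists2 y, y \in v & (x - 2 <= y) && (y <= x + 2).
Proof.
elim/last_ind: v' v => // v' c IH v rv rv' E x.
have Sz : size v = (size v').+1.
  have := red_min rv (w' := rcons v' c); have := red_min rv' (w' := v).
  by rewrite E !size_rcons => /(_ erefl) ? /(_ erefl) ?; lia.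
move: (rv'); rewrite red_rcons => /andP[r lt].
have := up_step (fpf_C v') lt; rewrite -conj_fpf_rcons -E => -[d1 d2].
have [|j lt_j Ej] := @strong_exchange v c (c + 1) _ d1 d2; first lia.
have Ej' : conj_fpf (delete j v) = conj_fpf v' by rewrite Ej E conj_fpf_rcons; apply: cjK.
rewrite mem_rcons inE => /orP[/eqP->|xv]; last first.
  have [|y yv H] := IH (delete j v) _ r Ej' x xv.
    by apply: (red_same_size r Ej'); rewrite size_delete // Sz.
  by exists y => //; move: yv; rewrite mem_cat => /orP[/mem_take|/mem_drop].
case: (excluded_middle_informative (exists2 y, y \in v & (c - 2 <= y) && (y <= c + 2))) => // N.
have F y : y \in v -> (y < c - 2) || (c + 2 < y).
  move=> yv; apply/negP => /negP H; apply: N; exists y => //.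
  by move: H; rewrite negb_or; lia.
have O1 : one_fpf c < one_fpf (c + 1) \/ one_fpf c = c + 1.
  by rewrite /one_fpf !dvd2E; splits; lia.
have B : (c - 1 <= one_fpf c) && (one_fpf c <= c + 1) && (c <= one_fpf (c + 1)) &&
   (one_fpf (c + 1) <= c + 2) by rewrite /one_fpf; splits; lia.
have E1 : conj_fpf v c = one_fpf c by apply: conj_fpf_fix => y /F; lia.
have E2 : conj_fpf v (c + 1) = one_fpf (c + 1) by apply: conj_fpf_fix => y /F; lia.
by move: d1 d2; rewrite E1 E2; case: O1; lia.
Qed.

Definition sumZ (w : seq int) : int := \sum_(x <- w) x.

Lemma sumZ_bound (w : seq int) (B : int) :
  (forall x, x \in w -> (- B <= x) && (x <= B)) ->
  (- (B * (size w)%:Z) <= sumZ w) && (sumZ w <= B * (size w)%:Z).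
Proof.
rewrite /sumZ; elim: w => [|x w IH] H; first by rewrite big_nil /= mulr0 oppr0 lexx.
have /IH : forall y, y \in w -> (- B <= y) && (y <= B).
  by move=> y yw; apply: H; rewrite inE yw orbT.
have := H x (mem_head _ _); rewrite big_cons /= intS mulrDr mulr1; lia.
Qed.

Lemma word_bound (v : seq int) : exists2 B : int, 0 <= B &
  forall x, x \in v -> (- B <= x) && (x <= B).
Proof.
elim: v => [|x v [B B0 IH]]; first by exists 0.
exists (B + `|x|) => [|y]; first lia.
by rewrite inE => /orP[/eqP->|/IH]; lia.
Qed.

Lemma class_bound pi v0 : red v0 -> conj_fpf v0 = pi -> exists2 B : int, 0 <= B &
  forall v, red v -> conj_fpf v = pi ->
    (forall x, x \in v -> (- B <= x) && (x <= B)) /\ (- B <= sumZ v) && (sumZ v <= B).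
Proof.
move=> r0 E0; have [B B0 HB] := word_bound v0.
have L : 0 <= (B + 2) * (size v0)%:Z by apply: mulr_ge0; lia.
(* The summand B + 2 bounds the letters; the other one, with the common length as a factor, bounds
   the sum. *)
exists ((B + 2) + (B + 2) * (size v0)%:Z) => [|v rv Ev]; first lia.
have S : size v = size v0.
  have := red_min rv (w' := v0); have := red_min r0 (w' := v).
  by rewrite E0 Ev => /(_ erefl) ? /(_ erefl) ?; lia.
have H x : x \in v -> (- (B + 2) <= x) && (x <= B + 2).
  have E : conj_fpf v0 = conj_fpf v by rewrite E0 Ev.
  by move=> /(red_letters_near r0 rv E)[y /HB]; lia.
have := sumZ_bound H; rewrite S => HS; split; last lia.
by move=> x /H; lia.
Qed.

Lemma word_perm_move a v : (forall x, x \in v -> (x + 1 < a) || (a + 1 < x)) ->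
  word_perm (a :: v) = word_perm (rcons v a).
Proof.
move=> H; apply: functional_extensionality => z; elim: v H => // x v IH H.
rewrite rcons_cons /= -/(word_perm (rcons v a) z) -IH; last first.
  by move=> y yv; apply: H; rewrite inE yv orbT.
rewrite /= -/(word_perm v z); move: (word_perm v z) => t.
have := H x (mem_head _ _); rewrite /s; splits; lia.
Qed.

Lemma conj_fpf_P u w w' v : word_perm w = word_perm w' -> conj_fpf (u ++ w ++ v) = conj_fpf (u ++ w' ++ v).
Proof. by move=> E; rewrite !conj_fpf_cat !conjw_cat (conjw_P _ E). Qed.

(** The distant letter commutes to the end and acts where the involution is the base one: an even
    letter joins two two-cycles and is an ascent, an odd letter swaps the points of one two-cycle
    and acts trivially. *)
Lemma mark_far pi w i : marks pi w i ->
  (forall x, x \in delete i w -> (x + 2 < nthZ w i) || (nthZ w i + 2 < x)) ->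
  if (2 %| nthZ w i)%Z then is_true (red w) else conj_fpf w = pi.
Proof.
move=> [lt_i r E]; have Ew := mid_nth lt_i; move: Ew r E.
rewrite -[delete i w]/(take i w ++ drop i.+1 w).
move: (take i w) (nthZ w i) (drop i.+1 w) => u a v -> r E H.
have EC : conj_fpf (u ++ a :: v) = conj_fpf (rcons (u ++ v) a).
  rewrite -cats1 -catA cats1 -[a :: v]cats0 -[rcons v a]cats0.
  apply: conj_fpf_P; apply: word_perm_move => x xv.
  by have := H x; rewrite mem_cat xv orbT => /(_ isT); lia.
have O : forall x, a <= x <= a + 1 ->
    (forall y, one_fpf x = y -> a - 1 <= y <= a + 2) -> conj_fpf (u ++ v) x = one_fpf x.
  by move=> x hx /(_ _ erefl) hy; apply: conj_fpf_fix => y /H; lia.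
have B : (a - 1 <= one_fpf a <= a + 2) && (a - 1 <= one_fpf (a + 1) <= a + 2).
  by rewrite /one_fpf; splits; lia.
have E1 : conj_fpf (u ++ v) a = one_fpf a by apply: O => [|y <-]; lia.
have E2 : conj_fpf (u ++ v) (a + 1) = one_fpf (a + 1) by apply: O => [|y <-]; lia.
case: ifP => ev; last first.
  by rewrite EC conj_fpf_rcons cj_fix //; [exact: fpf_C|rewrite E1 /one_fpf ev].
have : red (rcons (u ++ v) a).
  rewrite red_rcons r E1 E2; move: ev; rewrite /one_fpf !dvd2E; splits; lia.
move=> rr; apply: (red_same_size rr EC).
by rewrite size_rcons !size_cat /=; lia.
Qed.

Lemma sumZ_set w j (x : int) : (j < size w)%N ->
  sumZ (setZ w j x) = sumZ (delete j w) + x.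
Proof.
move=> lt; have lt' : (j < size (setZ w j x))%N by rewrite size_set_in.
rewrite /sumZ {1}(mid_nth lt') big_cat big_cons nth_set_nth /= eqxx.
rewrite -(delete_set x lt) [delete j (setZ _ _ _)]/(_ ++ _) big_cat /=; lia.
Qed.

Lemma sumZ_mid w j : (j < size w)%N -> sumZ w = sumZ (delete j w) + nthZ w j.
Proof. by move=> lt; rewrite -sumZ_set // set_nth_id. Qed.

Lemma sumZ_iter pi n p : marked_pair pi p ->
  sumZ (iter n (fpush pi) p).1 = sumZ p.1 + n%:Z.
Proof.
move=> m; elim: n => [|n IH]; first by rewrite addr0.
rewrite iterS; have := marked_pair_iter n m; case: (iter _ _ _) IH => w i IH mi.
have [j [/marks_lt lt -> _]] := fpushP (mi : marks pi w i).
by rewrite [LHS]sumZ_set //; have := sumZ_mid lt; have : sumZ w = _ := IH; lia.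
Qed.

Lemma marked_pair_bound pi p : marked_pair pi p -> exists2 B : int, 0 <= B &
  forall w i, marks pi w i ->
   `|sumZ w - nthZ w i| <= B /\ forall x : int, x \in delete i w -> `|x| <= B.
Proof.
case: p => w0 i0 [_ r0 E0]; have [B B0 H] := class_bound r0 E0.
exists B => // w i [lt r E]; have [H1 H2] := H _ r E.
rewrite (sumZ_mid lt); split; first lia.
by move=> x /H1; lia.
Qed.

Lemma marks_red_alone pi w i j : marks pi w i -> marks pi w j -> red w -> i = j.
Proof.
by move=> mi mj; have [//|/eqP ne] := eqVneq i j; have [->] := marks_two mi mj ne.
Qed.

Lemma fpush_fix pi w i : marks pi w i -> red w \/ conj_fpf w = pi -> fpush pi (w, i) = (inc w i, i).
Proof.
move=> m H; apply: fpush_alone => // j mj; have [//|/eqP ne] := eqVneq j i.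
by have [r nC] := marks_two mj m ne; case: H => //; rewrite r.
Qed.

(** The unmarked letters stay bounded while the sum grows, so the marked letter ends up far to the
    right; if it is odd there, one more push makes it even. *)
Lemma fpush_return pi p : marked_pair pi p ->
  exists2 N, (0 < N)%N & red (iter N (fpush pi) p).1.
Proof.
move=> m; have [B B0 HB] := marked_pair_bound m.
(* After this many pushes the sum is at least 2B + 4; the unmarked letters account for at most B, so
   the marked letter exceeds B + 2. *)
pose N := `|(B + B + 4 + `|sumZ p.1|)%R|%N.
have := sumZ_iter N m; have := marked_pair_iter N m.
have := sumZ_iter N.+1 m; have := marked_pair_iter N.+1 m; rewrite !iterS.
case EN : (iter _ _ _) => [w i]; rewrite /marked_pair /= => m' S' mi S.
have [b1 b2] := HB w i mi.
have lt := marks_lt mi.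
have pos : B + 2 < nthZ w i.
  by have : sumZ w = _ := S; lia.
have := mark_far mi; case: ifP => ev.
  move=> R; exists N; first lia.
  by rewrite EN; apply: R => x /b2; lia.
move=> /(_ _) E; exists N.+1 => //; rewrite iterS EN.
have {}E : conj_fpf w = pi by apply: E => x /b2; lia.
rewrite fpush_fix //; last by right.
have mi' : marks pi (inc w i) i by apply/marks_set.
have := mark_far mi'; rewrite /inc nth_set_nth /= eqxx delete_set //.
have -> : (2 %| nthZ w i + 1)%Z by move: ev; rewrite !dvd2E; lia.
by apply=> x /b2; lia.
Qed.

(** Along preimages the marked letter goes far to the left; an odd one is lowered once more. *)
Lemma fpush_return_back pi q : marked_pair pi q ->
  exists2 N, (0 < N)%N & exists p, [/\ marked_pair pi p, red p.1 & iter N (fpush pi) p = q].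
Proof.
move=> m; have [B B0 HB] := marked_pair_bound m.
have back : forall N, exists2 p, marked_pair pi p & iter N (fpush pi) p = q.
  elim=> [|N [p mp E]]; first by exists q.
  by have [p' mp' E'] := fpush_surj mp; exists p' => //; rewrite iterSr E'.
pose N := `|(B + B + 4 + `|sumZ q.1|)%R|%N.
have [[w i] mi E] := back N; have := sumZ_iter N mi; rewrite E /= => S.
rewrite /marked_pair /= in mi; have lt := marks_lt mi.
have [b1 b2] := HB w i mi.
have neg : nthZ w i < - (B + 2) by have : sumZ q.1 = sumZ w + _ := S; lia.
have := mark_far mi; case: ifP => ev.
  move=> R; exists N; first lia.
  by exists (w, i); split=> //; apply: R => x /b2; lia.
move=> _; exists N.+1 => //; pose w' := setZ w i (nthZ w i - 1).
have mi' : marks pi w' i by apply/marks_set.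
have rw' : red w'.
  have := mark_far mi'; rewrite /w' nth_set_nth /= eqxx delete_set //.
  have -> : (2 %| nthZ w i - 1)%Z by move: ev; rewrite !dvd2E; lia.
  by apply=> x /b2; lia.
exists (w', i); split=> //.
by rewrite iterSr fpush_fix //; [rewrite decK|left].
Qed.

(** * The bump as a first return, and its bijectivity *)

Definition first_return pi p q : Prop :=
  [/\ marked_pair pi p, red p.1, red q.1 & exists N, [/\ (0 < N)%N, iter N (fpush pi) p = q
    & forall m, (0 < m < N)%N -> ~~ red (iter m (fpush pi) p).1]].

Lemma first_return_ex pi p : marked_pair pi p -> red p.1 -> exists q, first_return pi p q.
Proof.
move=> m r; have [N0 N0p R0] := fpush_return m.
have ex : exists N, (0 < N)%N && red (iter N (fpush pi) p).1.
  by exists N0; rewrite N0p.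
case: (ex_minnP ex) => N /andP[Np R] H; exists (iter N (fpush pi) p); split=> //.
exists N; split=> // k /andP[k0 kN]; apply/negP => rk.
by have := H k; rewrite k0 rk => /(_ isT); lia.
Qed.

Lemma fb_first_return pi w i q : first_return pi (w, i) q -> fb pi w = q.1.
Proof.
move=> [m r rq [N [N0 E H]]]; rewrite /fb.
case: excluded_middle_informative => [ex|[]]; last first.
  by exists i; apply/pbP/markedE.
case: ex_minnP => j /pbP/markedE mj _; have -> : j = i by apply: (marks_red_alone mj m r).
rewrite /fb_from; case: excluded_middle_informative => [ex'|[]]; last first.
  by exists N; apply/pbP; split=> //; apply/fpf_reducedE; rewrite E.
case: ex_minnP => M /pbP[M0 /fpf_reducedE rM] HM.
have le : (M <= N)%N.
  by apply: HM; apply/pbP; split=> //; apply/fpf_reducedE; rewrite E.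
have -> : M = N; last by rewrite E.
apply/eqP; rewrite eqn_leq le leqNgt; apply/negP => lt.
by have := H M; rewrite M0 lt rM => /(_ isT).
Qed.

Lemma fb_unmarked pi w : (forall i, ~ marks pi w i) -> fb pi w = w.
Proof.
move=> H; rewrite /fb; case: excluded_middle_informative => // ex; exfalso.
by case: ex => i /pbP/markedE /(H i).
Qed.

Lemma fb_cases pi w : red w -> (forall i, ~ marks pi w i) \/
  exists i q, first_return pi (w, i) q.
Proof.
move=> r; case: (excluded_middle_informative (exists i, marks pi w i)) => [[i m]|N].
  by right; have [q H] := @first_return_ex pi (w, i) m r; exists i, q.
by left=> i m; apply: N; exists i.
Qed.

Lemma first_return_mkp pi p q : first_return pi p q -> marked_pair pi q.
Proof. by case=> m _ _ [N [_ <- _]]; apply: marked_pair_iter. Qed.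

Lemma fb_red pi w : red w -> red (fb pi w).
Proof.
by move=> r; case: (fb_cases pi r) => [/fb_unmarked->//|[i [q H]]];
  rewrite (fb_first_return H); case: H.
Qed.

Lemma size_fpush pi p : marked_pair pi p -> size (fpush pi p).1 = size p.1.
Proof.
case: p => w i m; have [j [/marks_lt lt -> _]] := fpushP m.
by rewrite /= size_set_in.
Qed.

Lemma size_iter pi n p : marked_pair pi p -> size (iter n (fpush pi) p).1 = size p.1.
Proof. by move=> m; elim: n => //= n IH; rewrite size_fpush ?IH //; apply: marked_pair_iter. Qed.

Lemma size_fb pi w : red w -> size (fb pi w) = size w.
Proof.
move=> r; case: (fb_cases pi r) => [/fb_unmarked->//|[i [q H]]].
rewrite (fb_first_return H); case: H => m _ _ [N [_ <- _]].
by rewrite size_iter.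
Qed.

Lemma iter_fpush_inj pi n p q : marked_pair pi p -> marked_pair pi q ->
  iter n (fpush pi) p = iter n (fpush pi) q -> p = q.
Proof.
by move=> mp mq; elim: n => //= n IH /fpush_inj E; apply/IH/E; apply: marked_pair_iter.
Qed.

(** Two runs with the same end agree backwards, the push being injective; a longer run would pass
    through the reduced start of the shorter one before its own end. An unmarked word is fixed and
    cannot be the image of a marked one, which is marked. *)
Lemma fb_inj pi w w' : red w -> red w' -> fb pi w = fb pi w' -> w = w'.
Proof.
move=> r r'; case: (fb_cases pi r) => [N|[i [q H]]];
  case: (fb_cases pi r') => [N'|[i' [q' H']]].
- by rewrite !fb_unmarked.
- rewrite (fb_unmarked N) (fb_first_return H') => E.
  by case: (N q'.2); rewrite E; apply: first_return_mkp H'.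
- rewrite (fb_unmarked N') (fb_first_return H) => E.
  by case: (N' q.2); rewrite -E; apply: first_return_mkp H.
rewrite (fb_first_return H) (fb_first_return H') => E.
have Eq : q = q'.
  have rq : red q.1 by case: H.
  move: (first_return_mkp H) (first_return_mkp H') rq E.
  case: (q) (q') => [v j] [v' j'] m m' /= rv E0; move: m'; rewrite -E0 => m'.
  by congr (_, _); apply: (marks_red_alone m m').
case: H H' => m1 _ _ [M [M0 E1 L1]] [m2 _ _ [M' [M0' E2 L2]]].
wlog le : w w' i i' r r' q q' E Eq m1 m2 M M' M0 M0' E1 E2 L1 L2 / (M <= M')%N.
  move=> W; case/orP: (leq_total M M') => le.
    by apply: (W w w' i i' r r' q q' _ _ _ _ M M').
  by symmetry; apply: (W w' w i' i r' r q' q _ _ _ _ M' M).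
have : (w, i) = iter (M' - M) (fpush pi) (w', i').
  apply: (@iter_fpush_inj pi M) => //; first exact: marked_pair_iter.
  by rewrite -iterD subnKC // E1 E2.
case EM : (M' - M)%N => [|k]; first by case.
move=> Ek; have := L2 k.+1; rewrite -Ek /= r => /(_ _) H.
by have := H _; rewrite -EM; move/implyP; lia.
Qed.

(** Going back the least positive number of steps to a reduced word makes the forward run a first
    return. *)
Lemma fb_surj pi v : red v -> exists2 w, red w & fb pi w = v.
Proof.
move=> r; case: (excluded_middle_informative (exists j, marks pi v j)) => [[j m]|N]; last first.
  by exists v => //; apply: fb_unmarked => j m; apply: N; exists j.
have [N0 N0p [p0 [m0 r0 E0]]] := @fpush_return_back pi (v, j) m.
pose Q N := pb ((0 < N)%N /\ exists p, [/\ marked_pair pi p, red p.1 & iter N (fpush pi) p = (v, j)]).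
have ex : exists N, Q N by exists N0; apply/pbP; split=> //; exists p0.
case: (ex_minnP ex) => N /pbP[N1 [[w i] [mp rp E]]] H; exists w => //.
rewrite (@fb_first_return pi w i (v, j)) //; split=> //; exists N; split=> //.
move=> k /andP[k0 kN]; apply/negP => rk.
have := H (N - k)%N; rewrite leqNgt; have -> : (N - k < N)%N by lia.
suff -> : Q (N - k)%N by move=> /(_ isT).
apply/pbP; split; first lia.
exists (iter k (fpush pi) (w, i)); split=> //; first exact: marked_pair_iter.
by rewrite -iterD subnK //; lia.
Qed.

(** * Bumps preserve ascents and descents *)

Lemma red_adj w k : red w -> (k.+1 < size w)%N -> nthZ w k <> nthZ w k.+1.
Proof.
move=> r lt E; have lt' : (k < size w)%N by lia.
have Ew := mid_nth lt'; have Ed : drop k.+1 w = nthZ w k.+1 :: drop k.+2 w.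
  by rewrite -drop_nth.
have EC : conj_fpf (take k w ++ drop k.+2 w) = conj_fpf w.
  by rewrite {3}Ew Ed -E -!cat_rcons !conj_fpf_cat !conj_fpf_rcons cjK.
have := red_min r EC.
by rewrite size_cat size_take size_drop lt'; lia.
Qed.

(** A strict ascent alone is not invariant: raising letter k may produce an equality. Position k
    then carries the mark, and k + 1 is a mark too, since deleting either of two equal neighbours
    gives the same word; the next push raises k + 1 and restores the ascent. *)
Lemma fpush_asc pi k p : marked_pair pi p -> (k.+1 < size p.1)%N ->
  let A p := nthZ p.1 k < nthZ p.1 k.+1 \/ (nthZ p.1 k = nthZ p.1 k.+1 /\ p.2 = k) in
  A p -> A (fpush pi p).
Proof.
case: p => w i m lt A; change (marks pi w i) in m; rewrite /= in lt; rewrite /A {A} [fst _]/= [snd _]/=.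
have [j [mj E hj]] := fpushP m.
have eqmark : nthZ w k = nthZ w k.+1 -> i = k -> marks pi w k.+1.
  move=> Ekk Ei; case: m; rewrite Ei => lt' r' E'.
  have Ew := mid_nth lt'; have Ed : drop k.+1 w = nthZ w k.+1 :: drop k.+2 w.
    by rewrite -drop_nth.
  have Sk : size (rcons (take k w) (nthZ w k)) = k.+1.
    by rewrite size_rcons size_take lt'.
  have ED : delete k.+1 w = delete k w.
    rewrite -{1}Sk {3}Ew Ed -cat_rcons delete_mid.
    by rewrite /delete Ed cat_rcons Ekk.
  by split; rewrite ?ED.
rewrite E /inc /= !nth_set_nth /= => -[lt1|[E1 E2]].
  by case: (k =P j) => [e|?]; case: (k.+1 =P j) => [e1|?]; try subst j; lia.
have mk1 := eqmark E1 E2; have -> : j = k.+1.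
  case: hj => [ne|[ej H]]; last by have := H _ mk1; lia.
  by apply: (mark_other_uniq m) => //; lia.
by left; rewrite eqxx; case: eqP; lia.
Qed.

(** Mirror image of [fpush_asc]: an equality arises by raising k + 1, and the next push raises k. *)
Lemma fpush_desc pi k p : marked_pair pi p -> (k.+1 < size p.1)%N ->
  let A p := nthZ p.1 k.+1 < nthZ p.1 k \/ (nthZ p.1 k = nthZ p.1 k.+1 /\ p.2 = k.+1) in
  A p -> A (fpush pi p).
Proof.
case: p => w i m lt A; change (marks pi w i) in m; rewrite /= in lt; rewrite /A {A} [fst _]/= [snd _]/=.
have [j [mj E hj]] := fpushP m.
have eqmark : nthZ w k = nthZ w k.+1 -> i = k.+1 -> marks pi w k.
  move=> Ekk Ei; case: m; rewrite Ei => lt' r' E'.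
  have ltk : (k < size w)%N by lia.
  have Ew := mid_nth ltk; have Ed : drop k.+1 w = nthZ w k.+1 :: drop k.+2 w.
    by rewrite -drop_nth.
  have Sk : size (rcons (take k w) (nthZ w k)) = k.+1.
    by rewrite size_rcons size_take ltk.
  have ED : delete k.+1 w = delete k w.
    rewrite -{1}Sk {3}Ew Ed -cat_rcons delete_mid.
    by rewrite /delete Ed cat_rcons Ekk.
  by split; rewrite -?ED.
rewrite E /inc /= !nth_set_nth /= => -[lt1|[E1 E2]].
  by case: (k =P j) => [e|?]; case: (k.+1 =P j) => [e1|?]; try subst j; lia.
have mk1 := eqmark E1 E2; have -> : j = k.
  case: hj => [ne|[ej H]]; last by have := H _ mk1; lia.
  by apply: (mark_other_uniq m) => //; lia.
by left; rewrite eqxx; case: eqP; lia.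
Qed.

Lemma fb_asc pi w k : red w -> (k.+1 < size w)%N ->
  (nthZ (fb pi w) k < nthZ (fb pi w) k.+1) = (nthZ w k < nthZ w k.+1).
Proof.
move=> r lt; case: (fb_cases pi r) => [/fb_unmarked->//|[i [q H]]].
have rf := fb_red pi r; have := red_adj rf (k := k); rewrite size_fb // => /(_ lt).
rewrite (fb_first_return H); case: H => m _ _ [N [_ <- _]] ne.
have S n : (k.+1 < size (iter n (fpush pi) (w, i)).1)%N by rewrite size_iter.
case: (ltgtP (nthZ w k) (nthZ w k.+1)) => h.
- pose A (p : seq int * nat) :=
    nthZ p.1 k < nthZ p.1 k.+1 \/ (nthZ p.1 k = nthZ p.1 k.+1 /\ p.2 = k).
  have : A (iter N (fpush pi) (w, i)).
    elim: (N) => [|n IH]; first by left.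
    by rewrite iterS; apply: (@fpush_asc pi k) => //; apply: marked_pair_iter.
  by case=> [->|[]].
- pose A (p : seq int * nat) :=
    nthZ p.1 k.+1 < nthZ p.1 k \/ (nthZ p.1 k = nthZ p.1 k.+1 /\ p.2 = k.+1).
  have : A (iter N (fpush pi) (w, i)).
    elim: (N) => [|n IH]; first by left.
    by rewrite iterS; apply: (@fpush_desc pi k) => //; apply: marked_pair_iter.
  by case=> [?|[]//]; apply/negbTE; lia.
- by case: (red_adj r lt h).
Qed.

(** * Little bumps commute with Coxeter-Knuth moves *)

Arguments word_perm : simpl never.
Arguments conj_fpf : simpl never.

(** The list of positions pairs letters of the two blocks so that deleting paired letters leaves
    words of the same permutation; hence marks correspond. In a braid the pairing reverses the
    positions, and deleting the middle letters leaves two squares. *)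
Inductive ck_block : seq int -> seq int -> seq nat -> Prop :=
| BlkBac (a b c : int) of a < b & b < c : ck_block [:: b; a; c] [:: b; c; a] [:: 0; 2; 1]%N
| BlkBca (a b c : int) of a < b & b < c : ck_block [:: b; c; a] [:: b; a; c] [:: 0; 2; 1]%N
| BlkAcb (a b c : int) of a < b & b < c : ck_block [:: a; c; b] [:: c; a; b] [:: 1; 0; 2]%N
| BlkCab (a b c : int) of a < b & b < c : ck_block [:: c; a; b] [:: a; c; b] [:: 1; 0; 2]%N
| BlkAba (a b : int) of b = a + 1 : ck_block [:: a; b; a] [:: b; a; b] [:: 2; 1; 0]%N
| BlkBab (a b : int) of b = a + 1 : ck_block [:: b; a; b] [:: a; b; a] [:: 2; 1; 0]%N.

(** These replacements are used only at the start of a word. The last two preserve the involution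
    but not the permutation; deleting the even letter x from either side leaves an odd letter, which
    fixes the base involution. *)
Inductive initial_block : seq int -> seq int -> seq nat -> Prop :=
| BlkXY (x y : int) of (2 %| x)%Z & (2 %| y)%Z & x <> y : initial_block [:: x; y] [:: y; x] [:: 1; 0]%N
| BlkUp (x y z : int) of (2 %| x)%Z & y = x + 1 & z = x - 1 : initial_block [:: x; y] [:: x; z] [:: 0; 1]%N
| BlkDown (x y z : int) of (2 %| x)%Z & y = x + 1 & z = x - 1 : initial_block [:: x; z] [:: x; y] [:: 0; 1]%N.

Definition block (t : bool) (u : seq int) B B' phi : Prop :=
  if t then ck_block B B' phi else u = [::] /\ initial_block B B' phi.

Definition eqB (u B B' : seq int) : Prop := word_perm B = word_perm B' \/ (u = [::] /\ conj_fpf B = conj_fpf B').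

Lemma word_perm_comm (a b : int) : (a + 1 < b) || (b + 1 < a) -> word_perm [:: a; b] = word_perm [:: b; a].
Proof. by move=> H; apply: word_perm_move => x; rewrite inE => /eqP->; lia. Qed.

Ltac sv c x v := rewrite (_ : s c x = v); last by rewrite /s; splits; lia.

Lemma word_perm_braid (a : int) : word_perm [:: a; a + 1; a] = word_perm [:: a + 1; a; a + 1].
Proof.
apply: functional_extensionality => x; rewrite /word_perm /perm_of_word /=.
have [->|n1] := eqVneq x a.
  sv a a (a + 1); sv (a + 1) (a + 1) (a + 2); sv a (a + 2) (a + 2).
  by sv (a + 1) a a; sv a a (a + 1); sv (a + 1) (a + 1) (a + 2).
have [->|n2] := eqVneq x (a + 1).
  sv a (a + 1) a; sv (a + 1) a a; sv a a (a + 1); sv (a + 1) (a + 1) (a + 2).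
  by sv a (a + 2) (a + 2); sv (a + 1) (a + 2) (a + 1).
have [->|n3] := eqVneq x (a + 2).
  sv a (a + 2) (a + 2); sv (a + 1) (a + 2) (a + 1); sv a (a + 1) a.
  by sv (a + 1) a a.
by sv a x x; sv (a + 1) x x; sv a x x; sv (a + 1) x x.
Qed.

Lemma word_perm_sq (a : int) : word_perm [:: a; a] = word_perm [::].
Proof. by apply: functional_extensionality => x; rewrite /word_perm /perm_of_word /= sK. Qed.

Lemma word_perm_cons a w w' : word_perm w = word_perm w' -> word_perm (a :: w) = word_perm (a :: w').
Proof. by move=> E; rewrite -(cat1s a w) -(cat1s a w') !word_perm_cat E. Qed.

Lemma word_perm_catr u w w' : word_perm w = word_perm w' -> word_perm (w ++ u) = word_perm (w' ++ u).
Proof. by move=> E; rewrite !word_perm_cat E. Qed.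

Lemma conj_fpf_odd (x : int) v : (2 %| x)%Z = false -> conj_fpf (x :: v) = conj_fpf v.
Proof.
move=> H; rewrite /conj_fpf /= -/(cj x one_fpf) cj_fix //; first exact: fpf_one.
by rewrite /one_fpf H.
Qed.

(** Both words turn the cycles {x - 1, x}, {x + 1, x + 2} into the nested cycles {x - 1, x + 2}, {x,
    x + 1}; all other points keep their partners. *)
Lemma conj_fpf_updown (x y z : int) : (2 %| x)%Z -> y = x + 1 -> z = x - 1 ->
  conj_fpf [:: x; y] = conj_fpf [:: x; z].
Proof.
move=> ev -> ->; apply: functional_extensionality => t; rewrite /conj_fpf /conjw /=.
have O e : one_fpf (x + 2 * e) = x + 2 * e - 1.
  by move: ev; rewrite /one_fpf !dvd2E; splits; lia.
have O' e : one_fpf (x + 2 * e + 1) = x + 2 * e + 2.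
  by move: ev; rewrite /one_fpf !dvd2E; splits; lia.
have O1 : one_fpf (x - 1) = x.
  by rewrite (_ : x - 1 = x + 2 * -1 + 1) ?O'; lia.
have O2 : one_fpf x = x - 1 by rewrite (_ : x = x + 2 * 0) ?O; lia.
have O3 : one_fpf (x + 1) = x + 2.
  by rewrite (_ : x + 1 = x + 2 * 0 + 1) ?O'; lia.
have O4 : one_fpf (x + 2) = x + 1.
  by rewrite (_ : x + 2 = x + 2 * 1) ?O; lia.
have [->|n1] := eqVneq t (x - 1).
  sv (x + 1) (x - 1) (x - 1); sv x (x - 1) (x - 1); rewrite O1.
  sv x x (x + 1); sv (x + 1) (x + 1) (x + 2); sv (x - 1) (x - 1) x.
  by sv x x (x + 1); rewrite O3; sv x (x + 2) (x + 2); sv (x - 1) (x + 2) (x + 2).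
have [->|n2] := eqVneq t x.
  sv (x + 1) x x; sv x x (x + 1); rewrite O3; sv x (x + 2) (x + 2).
  sv (x + 1) (x + 2) (x + 1); sv (x - 1) x (x - 1); sv x (x - 1) (x - 1).
  by rewrite O1; sv x x (x + 1); sv (x - 1) (x + 1) (x + 1).
have [->|n3] := eqVneq t (x + 1).
  sv (x + 1) (x + 1) (x + 2); sv x (x + 2) (x + 2); rewrite O4.
  sv x (x + 1) x; sv (x + 1) x x; sv (x - 1) (x + 1) (x + 1); sv x (x + 1) x.
  by rewrite O2; sv x (x - 1) (x - 1); sv (x - 1) (x - 1) x.
have [->|n4] := eqVneq t (x + 2).
  sv (x + 1) (x + 2) (x + 1); sv x (x + 1) x; rewrite O2.
  sv x (x - 1) (x - 1); sv (x + 1) (x - 1) (x - 1); sv (x - 1) (x + 2) (x + 2).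
  by sv x (x + 2) (x + 2); rewrite O4; sv x (x + 1) x; sv (x - 1) x (x - 1).
sv (x + 1) t t; sv x t t; sv (x - 1) t t; sv x t t.
set r := one_fpf t.
have [r1 [r2 [r3 r4]]] : r != x - 1 /\ r != x /\ r != x + 1 /\ r != x + 2.
  have K := fpf_one.1 t; rewrite -/r in K.
  by do ![split]; apply/eqP => e; move: K; rewrite e ?O1 ?O2 ?O3 ?O4; lia.
by sv x r r; sv (x + 1) r r; sv (x - 1) r r.
Qed.

Lemma block_size t u B B' phi : block t u B B' phi ->
  [/\ size B' = size B, size phi = size B & (0 < size B)%N].
Proof. by case: t => [[]|[_ []]]. Qed.

Lemma block_sym t u B B' phi : block t u B B' phi -> block t u B' B phi.
Proof.
case: t => [|[-> H]]; first by case=> *; constructor.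
by split=> //; case: H => *; econstructor; eauto.
Qed.

Lemma block_phi t u B B' phi j : block t u B B' phi -> (j < size B)%N ->
  (nth 0%N phi j < size B)%N /\ nth 0%N phi (nth 0%N phi j) = j.
Proof.
case: t => [H|[_ H]]; case: H; intros;
  by destruct j as [|[|[|j]]].
Qed.

Lemma block_eqB t u B B' phi : block t u B B' phi -> eqB u B B'.
Proof.
case: t => [H|[-> H]]; case: H.
- by move=> a b c ab bc; left; apply: word_perm_cons; apply: word_perm_comm; lia.
- by move=> a b c ab bc; left; apply: word_perm_cons; apply: word_perm_comm; lia.
- move=> a b c ab bc; left; apply: (@word_perm_catr [:: b] [:: a; c] [:: c; a]).
  by apply: word_perm_comm; lia.
- move=> a b c ab bc; left; apply: (@word_perm_catr [:: b] [:: c; a] [:: a; c]).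
  by apply: word_perm_comm; lia.
- by move=> a b ->; left; apply: word_perm_braid.
- by move=> a b ->; left; symmetry; apply: word_perm_braid.
- by move=> x y ex ey ne; left; apply: word_perm_comm; move: ex ey; rewrite !dvd2E; lia.
- by move=> x y z ex ey ez; right; split=> //; apply: conj_fpf_updown.
- by move=> x y z ex ey ez; right; split=> //; symmetry; apply: conj_fpf_updown.
Qed.

Lemma block_del t u B B' phi j : block t u B B' phi -> (j < size B)%N ->
  eqB u (delete j B) (delete (nth 0%N phi j) B').
Proof.
have sq a b : word_perm [:: a; a] = word_perm [:: b; b] by rewrite !word_perm_sq.
case: t => [H|[-> H]]; case: H.
- by move=> a b c ab bc; case: j => [|[|[|]]] // _; left=> //; apply: word_perm_comm; lia.
- by move=> a b c ab bc; case: j => [|[|[|]]] // _; left=> //; apply: word_perm_comm; lia.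
- by move=> a b c ab bc; case: j => [|[|[|]]] // _; left=> //; apply: word_perm_comm; lia.
- by move=> a b c ab bc; case: j => [|[|[|]]] // _; left=> //; apply: word_perm_comm; lia.
- by move=> a b _; case: j => [|[|[|]]] // _; left; first [by [] | exact: sq].
- by move=> a b _; case: j => [|[|[|]]] // _; left; first [by [] | exact: sq].
- by move=> x y ex ey ne; case: j => [|[|]] // _; left.
- move=> x y z ex -> ->; case: j => [|[|]] // _; right; split=> //.
  by rewrite /delete /= !conj_fpf_odd //; move: ex; rewrite !dvd2E; lia.
- move=> x y z ex -> ->; case: j => [|[|]] // _; right; split=> //.
  by rewrite /delete /= !conj_fpf_odd //; move: ex; rewrite !dvd2E; lia.
Qed.

Lemma eqB_C u u' B B' v : eqB u B B' -> (u = [::] -> u' = [::]) ->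
  conj_fpf (u' ++ B ++ v) = conj_fpf (u' ++ B' ++ v).
Proof.
case=> [E|[u0 E]] H; first exact: conj_fpf_P.
by rewrite (H u0) /= !conj_fpf_cat E.
Qed.

Lemma marks_transport pi w w' i i' : marks pi w i -> (i' < size w')%N -> size w' = size w ->
  conj_fpf (delete i' w') = conj_fpf (delete i w) -> marks pi w' i'.
Proof.
move=> [lt r E] lt' S EC; split=> //; last by rewrite EC.
by apply: (red_same_size r) => //; rewrite !size_delete // S.
Qed.

Lemma marks_out pi u B B' v j : size B' = size B -> eqB u B B' ->
  marks pi (u ++ B ++ v) j -> (j < size u)%N || (size u + size B <= j)%N ->
  marks pi (u ++ B' ++ v) j.
Proof.
move=> S E m Hj; have := marks_lt m; rewrite !size_cat => lt.
apply: (marks_transport m); rewrite ?size_cat ?S //.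
case/orP: Hj => Hj.
  rewrite !delete_cat1 //; symmetry; apply: (eqB_C v E).
  by move=> u0; move: Hj; rewrite u0.
have -> : j = (size u + (size B + (j - size u - size B)))%N by lia.
by rewrite !delete_cat2 -{1}S !delete_cat2; symmetry; apply: eqB_C E _.
Qed.

Lemma marks_in pi u B B' v j j' : size B' = size B -> (j < size B)%N -> (j' < size B')%N ->
  eqB u (delete j B) (delete j' B') ->
  marks pi (u ++ B ++ v) (size u + j) -> marks pi (u ++ B' ++ v) (size u + j').
Proof.
move=> S lt lt' E m; apply: (marks_transport m); rewrite ?size_cat ?S //; first lia.
by rewrite !delete_cat2 !delete_cat1 //; symmetry; apply: eqB_C E _.
Qed.

Definition shift_phi (k : nat) (B : seq int) (phi : seq nat) (i : nat) : nat :=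
  if (k <= i < k + size B)%N then (k + nth 0 phi (i - k))%N else i.

Lemma shift_in k B phi j : (j < size B)%N -> shift_phi k B phi (k + j) = (k + nth 0 phi j)%N.
Proof. by move=> lt; rewrite /shift_phi leq_addr ltn_add2l lt addKn. Qed.

Lemma shift_out k B phi i : ~~ (k <= i < k + size B)%N -> shift_phi k B phi i = i.
Proof. by rewrite /shift_phi => /negbTE->. Qed.

Lemma in_split (k n i : nat) : (k <= i < k + n)%N -> exists2 j, (j < n)%N & i = (k + j)%N.
Proof. by move=> H; exists (i - k)%N; lia. Qed.

Lemma shiftK t u B B' phi i : block t u B B' phi ->
  shift_phi (size u) B' phi (shift_phi (size u) B phi i) = i.
Proof.
move=> H; have [S _ _] := block_size H.
have [/in_split[j lt ->]|nin] := boolP (size u <= i < size u + size B)%N.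
  by have [l1 l2] := block_phi H lt; rewrite !shift_in ?S // l2.
by rewrite !shift_out // S.
Qed.

Lemma marks_shift t pi u B B' phi v i : block t u B B' phi -> marks pi (u ++ B ++ v) i ->
  marks pi (u ++ B' ++ v) (shift_phi (size u) B phi i).
Proof.
move=> H m; have [S _ _] := block_size H.
have [|nin] := boolP (size u <= i < size u + size B)%N.
  move=> /in_split[j lt Ei]; rewrite Ei in m *; have [l1 l2] := block_phi H lt.
  by rewrite shift_in //; apply: (marks_in _ lt _ (block_del H lt)); rewrite ?S.
rewrite shift_out //; apply: (marks_out S (block_eqB H) m).
by move: nin; rewrite negb_and; lia.
Qed.

(** * Runs of pushes through non-reduced words *)

Definition nonred_steps pi (p q : seq int * nat) : Prop :=
  exists2 n, iter n (fpush pi) p = q &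
    forall m, (m < n)%N -> red (iter m (fpush pi) p).1 = false.

Lemma nonred0 pi p : nonred_steps pi p p. Proof. by exists 0%N. Qed.

Lemma nonred_trans pi p q r :
  nonred_steps pi p q -> nonred_steps pi q r -> nonred_steps pi p r.
Proof.
move=> [n <- Hn] [m <- Hm]; exists (m + n)%N; first by rewrite iterD.
move=> k lt; have [?|le] := ltnP k n; first exact: Hn.
by rewrite -(subnK le) iterD; apply: Hm; lia.
Qed.

Lemma nonred1 pi p : red p.1 = false -> nonred_steps pi p (fpush pi p).
Proof. by move=> H; exists 1%N => // -[]. Qed.

(** The mark is a premise, so that the case analyses below only have to display blocks; it is
    supplied in [related_step]. *)
Definition go pi u v (Bi Bj : seq int * nat) : Prop :=
  marks pi (u ++ Bi.1 ++ v) (size u + Bi.2) -> (Bi.2 < size Bi.1)%N ->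
  marks pi (u ++ Bj.1 ++ v) (size u + Bj.2) /\
  nonred_steps pi (u ++ Bi.1 ++ v, (size u + Bi.2)%N) (u ++ Bj.1 ++ v, (size u + Bj.2)%N).

Lemma inc_cat1 B v j : (j < size B)%N -> inc (B ++ v) j = inc B j ++ v.
Proof.
rewrite /inc => lt; rewrite nth_cat lt; move: (nthZ B j + 1) => y.
by elim: B j lt => // c B IH [|j] //= lt; rewrite IH.
Qed.

Lemma inc_mid u B v j : (j < size B)%N ->
  inc (u ++ B ++ v) (size u + j) = u ++ inc B j ++ v.
Proof.
move=> lt; rewrite -inc_cat1 // /inc nth_cat ltnNge leq_addr /= addKn.
by move: (nthZ _ _ + 1) => y; elim: u => //= x u ->.
Qed.

Lemma go_refl pi u v Bi : go pi u v Bi Bi.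
Proof. by move=> m _; split=> //; apply: nonred0. Qed.

Lemma go_trans pi u v B1 B2 B3 : (B2.2 < size B2.1)%N ->
  go pi u v B1 B2 -> go pi u v B2 B3 -> go pi u v B1 B3.
Proof.
move=> lt h1 h2 m l; have [m2 s2] := h1 m l; have [m3 s3] := h2 m2 lt.
by split=> //; apply: nonred_trans s2 s3.
Qed.

(** Letters whose deletions agree are both marks; a word with two marks is not reduced, and its push
    raises the other one. *)
Lemma go_other pi u v B i j : (j < size B)%N -> i <> j ->
  eqB u (delete i B) (delete j B) -> go pi u v (B, i) (inc B j, j).
Proof.
move=> lj ne E /= m li; have mj := marks_in erefl li lj E m.
have ne' : (size u + i)%N <> (size u + j)%N by lia.
have [r _] := marks_two m mj ne'.
have Hf := fpush_other m mj (nesym ne'); rewrite inc_mid // in Hf.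
split; first by rewrite -inc_mid //; apply/marks_set => //; apply: marks_lt mj.
by rewrite -Hf; apply: nonred1.
Qed.

(** A marked letter of an initial block that does not change the involution makes the word
    semi-reduced, so the same letter is raised again. *)
Lemma go_semi pi v B i : conj_fpf B = conj_fpf (delete i B) -> go pi [::] v (B, i) (inc B i, i).
Proof.
move=> E m li; rewrite /= add0n in m li *.
have EC : conj_fpf (B ++ v) = pi.
  by case: m => _ _ <-; rewrite delete_cat1 // conj_fpf_cat E conj_fpf_cat.
have r : red (B ++ v) = false.
  apply/negP => r; case: m => lt _ E'; have := red_min r (w' := delete i (B ++ v)).
  by rewrite E' EC size_delete // => /(_ erefl); lia.
have Hf := fpush_fix m (or_intror EC).
have Ei : inc (B ++ v) i = inc B i ++ v by apply: (@inc_mid [::]).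
rewrite Ei in Hf; split; first by rewrite -Ei; apply/marks_set => //; apply: marks_lt m.
by rewrite -Hf; apply: nonred1.
Qed.

(* After the corresponding letters of two related blocks have been pushed, a
   few more pushes, through words that are not reduced, make the blocks
   related again. *)
Definition resync t pi u v (Bi Bi' : seq int * nat) : Prop :=
  exists B1 B1' phi j, [/\ block t u B1 B1' phi, (j < size B1)%N,
    go pi u v Bi (B1, j) & go pi u v Bi' (B1', nth 0%N phi j)].

Lemma resync_sym t pi u v Bi Bi' : resync t pi u v Bi Bi' -> resync t pi u v Bi' Bi.
Proof.
move=> [B1 [B1' [phi [j [H lt g g']]]]]; have [S _ _] := block_size H.
have [l1 l2] := block_phi H lt.
exists B1', B1, phi, (nth 0%N phi j); split; rewrite ?S ?l2 //; exact: block_sym.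
Qed.

(** Unless the raised letter meets the next value, the same relation persists. If it does, the equal
    letters are both marks and another push raises the other copy. For three consecutive values,
    raising a turns the block into a braid, and only the first word is pushed again. *)
Lemma resync_bac pi u v (a b c : int) j : a < b -> b < c -> (j < 3)%N ->
  resync true pi u v (inc [:: b; a; c] j, j)
    (inc [:: b; c; a] (nth 0%N [:: 0; 2; 1]%N j), nth 0%N [:: 0; 2; 1]%N j).
Proof.
move=> ab bc; case: j => [|[|[|//]]] _; rewrite /inc /=.
- have [lt|ge] := ltrP (b + 1) c.
    exists [:: b + 1; a; c], [:: b + 1; c; a], [:: 0; 2; 1]%N, 0%N.
    by split=> //; try exact: go_refl; apply: BlkBac; lia.
  have -> : b + 1 = c by lia.
  exists [:: c; a; c + 1], [:: c; c + 1; a], [:: 0; 2; 1]%N, 2%N; split=> //.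
  + by apply: BlkBac; lia.
  + by apply: (@go_other _ _ _ [:: c; a; c] 0 2) => //; left; apply: word_perm_comm; lia.
  + by apply: (@go_other _ _ _ [:: c; c; a] 0 1) => //; left.
- have [lt|ge] := ltrP (a + 1) b.
    exists [:: b; a + 1; c], [:: b; c; a + 1], [:: 0; 2; 1]%N, 1%N.
    by split=> //; try exact: go_refl; apply: BlkBac; lia.
  have -> : a + 1 = b by lia.
  have G : go pi u v ([:: b; b; c], 1%N) ([:: b + 1; b; c], 0%N).
    by apply: (@go_other _ _ _ [:: b; b; c] 1 0) => //; left.
  have [lt|ge'] := ltrP (b + 1) c.
    exists [:: b + 1; b; c], [:: b + 1; c; b], [:: 0; 2; 1]%N, 0%N; split=> //.
      by apply: BlkBac; lia.
    by apply: (@go_other _ _ _ [:: b; c; b] 2 0) => //; left; apply: word_perm_comm; lia.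
  have Ec : c = b + 1 by lia.
  rewrite Ec in G *; exists [:: b + 1; b; b + 1], [:: b; b + 1; b], [:: 2; 1; 0]%N, 0%N.
  by split=> //; [exact: BlkBab|exact: go_refl].
- exists [:: b; a; c + 1], [:: b; c + 1; a], [:: 0; 2; 1]%N, 2%N.
  by split=> //; try exact: go_refl; apply: BlkBac; lia.
Qed.

Lemma resync_acb pi u v (a b c : int) j : a < b -> b < c -> (j < 3)%N ->
  resync true pi u v (inc [:: a; c; b] j, j)
    (inc [:: c; a; b] (nth 0%N [:: 1; 0; 2]%N j), nth 0%N [:: 1; 0; 2]%N j).
Proof.
move=> ab bc; case: j => [|[|[|//]]] _; rewrite /inc /=.
- have [lt|ge] := ltrP (a + 1) b.
    exists [:: a + 1; c; b], [:: c; a + 1; b], [:: 1; 0; 2]%N, 0%N.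
    by split=> //; try exact: go_refl; apply: BlkAcb; lia.
  have -> : a + 1 = b by lia.
  have G : go pi u v ([:: c; b; b], 1%N) ([:: c; b; b + 1], 2%N).
    by apply: (@go_other _ _ _ [:: c; b; b] 1 2) => //; left.
  have [lt|ge'] := ltrP (b + 1) c.
    exists [:: b; c; b + 1], [:: c; b; b + 1], [:: 1; 0; 2]%N, 2%N; split=> //.
      by apply: BlkAcb; lia.
    by apply: (@go_other _ _ _ [:: b; c; b] 0 2) => //; left; apply: word_perm_comm; lia.
  have Ec : c = b + 1 by lia.
  rewrite Ec in G *; exists [:: b; b + 1; b], [:: b + 1; b; b + 1], [:: 2; 1; 0]%N, 0%N.
  by split=> //; [exact: BlkAba|exact: go_refl].
- exists [:: a; c + 1; b], [:: c + 1; a; b], [:: 1; 0; 2]%N, 1%N.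
  by split=> //; try exact: go_refl; apply: BlkAcb; lia.
- have [lt|ge] := ltrP (b + 1) c.
    exists [:: a; c; b + 1], [:: c; a; b + 1], [:: 1; 0; 2]%N, 2%N.
    by split=> //; try exact: go_refl; apply: BlkAcb; lia.
  have -> : b + 1 = c by lia.
  exists [:: a; c + 1; c], [:: c + 1; a; c], [:: 1; 0; 2]%N, 1%N; split=> //.
  + by apply: BlkAcb; lia.
  + by apply: (@go_other _ _ _ [:: a; c; c] 2 1) => //; left.
  + by apply: (@go_other _ _ _ [:: c; a; c] 2 0) => //; left; apply: word_perm_comm; lia.
Qed.

(** Raising an end letter of a braid creates two equal letters in one of the words; one more push
    there leaves three distinct letters, and the braid dissolves into a Coxeter-Knuth block. *)
Lemma resync_aba pi u v (a : int) j : j <> 1%N -> (j < 3)%N ->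
  resync true pi u v (inc [:: a; a + 1; a] j, j)
    (inc [:: a + 1; a; a + 1] (nth 0%N [:: 2; 1; 0]%N j), nth 0%N [:: 2; 1; 0]%N j).
Proof.
case: j => [|[|[|//]]] // _ _; rewrite /inc /=.
- exists [:: a + 1; a + 1 + 1; a], [:: a + 1; a; a + 1 + 1], [:: 0; 2; 1]%N, 1%N; split=> //.
  + by apply: BlkBca; lia.
  + by apply: (@go_other _ _ _ [:: a + 1; a + 1; a] 0 1) => //; left.
  + exact: go_refl.
- exists [:: a; a + 1 + 1; a + 1], [:: a + 1 + 1; a; a + 1], [:: 1; 0; 2]%N, 1%N; split=> //.
  + by apply: BlkAcb; lia.
  + by apply: (@go_other _ _ _ [:: a; a + 1; a + 1] 2 1) => //; left.
  + exact: go_refl.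
Qed.

Lemma even_inc2 (x : int) : (2 %| x)%Z -> (2 %| x + 1 + 1)%Z.
Proof. by rewrite !dvd2E; lia. Qed.

Lemma even_odd (x : int) : (2 %| x)%Z -> (2 %| x + 1)%Z = false.
Proof. by rewrite !dvd2E; lia. Qed.

(** The raised letter is odd, acts trivially at the front even after commuting past y, and is raised
    again. If y = x + 2 this would collide with y, and the words become y (y + 1) and y (y - 1)
    instead. *)
Lemma resync_xy pi v (x y : int) : (2 %| x)%Z -> (2 %| y)%Z -> x <> y ->
  resync false pi [::] v ([:: x + 1; y], 0%N) ([:: y; x + 1], 1%N).
Proof.
move=> ex ey ne; have ox := even_odd ex.
have G : go pi [::] v ([:: x + 1; y], 0%N) ([:: x + 1 + 1; y], 0%N).
  by apply: (@go_semi _ _ [:: x + 1; y] 0); rewrite conj_fpf_odd.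
have [ey2|/eqP ny2] := eqVneq y (x + 1 + 1).
  exists [:: y; y + 1], [:: y; y - 1], [:: 0; 1]%N, 1%N; split=> //.
  - by split=> //; apply: BlkUp.
  - apply: (go_trans _ G) => //; rewrite -ey2.
    by apply: (@go_other _ _ _ [:: y; y] 0 1) => //; left.
  - have -> : x + 1 = y - 1 by lia.
    exact: go_refl.
exists [:: x + 1 + 1; y], [:: y; x + 1 + 1], [:: 1; 0]%N, 0%N; split=> //.
  by split=> //; apply: BlkXY => //; [apply: even_inc2|apply: nesym].
apply: (@go_semi _ _ [:: y; x + 1] 1); rewrite /delete /=.
have E : word_perm [:: y; x + 1] = word_perm [:: x + 1; y].
  by apply: word_perm_comm; move: ex ey; rewrite !dvd2E; lia.
by rewrite {1}/conj_fpf (conjw_P _ E); apply: conj_fpf_odd.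
Qed.

(** The second word passes from x x to (x + 1) x, whose odd front letter acts trivially, and on to
    (x + 2) x; the first is already x (x + 2). *)
Lemma resync_up pi v (x y z : int) : (2 %| x)%Z -> y = x + 1 -> z = x - 1 ->
  resync false pi [::] v ([:: x; y + 1], 1%N) ([:: x; z + 1], 1%N).
Proof.
move=> ex -> ->; have -> : x - 1 + 1 = x by lia.
have ox := even_odd ex; have ex2 := even_inc2 ex.
exists [:: x; x + 1 + 1], [:: x + 1 + 1; x], [:: 1; 0]%N, 1%N; split=> //.
- by split=> //; apply: BlkXY => //; lia.
- exact: go_refl.
apply: (@go_trans _ _ _ _ ([:: x + 1; x], 0%N)) => //.
  by apply: (@go_other _ _ _ [:: x; x] 1 0) => //; left.
by apply: (@go_semi _ _ [:: x + 1; x] 0); rewrite conj_fpf_odd.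
Qed.

Lemma resyncP t pi u v B B' phi j : block t u B B' phi -> (j < size B)%N ->
  marks pi (u ++ B ++ v) (size u + j) ->
  resync t pi u v (inc B j, j) (inc B' (nth 0%N phi j), nth 0%N phi j).
Proof.
(* The middle letter of a braid is never a mark, since its deletion leaves a square. *)
have braid_mid (a b : int) : marks pi (u ++ [:: a; b; a] ++ v) (size u + 1) -> False.
  move=> [_]; rewrite delete_cat2 -[delete 1 _]/(a :: a :: v) => r _.
  have := red_adj r (k := size u).
  rewrite size_cat !nth_cat ltnn subnn.
  have -> : ((size u).+1 < size u)%N = false by lia.
  by rewrite subSnn /= => H; apply: H => //; lia.
(* The even first letter is not a mark when an odd letter follows, since no reduced word begins with
   an odd letter. *)
have start_odd (x y : int) : (2 %| y)%Z = false -> marks pi ([:: x; y] ++ v) 0 -> False.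
  move=> oy [_]; rewrite -[delete 0 _]/(y :: v) => /andP[+ _] _.
  by rewrite /one_fpf oy; move: oy; rewrite !dvd2E; splits; lia.
case: t => [H|[u0 H]].
  case: H => [a b c ab bc|a b c ab bc|a b c ab bc|a b c ab bc|a b ->|a b ->] lt m.
  - exact: resync_bac.
  - case: j lt {m} => [|[|[|]]] // _; apply: resync_sym.
    + exact: (@resync_bac pi u v a b c 0).
    + exact: (@resync_bac pi u v a b c 2).
    + exact: (@resync_bac pi u v a b c 1).
  - exact: resync_acb.
  - case: j lt {m} => [|[|[|]]] // _; apply: resync_sym.
    + exact: (@resync_acb pi u v a b c 1).
    + exact: (@resync_acb pi u v a b c 0).
    + exact: (@resync_acb pi u v a b c 2).
  - by apply: resync_aba => // j1; apply: (braid_mid a (a + 1)); rewrite -j1.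
  - case: j lt m => [|[|[|]]] // _ m; try by case: (braid_mid _ _ m).
    + by apply: resync_sym; apply: (@resync_aba pi u v a 2).
    + by apply: resync_sym; apply: (@resync_aba pi u v a 0).
case: H => [x y ex ey ne|x y z ex ey ez|x y z ex ey ez] lt m.
- subst u; case: j lt {m} => [|[|]] // _; first exact: resync_xy.
  by apply: resync_sym; apply: resync_xy => //; apply: nesym.
- subst u; case: j lt m => [|[|]] // _ m.
    by case: (start_odd x y) => //; rewrite ey even_odd.
  exact: resync_up.
- subst u; case: j lt m => [|[|]] // _ m.
    by case: (start_odd x z) => //; rewrite ez; move: ex; rewrite !dvd2E; lia.
  by apply: resync_sym; apply: resync_up.
Qed.

(* [moved t k w w']: [w'] is obtained from [w] by a Coxeter-Knuth move on the
   letters at positions k, k+1, k+2 (t = true) or by the initial symplectic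
   move on the first two letters (t = false). *)
Definition moved (t : bool) (k : nat) (w w' : seq int) : Prop :=
  exists u B B' phi v, [/\ size u = k, w = u ++ B ++ v, w' = u ++ B' ++ v
    & block t u B B' phi].

Definition related t k (p p' : seq int * nat) : Prop :=
  exists u B B' phi v, [/\ size u = k, p.1 = u ++ B ++ v, p'.1 = u ++ B' ++ v,
    p'.2 = shift_phi (size u) B phi p.2 & block t u B B' phi].

Lemma moved_sym t k w w' : moved t k w w' -> moved t k w' w.
Proof.
by move=> [u [B [B' [phi [v [? ? ? /block_sym ?]]]]]]; exists u, B', B, phi, v.
Qed.

Lemma moved_size t k w w' : moved t k w w' -> size w' = size w.
Proof.
by move=> [u [B [B' [phi [v [_ -> -> /block_size[S _ _]]]]]]]; rewrite !size_cat S.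
Qed.

Lemma moved_C t k w w' : moved t k w w' -> conj_fpf w' = conj_fpf w.
Proof.
by move=> [u [B [B' [phi [v [_ -> -> /block_eqB H]]]]]]; symmetry; apply: eqB_C H _.
Qed.

Lemma moved_red t k w w' : moved t k w w' -> red w = red w'.
Proof.
move=> m; have [S E] := (moved_size m, moved_C m).
apply/idP/idP => r; [exact: (red_same_size r E S)|].
exact: (red_same_size r (esym E) (esym S)).
Qed.

Lemma related_moved t k p p' : related t k p p' -> moved t k p.1 p'.1.
Proof. by move=> [u [B [B' [phi [v [? ? ? _ ?]]]]]]; exists u, B, B', phi, v. Qed.

Lemma related_mkp t k pi p p' : related t k p p' -> marked_pair pi p -> marked_pair pi p'.
Proof.
case: p p' => w i [w' i'] [u [B [B' [phi [v [_ /= -> -> -> H]]]]]].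
exact: (marks_shift H).
Qed.

Lemma fpush_shift t pi u v B B' phi i j : block t u B B' phi ->
  marks pi (u ++ B ++ v) i -> marks pi (u ++ B ++ v) j ->
  (j <> i) \/ (j = i /\ forall j, marks pi (u ++ B ++ v) j -> j = i) ->
  let f := shift_phi (size u) B phi in
  fpush pi (u ++ B' ++ v, f i) = (inc (u ++ B' ++ v) (f j), f j).
Proof.
move=> H mi mj hj f; have mi' := marks_shift H mi; have mj' := marks_shift H mj.
case: hj => [ne|[-> A]].
  apply: fpush_other => // e; apply: ne.
  by rewrite -(shiftK j H) [shift_phi _ B _ j]e (shiftK i H).
apply: fpush_alone => // k /(marks_shift (block_sym H)) m.
by rewrite /f -(A _ m) -{1}(shiftK k (block_sym H)).
Qed.

Lemma related_step t k pi p p' : related t k p p' -> marked_pair pi p ->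
  exists q q', [/\ nonred_steps pi (fpush pi p) q, nonred_steps pi (fpush pi p') q'
    & related t k q q'].
Proof.
case: p p' => w i [w' i'] [u [B [B' [phi [v [Su Ew Ew' Ei H]]]]]] mi.
rewrite /= in Ew Ew' Ei; subst w w' i'.
change (marks pi (u ++ B ++ v) i) in mi; have [S _ _] := block_size H.
have [j [mj Ef hj]] := fpushP mi; rewrite Ef (fpush_shift H mi mj hj).
have [|nin] := boolP (size u <= j < size u + size B)%N.
  move=> /in_split[l lt Ej]; rewrite Ej in mj *; have [l1 l2] := block_phi H lt.
  have mj' := marks_shift H mj; rewrite shift_in // in mj' *.
  have [B1 [B1' [phi1 [j1 [H1 lt1 g g']]]]] := resyncP H lt mj.
  have Si X n : (n < size X)%N -> (n < size (inc X n))%N.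
    by move=> ltn; rewrite size_set_in.
  have [|//|_ s1] := g; [|exact: Si|].
    by rewrite /= -inc_mid //; apply/marks_set => //; apply: marks_lt mj.
  have [|/=|_ s1'] := g'; [|by apply: Si; rewrite S|].
    by rewrite /= -inc_mid ?S //; apply/marks_set => //; apply: marks_lt mj'.
  rewrite !inc_mid ?S //; exists (u ++ B1 ++ v, (size u + j1)%N).
  exists (u ++ B1' ++ v, (size u + nth 0%N phi1 j1)%N); split=> //.
  by exists u, B1, B1', phi1, v; split=> //=; rewrite shift_in.
rewrite shift_out //; exists (inc (u ++ B ++ v) j, j), (inc (u ++ B' ++ v) j, j).
split; try exact: nonred0.
have lj := marks_lt mj; rewrite !size_cat in lj.
have [lt|ge] := ltnP j (size u).
  exists (inc u j), B, B', phi, v; split=> //=; rewrite ?inc_cat1 ?size_set_in //.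
    by rewrite shift_out.
  by case: t H => // -[u0 _]; rewrite u0 in lt.
pose l := (j - size u - size B)%N; have lv : (l < size v)%N by rewrite /l; lia.
have -> : j = (size u + (size B + l))%N by rewrite /l; lia.
exists u, B, B', phi, (inc v l).
have E X : size X = size B ->
    inc (u ++ X ++ v) (size u + (size B + l)) = u ++ X ++ inc v l.
  move=> SX; have := @inc_mid (u ++ X) v [::] l lv; rewrite !cats0 size_cat SX -!catA addnA.
  by [].
by split=> //=; rewrite ?E ?shift_out //; lia.
Qed.

Definition returns pi N p q : Prop := [/\ (0 < N)%N, iter N (fpush pi) p = q, red q.1
    & forall m, (0 < m < N)%N -> red (iter m (fpush pi) p).1 = false].

(** Induction on the length of the run, which is cut at the synchronised pairs. The words between
    them are not reduced and related words are reduced together, so the first returns match even if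
    the numbers of pushes differ. *)
Lemma returns_related t k pi N p p' q : related t k p p' -> marked_pair pi p ->
  returns pi N p q -> exists N' q', returns pi N' p' q' /\ related t k q q'.
Proof.
have [n] := ubnP N; elim: n N p p' => // n IH N p p' ltn R m [N0 E rq H].
have [q1 [q1' [[a Ea Ha] [b Eb Hb] R1]]] := related_step R m.
have Ea' : iter a.+1 (fpush pi) p = q1 by rewrite iterSr.
have Eb' : iter b.+1 (fpush pi) p' = q1' by rewrite iterSr.
have ltN : (a < N)%N.
  rewrite ltnNge; apply/negP => le; have lt' : (N.-1 < a)%N by lia.
  by have := Ha _ lt'; rewrite -iterSr prednK // E rq.
have m1 : marked_pair pi q1 by rewrite -Ea'; apply: marked_pair_iter.
have R1r := moved_red (related_moved R1).
have Hb' l : (0 < l < b.+1)%N -> red (iter l (fpush pi) p').1 = false.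
  by case: l => // l lt; rewrite iterSr; apply: Hb.
have [Na|ltN1] := leqP N a.+1.
  have EN : N = a.+1 by lia.
  exists b.+1, q1'; rewrite -E EN Ea'; split=> //; split=> //.
  by rewrite -R1r -Ea' -EN E.
have [||N2 [q' [[N20 E2 rq' H2] R2]]] := IH (N - a.+1)%N q1 q1' _ R1 m1.
- by lia.
- split=> //; first lia.
    by rewrite -Ea' -iterD subnK.
  move=> l lt; rewrite -Ea' -iterD; apply: H; lia.
- exists (N2 + b.+1)%N, q'; split=> //; split=> //; first lia.
    by rewrite iterD Eb'.
  move=> l lt; have [le|gt] := leqP l b; first by apply: Hb'; lia.
  rewrite -(subnK gt) iterD Eb'.
  have [e|pos] := posnP (l - b.+1)%N; last by apply: H2; lia.
  by rewrite e /= -R1r -Ea'; apply: H; lia.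
Qed.

Theorem fb_moved t k pi w w' : red w -> moved t k w w' ->
  moved t k (fb pi w) (fb pi w').
Proof.
move=> r mv; have r' : red w' by rewrite -(moved_red mv).
case: (fb_cases pi r) => [N|[i [q F]]].
  rewrite !fb_unmarked // => i m.
  have [u [B [B' [phi [v [_ Ew Ew' H]]]]]] := moved_sym mv.
  by rewrite Ew in m; apply: (N _); rewrite Ew'; apply: (marks_shift H m).
have [u [B [B' [phi [v [Su Ew Ew' H]]]]]] := mv.
have R : related t k (w, i) (w', shift_phi (size u) B phi i).
  by exists u, B, B', phi, v.
rewrite (fb_first_return F); case: F => mp _ rq [N [N0 E HN]].
have [|N' [q' [[N0' E' rq' H'] R']]] := returns_related R mp (N := N) (q := q).
  by split=> // m /HN/negbTE.
rewrite (@fb_first_return pi w' (shift_phi (size u) B phi i) q').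
  exact: related_moved R'.
split=> //; first exact: related_mkp R mp.
by exists N'; split=> // m /H' ->.
Qed.

(** * Row insertion by Coxeter-Knuth moves *)

(** Makes a move of given type and position a partial function, so that a list of positions
    determines the outcome of a sequence of moves. *)
Lemma block_det t u B B1 B2 phi1 phi2 :
  block t u B B1 phi1 -> block t u B B2 phi2 -> B1 = B2.
Proof.
case: t => [|[_ H1] [_ H2]].
  move=> H1 H2; case: H1 H2 => [a b c ab bc|a b c ab bc|a b c ab bc|a b c ab bc
    |a b ab|a b ab] H2; inversion H2; subst; try (exfalso; lia); by [].
case: H1 H2 => [x y ex ey ne|x y z ex ey ez|x y z ex ey ez] H2; inversion H2; subst;
  try by []; exfalso; repeat match goal with H : is_true (2 %| _)%Z |- _ =>
    move: H; rewrite dvd2E => ? end; lia.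
Qed.

Lemma moved_det t k w w1 w2 : moved t k w w1 -> moved t k w w2 -> w1 = w2.
Proof.
move=> [u [B [B' [phi [v [Su -> -> H]]]]]] [u1 [B1 [B1' [phi1 [v1 [Su1 E -> H1]]]]]].
have Eu : u = u1.
  by move: (congr1 (take k) E); rewrite -{1}Su -Su1 !take_size_cat.
subst u1; have {}E : B ++ v = B1 ++ v1.
  by move: (congr1 (drop k) E); rewrite -Su !drop_size_cat.
have SB : size B = size B1.
  case: t H H1 => [H H1|[_ H] [_ H1]].
    by case: H => *; case: H1.
  by case: H => *; case: H1.
have EB : B = B1 by move: (congr1 (take (size B)) E); rewrite {2}SB !take_size_cat.
have Ev : v = v1 by move: (congr1 (drop (size B)) E); rewrite {2}SB !drop_size_cat.
by subst B1 v1; rewrite (block_det H H1).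
Qed.

(** * Sequences of Coxeter-Knuth moves at prescribed positions *)

Fixpoint chain (ks : seq nat) (w w' : seq int) : Prop :=
  if ks is k :: ks' then exists2 w1, moved true k w w1 & chain ks' w1 w' else w = w'.

Lemma chain_cat ks ks' w w1 w' : chain ks w w1 -> chain ks' w1 w' -> chain (ks ++ ks') w w'.
Proof.
by elim: ks w => [|k ks IH] w /= => [->|[w2 m c] c']; last by exists w2 => //; apply: IH.
Qed.

Lemma chain_rcons ks k w w1 w' : chain ks w w1 -> moved true k w1 w' -> chain (rcons ks k) w w'.
Proof. by move=> c m; rewrite -cats1; apply: (chain_cat c); exists w'. Qed.

Lemma chain_sym ks w w' : chain ks w w' -> chain (rev ks) w' w.
Proof.
elim: ks w => [|k ks IH] w /=; first by move=> ->.
by case=> w1 /moved_sym m /IH c; rewrite rev_cons; apply: chain_rcons c m.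
Qed.

Lemma chain_det ks w w1 w2 : chain ks w w1 -> chain ks w w2 -> w1 = w2.
Proof.
elim: ks w => [|k ks IH] w /=; first by move=> <-.
case=> x m c [y m' c']; move: (moved_det m m') => E; subst y; exact: IH c c'.
Qed.

Lemma chain_det_r ks w1 w2 w : chain ks w1 w -> chain ks w2 w -> w1 = w2.
Proof. by move=> /chain_sym c /chain_sym c'; apply: chain_det c c'. Qed.

Lemma chain_red ks w w' : chain ks w w' -> red w = red w'.
Proof. by elim: ks w => [|k ks IH] w /=; [move=> ->|case=> w1 /moved_red -> /IH]. Qed.

Lemma chain_size ks w w' : chain ks w w' -> size w' = size w.
Proof. by elim: ks w => [|k ks IH] w /=; [move=> ->|case=> w1 /moved_size <- /IH]. Qed.

Lemma chain_fb pi ks w w' : red w -> chain ks w w' -> chain ks (fb pi w) (fb pi w').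
Proof.
elim: ks w => [|k ks IH] w r /=; first by move=> ->.
case=> w1 m c; exists (fb pi w1); first exact: fb_moved.
by apply: IH => //; rewrite -(moved_red m).
Qed.

(** * Edelman-Greene insertion *)

Notation lt_sorted := (sorted (fun a b : int => a < b)).
Notation lt_path := (path (fun a b : int => a < b)).

Lemma ltZ_trans : transitive (fun a b : int => a < b).
Proof. by move=> y x z; apply: lt_trans. Qed.

Lemma lt_pathP (x : int) s : lt_path x s = all (fun y => x < y) s && lt_sorted s.
Proof. by rewrite path_sortedE //; apply: ltZ_trans. Qed.

(* Edelman-Greene insertion of [z] into the row [R]: the bumped letter and the
   new row. *)
Fixpoint eg (R : seq int) (z : int) : int * seq int :=
  if R is r :: R' then
    if z < r then (r, z :: R')
    else if z == r then (z + 1, r :: R')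
    else ((eg R' z).1, r :: (eg R' z).2)
  else (z, [::]).

Lemma size_eg R z : size (eg R z).2 = size R.
Proof. by elim: R => //= r R IH; case: ifP => //; case: ifP => //= _ _; rewrite IH. Qed.

Lemma eg_row (r : int) R z : lt_path r R -> r < z -> z < last r R ->
  lt_path r (eg R z).2 /\ nthZ (eg R z).2 0 < (eg R z).1.
Proof.
elim: R r => [|r1 R IH] r /=; first by move=> _; lia.
move=> /andP[rr1 p] rz zl; case: (ltrgtP z r1) => [zr|zr|->] /=.
- rewrite rz; split=> //; case: R p {IH zl} => //= r2 R /andP[h ->].
  by rewrite andbT; lia.
- have [h1 h2] := IH _ p zr zl; rewrite rr1; split=> //.
  have := size_eg R z; case: (eg R z) h1 h2 => c [|h T] /=; last by move=> /andP[]; lia.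
  by move=> _ _ /esym/size0nil e; move: zl; rewrite e /=; lia.
- by rewrite rr1 p; split=> //; lia.
Qed.

Lemma eg_sorted R z : lt_sorted R -> z < last z R -> lt_sorted (eg R z).2.
Proof.
case: R => //= r R p zl; case: (ltrgtP z r) => [zr|zr|->] //=.
  by case: R p {zl} => //= r2 R /andP[h ->]; rewrite andbT; lia.
by have [] := eg_row p zr zl.
Qed.

Lemma last_lt_path (r : int) R : lt_path r R -> R != [::] -> r < last r R.
Proof.
case: R => //= r1 R /andP[h p] _; elim: R r1 h p => //= r2 R IH r1 h /andP[h2 p].
by apply: IH => //; lia.
Qed.

Lemma last_change (z r : int) (R : seq int) : R != [::] -> last z R = last r R.
Proof. by case: R. Qed.

(** The letter z travels left past the larger entries, and from its landing place on the bumped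
    letter travels left. Each position is used once wherever z lands, so the list of positions
    depends only on the place and the length of the row. *)
Lemma eg_chain u R z v : lt_sorted R -> z < last z R -> (z \in R -> z + 1 \in R) ->
  chain (rev (iota (size u) (size R).-1)) (u ++ R ++ z :: v)
    (u ++ (eg R z).1 :: (eg R z).2 ++ v).
Proof.
elim: R u => [|r R IH] u; first by rewrite /=; lia.
case: R IH => [|r2 R] IH p; first by rewrite /= => ->.
rewrite [last _ _]/= => zl ok; have p2 : lt_sorted (r2 :: R) by case/andP: p.
have rr2 : r < r2 by case/andP: p.
have p3 : all (fun y => r < y) (r2 :: R) by move: p; rewrite /sorted lt_pathP => /andP[].
have -> : rev (iota (size u) (size (r :: r2 :: R)).-1) =
  rcons (rev (iota (size (rcons u r)) (size (r2 :: R)).-1)) (size u).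
  by rewrite size_rcons /= rev_cons.
have ok2 : z \in r2 :: R -> z + 1 \in r2 :: R.
  move=> zR; have := ok; rewrite inE zR orbT => /(_ isT).
  have /= := allP p3 _ zR; rewrite inE => rz /orP[/eqP e|//]; lia.
have c := IH (rcons u r) p2 zl ok2; rewrite !cat_rcons in c.
apply: chain_rcons c _; have [zr|zr|zr] := ltrgtP z r.
- have zr2 : z < r2 by lia.
  rewrite /= zr zr2; exists u, [:: r; r2; z], [:: r; z; r2], [:: 0; 2; 1]%N, (R ++ v).
  by split=> //; apply: BlkBca.
- have zR : ~~ (z < r) by lia.
  have [h1 h2] : lt_path r (eg (r2 :: R) z).2 /\
     nthZ (eg (r2 :: R) z).2 0 < (eg (r2 :: R) z).1 by apply: eg_row.
  have := size_eg (r2 :: R) z; rewrite [eg [:: r, r2 & R] z]/= (negbTE zR).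
  have -> : (z == r) = false by apply/eqP; lia.
  rewrite -/(eg (r2 :: R) z).
  move: h1 h2; case: (eg (r2 :: R) z) => x [|h T] //= /andP[rh _] hx _.
  exists u, [:: r; x; h], [:: x; r; h], [:: 1; 0; 2]%N, (T ++ v).
  by split=> //; apply: BlkAcb.
- have e2 : r2 = z + 1.
    have := ok; rewrite zr mem_head inE => /(_ isT) /orP[/eqP|]; first lia.
    rewrite inE => /orP[/eqP //|h]; have := p2; rewrite /sorted lt_pathP => /andP[/allP H _].
    by have /= := H _ h; lia.
  have zr2 : z < r2 by lia.
  rewrite /= zr2 zr ltxx eqxx; exists u, [:: r; r2; r], [:: r2; r; r2], [:: 2; 1; 0]%N, (R ++ v).
  by split=> //; rewrite ?e2 ?zr //; apply: BlkAba.
Qed.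

Fixpoint egs (R bs : seq int) : seq int * seq int :=
  if bs is z :: bs' then
    ((eg R z).1 :: (egs (eg R z).2 bs').1, (egs (eg R z).2 bs').2)
  else ([::], R).

(** Each letter bumps instead of extending the row, and an entry equal to it is accompanied by its
    successor, which makes the braid move available. *)
Fixpoint insertable (R bs : seq int) : Prop :=
  if bs is z :: bs' then
    [/\ z < last z R, z \in R -> z + 1 \in R & insertable (eg R z).2 bs']
  else True.

Fixpoint ins_moves (k m q : nat) : seq nat :=
  if q is q'.+1 then rev (iota k m.-1) ++ ins_moves k.+1 m q' else [::].

Lemma egs_chain u R bs v : lt_sorted R -> insertable R bs ->
  chain (ins_moves (size u) (size R) (size bs)) (u ++ R ++ bs ++ v)
    (u ++ (egs R bs).1 ++ (egs R bs).2 ++ v).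
Proof.
elim: bs u R => [//|z bs IH] u R p [zl ok i].
rewrite [size (z :: bs)]/= [ins_moves _ _ _]/=.
apply: (chain_cat (w1 := u ++ (eg R z).1 :: (eg R z).2 ++ bs ++ v)).
  by have := eg_chain u (bs ++ v) p zl ok.
have := IH (rcons u (eg R z).1) (eg R z).2 (eg_sorted p zl) i.
by rewrite size_rcons size_eg !cat_rcons.
Qed.

Lemma egs_cat R b1 b2 : egs R (b1 ++ b2) =
  ((egs R b1).1 ++ (egs (egs R b1).2 b2).1, (egs (egs R b1).2 b2).2).
Proof.
elim: b1 R => [|z b1 IH] R /=; first by case: (egs R b2).
by rewrite IH.
Qed.

Lemma insertable_cat R b1 b2 :
  insertable R (b1 ++ b2) <-> insertable R b1 /\ insertable (egs R b1).2 b2.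
Proof.
elim: b1 R => [|z b1 IH] R /=; first by split=> // -[].
split=> [[h1 h2 /IH[h3 h4]]|[[h1 h2 h3] h4]]; first by split.
by split=> //; apply/IH.
Qed.

Lemma size_egs R bs : size (egs R bs).1 = size bs /\ size (egs R bs).2 = size R.
Proof.
by elim: bs R => //= z bs IH R; have [-> ->] := IH (eg R z).2; rewrite size_eg.
Qed.

Lemma red_no_square u (z : int) v : red (u ++ z :: z :: v) = false.
Proof.
apply/negP => r; have := red_adj r (k := size u).
rewrite size_cat !nth_cat ltnn subnn.
have -> : ((size u).+1 < size u)%N = false by lia.
by rewrite subSnn /= => H; apply: H => //; lia.
Qed.

(* In a reduced word the letter [z] following a row that contains [z] but not
   [z + 1] could be commuted back to the first [z]. *)
Lemma red_row_succ u R z v : lt_sorted R -> red (u ++ R ++ z :: v) ->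
  z \in R -> z + 1 \in R.
Proof.
move=> p r zR; case/splitPr: zR p r => R1 R2 p r.
have [_] := cat_sorted2 p; rewrite /sorted lt_pathP => /andP[/allP p2 _].
apply/negPn/negP; rewrite mem_cat inE !negb_or => /and3P[_ _ nR].
have E : word_perm (z :: R2) = word_perm (rcons R2 z).
  apply: word_perm_move => x xR; have /= := p2 x xR; have : x <> z + 1; last lia.
  by move=> e; move: nR; rewrite -e xR.
have EC := conj_fpf_P (u ++ R1) (z :: v) E.
have : red ((u ++ R1) ++ rcons R2 z ++ z :: v).
  apply: (red_same_size r); first by rewrite -EC -!catA.
  by rewrite !size_cat size_rcons /=; lia.
by rewrite cat_rcons catA red_no_square.
Qed.

(** The part of [insertable] that does not follow from reducedness; see [red_insertable]. *)
Fixpoint bumping (R bs : seq int) : Prop :=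
  if bs is z :: bs' then z < last z R /\ bumping (eg R z).2 bs' else True.

Lemma red_insertable u R bs v : lt_sorted R -> bumping R bs ->
  red (u ++ R ++ bs ++ v) -> insertable R bs.
Proof.
elim: bs u R => //= z bs IH u R p [zl b] r.
have ok : z \in R -> z + 1 \in R by apply: (@red_row_succ u R z (bs ++ v)).
split=> //; apply: (IH (rcons u (eg R z).1)) => //; first exact: eg_sorted.
by rewrite cat_rcons -(chain_red (eg_chain u (bs ++ v) p zl ok)).
Qed.

(** Describes q as the number of letters, out of the p that follow a row of m letters at position k,
    that are inserted before one fails to bump. After j insertions the end of the row and the next
    letter stand at positions k + m + j - 1 and k + m + j, and a descent there means that the letter
    bumps. *)
Definition insq (k m p : nat) (w : seq int) (q : nat) : Prop :=
  [/\ (q <= p)%N,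
    forall j, (j < q)%N -> exists2 T, chain (ins_moves k m j) w T &
      nthZ T (k + m + j) < nthZ T (k + m + j).-1 &
    (q < p)%N -> exists2 T, chain (ins_moves k m q) w T &
      nthZ T (k + m + q).-1 < nthZ T (k + m + q)].

Lemma nth_after u A B (z : int) v : nthZ (u ++ A ++ B ++ z :: v) (size u + size B + size A) = z.
Proof.
rewrite !catA nth_cat !size_cat; have -> : (size u + size B + size A < size u + size A + size B)%N = false by lia.
by have -> : (size u + size B + size A - (size u + size A + size B) = 0)%N by lia.
Qed.

Lemma nth_before u A B (z : int) v : B != [::] ->
  nthZ (u ++ A ++ B ++ z :: v) (size u + size B + size A).-1 = last z B.
Proof.
move=> nB; have pB : (0 < size B)%N by case: B nB.
rewrite !catA nth_cat !size_cat.
have -> : ((size u + size B + size A).-1 < size u + size A + size B)%N by lia.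
rewrite nth_cat size_cat.
have -> : ((size u + size B + size A).-1 < size u + size A)%N = false by lia.
have -> : ((size u + size B + size A).-1 - (size u + size A) = (size B).-1)%N by lia.
by rewrite nth_last; apply: last_change.
Qed.

Lemma insq_intro u R b1 b2 v : lt_sorted R -> R != [::] -> insertable R b1 ->
  (b2 != [::] -> last 0 (egs R b1).2 < head 0 b2) ->
  insq (size u) (size R) (size (b1 ++ b2)) (u ++ R ++ (b1 ++ b2) ++ v) (size b1).
Proof.
move=> p nR i L; have n0 (s : seq int) : size s = size R -> s != [::].
  by case: s => //; case: (R) nR.
split; first by rewrite size_cat leq_addr.
- move=> j lt; have lt' : (j < size b1)%N by [].
  have Eb : b1 = take j b1 ++ nthZ b1 j :: drop j.+1 b1 by exact: mid_nth.
  move: i; rewrite {1}Eb => /insertable_cat[i1 [zl _ _]].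
  have Sj : size (take j b1) = j by rewrite size_take lt.
  have [S1 S2] := size_egs R (take j b1).
  exists (u ++ (egs R (take j b1)).1 ++ (egs R (take j b1)).2 ++
     nthZ b1 j :: drop j.+1 b1 ++ b2 ++ v).
    have := @egs_chain u R (take j b1) (nthZ b1 j :: drop j.+1 b1 ++ b2 ++ v) p i1.
    by rewrite Sj [in X in _ ++ X ++ v]Eb -!catA.
  have -> : (size u + size R + j = size u + size (egs R (take j b1)).2 +
    size (egs R (take j b1)).1)%N by rewrite S1 S2 Sj.
  by rewrite nth_after nth_before //; apply: n0.
- rewrite size_cat; case: b2 L => [|z b2] L; first by rewrite addn0 ltnn.
  move=> _; have [S1 S2] := size_egs R b1.
  exists (u ++ (egs R b1).1 ++ (egs R b1).2 ++ z :: b2 ++ v).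
    by have := @egs_chain u R b1 (z :: b2 ++ v) p i; rewrite -!catA.
  have -> : (size u + size R + size b1 = size u + size (egs R b1).2 +
    size (egs R b1).1)%N by rewrite S1 S2.
  rewrite nth_after nth_before; last exact: n0.
  by rewrite (last_change z 0) ?L //; apply: n0.
Qed.

(** At the smaller of two distinct values one word would have an ascent and the other a descent at
    the same place after the same moves. *)
Lemma insq_fb_le pi k m p w q1 q2 : red w -> (k + m + p <= size w)%N -> (0 < m)%N ->
  insq k m p w q1 -> insq k m p (fb pi w) q2 -> q1 = q2.
Proof.
move=> r le m0 [l1 d1 a1] [l2 d2 a2].
have key T q : (q < p)%N -> chain (ins_moves k m q) w T ->
    (nthZ (fb pi T) (k + m + q).-1 < nthZ (fb pi T) (k + m + q)) =
    (nthZ T (k + m + q).-1 < nthZ T (k + m + q)).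
  move=> lt c; have := @fb_asc pi T (k + m + q).-1.
  rewrite -(chain_red c) prednK; last lia.
  by rewrite (chain_size c) => /(_ r) -> //; lia.
case: (ltngtP q1 q2) => // lt.
- have [|T c h] := a1; first lia; have [T' c' h'] := d2 _ lt.
  have := key T q1 _ c; rewrite h (chain_det (chain_fb pi r c) c') => H.
  by have : nthZ T' (k + m + q1).-1 < nthZ T' (k + m + q1) by [apply: H; lia]; lia.
- have [|T' c' h'] := a2; first lia; have [T c h] := d1 _ lt.
  have := key T q2 _ c; rewrite (chain_det (chain_fb pi r c) c') h' => H.
  by have : nthZ T (k + m + q2).-1 < nthZ T (k + m + q2) by [rewrite -H //; lia]; lia.
Qed.

(** * The pairing rule *)

Lemma lt_sorted_cat (s t : seq int) : lt_sorted (s ++ t) <->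
  [/\ lt_sorted s, lt_sorted t & forall x y, x \in s -> y \in t -> x < y].
Proof.
rewrite !(sorted_pairwise ltZ_trans) pairwise_cat.
split=> [/and3P[/allrelP H -> ->]//|[-> -> H]]; rewrite !andbT.
by apply/allrelP.
Qed.

Lemma leZ_trans : transitive leZ.
Proof. by move=> y x z; rewrite /leZ; apply: le_trans. Qed.

Lemma lt_sorted_leZ s : lt_sorted s -> sorted leZ s.
Proof. by apply: sub_sorted => x y; rewrite /leZ => /ltW. Qed.

Lemma sort_id s : lt_sorted s -> sort leZ s = s.
Proof. by move=> /lt_sorted_leZ; apply: (sorted_sort leZ_trans). Qed.

Lemma sort_perm s t : lt_sorted t -> perm_eq s t -> sort leZ s = t.
Proof.
move=> st pst; apply: (@sorted_eq _ leZ leZ_trans).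
- by move=> x y; rewrite /leZ => H; apply: le_anti.
- by apply: sort_sorted => x y; rewrite /leZ le_total.
- exact: lt_sorted_leZ.
- by rewrite (perm_trans _ pst) // perm_sort.
Qed.

Lemma minZ_sorted x s : lt_sorted (x :: s) -> minZ (x :: s) = x.
Proof. by move=> H; rewrite /minZ sort_id. Qed.

Lemma maxZ_sorted s : lt_sorted s -> maxZ s = last 0 s.
Proof. by move=> H; rewrite /maxZ sort_id. Qed.

Lemma rem_mid (s : seq int) x t : x \notin s -> rem x (s ++ x :: t) = s ++ t.
Proof.
elim: s => [|y s IH] /=; first by rewrite eqxx.
by rewrite inE negb_or eq_sym => /andP[/negbTE -> /IH ->].
Qed.

(** On a sorted word this removes the partner of y, the smallest larger letter. Reading the second
    word from its largest letter down then becomes plain recursion on that word. *)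
Fixpoint rmgt (y : int) (s : seq int) : seq int :=
  if s is x :: s' then if y < x then s' else x :: rmgt y s' else [::].
Definition pU (a b : seq int) : seq int := foldr rmgt a b.
Fixpoint pV (a b : seq int) : seq int :=
  if b is y :: b' then
    if has (fun x : int => y < x) (pU a b') then pV a b' else y :: pV a b'
  else [::].
Fixpoint matched (a b : seq int) : bool :=
  if b is y :: b' then matched a b' && has (fun x : int => y < x) (pU a b') else true.

Lemma rmgt_subseq y s : subseq (rmgt y s) s.
Proof.
elim: s => //= x s IH; case: ifP => _; first exact: subseq_cons.
by rewrite eqxx.
Qed.

Lemma pU_subseq a b : subseq (pU a b) a.
Proof. by elim: b => //= y b IH; apply: subseq_trans IH; apply: rmgt_subseq. Qed.

Lemma pV_subseq a b : subseq (pV a b) b.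
Proof.
elim: b => [|y b IH] //; rewrite [pV _ _]/=; case: ifP => _.
  by apply: (subseq_trans IH); apply: subseq_cons.
by rewrite /= eqxx.
Qed.

Lemma lt_subseq s t : subseq s t -> lt_sorted t -> lt_sorted s.
Proof. exact: (subseq_sorted ltZ_trans). Qed.

Lemma pair_stepE U V y : lt_sorted U ->
  pair_step (U, V) y = (rmgt y U, if has (fun x : int => y < x) U then V else y :: V).
Proof.
move=> sU; rewrite /pair_step has_filter.
have: lt_sorted [seq x <- U | y < x] by apply: lt_subseq sU; apply: filter_subseq.
case E : [seq x <- U | y < x] => [|x L] sL /=.
  congr (_, _); elim: U E {sU} => //= x U IH; case: ifP => // _ /IH {1}->//.
rewrite minZ_sorted //; congr (_, _).
elim: U E {sU sL} => //= z U IH; case: ifP => [_ [-> _]|nz E]; first by rewrite eqxx.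
case: eqP => [ez|_]; last by rewrite IH.
have : x \in [seq x <- U | y < x] by rewrite E mem_head.
by rewrite mem_filter -ez nz.
Qed.

Lemma unpairedE a b : lt_sorted a -> lt_sorted b -> unpaired a b = (pU a b, pV a b).
Proof.
move=> sa sb; rewrite /unpaired sort_id // foldl_rev.
elim: b {sb} => //= y b ->; rewrite pair_stepE //.
by apply: lt_subseq sa; apply: pU_subseq.
Qed.

Lemma pU_cat a b1 b2 : pU a (b1 ++ b2) = pU (pU a b2) b1.
Proof. exact: foldr_cat. Qed.

Lemma matched_cat a b1 b2 : matched a (b1 ++ b2) = matched a b2 && matched (pU a b2) b1.
Proof. by elim: b1 => /= [|y b1 ->]; rewrite ?andbT // pU_cat andbA. Qed.

Lemma pV_cat a b1 b2 : pV a (b1 ++ b2) = pV (pU a b2) b1 ++ pV a b2.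
Proof. by elim: b1 => //= y b1 ->; rewrite pU_cat; case: ifP. Qed.

Lemma pV_matched a b : matched a b = (pV a b == [::]).
Proof. by elim: b => //= y b ->; case: ifP => _; rewrite ?andbT ?andbF. Qed.

Lemma rmgt_cat y s t : rmgt y (s ++ t) =
  if has (fun x : int => y < x) s then rmgt y s ++ t else s ++ rmgt y t.
Proof. by elim: s => //= x s ->; case: ifP => //= _; case: ifP. Qed.

Lemma has_low (y : int) (s : seq int) : (forall x, x \in s -> x <= y) -> has (fun x : int => y < x) s = false.
Proof. by move=> H; apply/negP => /hasP[x /H]; lia. Qed.

Lemma low_part (s t b : seq int) : (forall x y, x \in s -> y \in b -> x <= y) ->
  [/\ pU (s ++ t) b = s ++ pU t b, matched (s ++ t) b = matched t b
    & pV (s ++ t) b = pV t b].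
Proof.
elim: b => //= y b IH H.
have [|-> -> ->] := IH; first by move=> x z xs zb; apply: H; rewrite ?inE ?zb ?orbT.
have hl : has (fun x : int => y < x) s = false.
  by apply: has_low => x xs; apply: H; rewrite ?mem_head.
by rewrite rmgt_cat has_cat hl.
Qed.

Lemma matched_part s t b : matched s b ->
  pU (s ++ t) b = pU s b ++ t /\ matched (s ++ t) b.
Proof.
elim: b => //= y b IH /andP[/IH[-> ->] h].
by rewrite rmgt_cat has_cat h.
Qed.

Fixpoint run (x : int) (k : nat) : seq int :=
  if k is k'.+1 then x :: run (x + 1) k' else [::].

Lemma size_run x k : size (run x k) = k.
Proof. by elim: k x => //= k IH x; rewrite IH. Qed.

Lemma mem_run (z x : int) k : (z \in run x k) = (x <= z) && (z < x + k%:Z).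
Proof.
elim: k x => [|k IH] x /=; first by rewrite in_nil; apply/esym/negP; lia.
by rewrite inE IH; case: (z =P x) => [->|ne] /=; lia.
Qed.

Lemma sorted_run x k : lt_sorted (run x k).
Proof.
elim: k x => //= k IH x; rewrite lt_pathP IH andbT; apply/allP => y.
by rewrite mem_run; lia.
Qed.

Lemma run_rcons x k : run x k.+1 = rcons (run x k) (x + k%:Z).
Proof.
elim: k x => [|k IH] x; first by rewrite /= addr0.
rewrite -[run x k.+2]/(x :: run (x + 1) k.+1) IH /=; congr (_ :: rcons _ _); lia.
Qed.

(** Each x + i pairs with x + i + 1, from the top down; the letters of s are too small to take
    part. *)
Lemma run_pair (s : seq int) (x : int) k : (forall z, z \in s -> z <= x) ->
  pU (s ++ run (x + 1) k) (run x k) = s /\ matched (s ++ run (x + 1) k) (run x k).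
Proof.
elim: k s x => [|k IH] s x H; first by rewrite cats0.
have [] := IH (rcons s (x + 1)) (x + 1).
  by move=> z; rewrite mem_rcons inE => /orP[/eqP->|/H]; lia.
rewrite cat_rcons -[run (x + 1) k.+1]/((x + 1) :: run (x + 1 + 1) k) /= => -> ->.
have h1 : x < x + 1 by lia.
by rewrite -cats1 rmgt_cat has_cat has_low //= h1 cats0.
Qed.

Lemma find_up_run (u : seq int) x k n : (k < n)%N ->
  (forall z, x <= z < x + k%:Z -> z \in u) -> x + k%:Z \notin u -> find_up n x u = x + k%:Z.
Proof.
elim: n x k => // n IH x [|k] lt H N /=.
  by move: N; rewrite addr0 => /negbTE ->.
rewrite H; last by lia.
rewrite (IH _ k); first lia.
- by lia.
- by move=> z hz; apply: H; lia.
- by move: N; have -> : x + k.+1%:Z = x + 1 + k%:Z by lia.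
Qed.

Lemma find_down_run (u : seq int) y k n : (k < n)%N ->
  (forall z, y - k%:Z < z <= y -> z \in u) -> y - k%:Z \notin u ->
  find_down n y u = y - k%:Z.
Proof.
elim: n y k => // n IH y [|k] lt H N /=.
  by move: N; rewrite subr0 => /negbTE ->.
rewrite H; last by lia.
rewrite (IH _ k); first lia.
- by lia.
- by move=> z hz; apply: H; lia.
- by move: N; have -> : y - k.+1%:Z = y - 1 - k%:Z by lia.
Qed.

(** * The operators on two adjacent factors *)

Definition f_pair (a b : seq int) : option (seq int * seq int) :=
  let U := (unpaired a b).1 in
  if U is [::] then None else
  Some (rem (maxZ U) a, insZ (next_absent (maxZ U) b) b).

Definition e_pair (a b : seq int) : option (seq int * seq int) :=
  let V := (unpaired a b).2 in
  if V is [::] then None else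
  Some (insZ (prev_absent (minZ V) a) a, rem (minZ V) b).

(* The operator f sends (a1 (x..x+k) a3, b1 (x..x+k-1) b2) to
   (a1 (x+1..x+k) a3, b1 (x..x+k) b2); e is the inverse. *)
Record slide (a1 : seq int) (x : int) (k : nat) (a3 b1 b2 : seq int) : Prop := Slide {
  slide_a : lt_sorted (a1 ++ x :: run (x + 1) k ++ a3);
  slide_b : lt_sorted (b1 ++ run x k.+1 ++ b2);
  slide_low : matched a1 b1;
  slide_high : pU a3 b2 = [::] }.

Lemma slide_a' a1 x k a3 b1 b2 (S : slide a1 x k a3 b1 b2) :
  lt_sorted (a1 ++ run (x + 1) k ++ a3).
Proof.
apply: lt_subseq (slide_a S); apply: cat_subseq => //; exact: subseq_cons.
Qed.

Lemma slide_b' a1 x k a3 b1 b2 (S : slide a1 x k a3 b1 b2) :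
  lt_sorted (b1 ++ run x k ++ b2).
Proof.
apply: lt_subseq (slide_b S); apply: cat_subseq => //; apply: cat_subseq => //.
by rewrite run_rcons subseq_rcons.
Qed.

Lemma slide_bounds a1 x k a3 b1 b2 (S : slide a1 x k a3 b1 b2) :
  [/\ forall z, z \in a1 -> z < x, forall z, z \in a3 -> x + k%:Z < z,
   forall z, z \in b1 -> z < x & forall z, z \in b2 -> x + k%:Z < z].
Proof.
have := slide_a S; rewrite -cat_cons -[x :: _]/(run x k.+1).
move=> /lt_sorted_cat[_ /lt_sorted_cat[_ _ h2] h1].
have /lt_sorted_cat[_ /lt_sorted_cat[_ _ h4] h3] := slide_b S.
have hx : x \in run x k.+1 by rewrite mem_run; lia.
have hy : x + k%:Z \in run x k.+1 by rewrite mem_run; lia.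
split=> z hz; [apply: h1 => //|exact: h2|apply: h3 => //|exact: h4];
  by rewrite mem_cat hx.
Qed.

(** The unpaired letters are those left by a1 and b1, with x on top; the run from x in the second
    word makes x + k the first absent letter. *)
Lemma slide_f a1 x k a3 b1 b2 (S : slide a1 x k a3 b1 b2) :
  f_pair (a1 ++ x :: run (x + 1) k ++ a3) (b1 ++ run x k ++ b2) =
  Some (a1 ++ run (x + 1) k ++ a3, b1 ++ run x k.+1 ++ b2).
Proof.
have [ha1 ha3 hb1 hb2] := slide_bounds S.
have EU : pU (a1 ++ x :: run (x + 1) k ++ a3) (b1 ++ run x k ++ b2) = pU a1 b1 ++ [:: x].
  rewrite !pU_cat -cat_cons catA.
  have [|-> _ _] := @low_part (a1 ++ x :: run (x + 1) k) a3 b2.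
    by move=> z y; rewrite mem_cat -[x :: _]/(run x k.+1) mem_run => /orP[/ha1|] hz /hb2; lia.
  rewrite (slide_high S) cats0 -cat_rcons.
  have [|-> _] := @run_pair (rcons a1 x) x k.
    by move=> z; rewrite mem_rcons inE => /orP[/eqP->|/ha1]; lia.
  by rewrite -cats1; have [E _] := @matched_part a1 [:: x] b1 (slide_low S).
rewrite /f_pair (unpairedE (slide_a S) (slide_b' S)) EU.
have -> : maxZ (pU a1 b1 ++ [:: x]) = x.
  rewrite maxZ_sorted ?cats1 ?last_rcons //.
  have /lt_sorted_cat[s1 _ _] := slide_a S.
  rewrite -cats1; apply/lt_sorted_cat; split=> //; first exact: lt_subseq (pU_subseq _ _) s1.
  by move=> z y /(mem_subseq (pU_subseq _ _))/ha1 hz; rewrite inE => /eqP->.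
have -> : next_absent x (b1 ++ run x k ++ b2) = x + k%:Z.
  apply: find_up_run; first by rewrite !size_cat size_run; lia.
    by move=> z hz; rewrite !mem_cat mem_run hz orbT.
  by rewrite !mem_cat mem_run !negb_or; apply/and3P; split; apply/negP;
    [move=> /hb1|idtac|move=> /hb2]; lia.
have -> : insZ (x + k%:Z) (b1 ++ run x k ++ b2) = b1 ++ run x k.+1 ++ b2.
  apply: sort_perm (slide_b S) _; rewrite run_rcons cat_rcons.
  by rewrite -cat1s perm_catCA perm_cat2l -cat1s perm_catCA.
case E1 : (pU a1 b1 ++ [:: x]) => [|z l]; first by case: (pU a1 b1) E1.
congr (Some (_, _)); rewrite rem_mid //.
by apply/negP => /ha1; lia.
Qed.

(** Everything below x + k in the second word is paired, so x + k is the least unpaired letter;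
    going down from it through the run in the first word, the first absent letter is x. *)
Lemma slide_e a1 x k a3 b1 b2 (S : slide a1 x k a3 b1 b2) :
  e_pair (a1 ++ run (x + 1) k ++ a3) (b1 ++ run x k.+1 ++ b2) =
  Some (a1 ++ x :: run (x + 1) k ++ a3, b1 ++ run x k ++ b2).
Proof.
have [ha1 ha3 hb1 hb2] := slide_bounds S.
rewrite /e_pair (unpairedE (slide_a' S) (slide_b S)).
have -> : pV (a1 ++ run (x + 1) k ++ a3) (b1 ++ run x k.+1 ++ b2) =
    (x + k%:Z) :: pV (a1 ++ run (x + 1) k ++ a3) b2.
  have EU : pU (a1 ++ run (x + 1) k ++ a3) b2 = a1 ++ run (x + 1) k.
    rewrite catA; have [|-> _ _] := @low_part (a1 ++ run (x + 1) k) a3 b2.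
      by move=> z y; rewrite mem_cat mem_run => /orP[/ha1|] hz /hb2; lia.
    by rewrite (slide_high S) cats0.
  have nh : has (fun z => x + k%:Z < z) (a1 ++ run (x + 1) k) = false.
    by apply: has_low => z; rewrite mem_cat mem_run => /orP[/ha1|]; lia.
  have ER : rmgt (x + k%:Z) (a1 ++ run (x + 1) k) = a1 ++ run (x + 1) k.
    by elim: (a1 ++ _) nh => //= z l IH; case: ifP => //= _ /IH ->.
  have [|E M] := @run_pair a1 x k; first by move=> z /ha1; lia.
  move: M (slide_low S); rewrite !pV_matched => /eqP M1 /eqP M2.
  by rewrite run_rcons cat_rcons !pV_cat !pU_cat /= EU nh ER E M1 M2.
set V2 := pV _ b2.
have -> : minZ (x + k%:Z :: V2) = x + k%:Z.
  apply: minZ_sorted; rewrite /sorted lt_pathP.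
  have /lt_sorted_cat[_ /lt_sorted_cat[_ s2 _] _] := slide_b S.
  rewrite (lt_subseq (pV_subseq _ _) s2) andbT; apply/allP => z.
  by move=> /(mem_subseq (pV_subseq _ _))/hb2.
have -> : prev_absent (x + k%:Z) (a1 ++ run (x + 1) k ++ a3) = x.
  rewrite /prev_absent (@find_down_run _ _ k); first lia.
  - by rewrite !size_cat size_run; lia.
  - move=> z hz; rewrite !mem_cat mem_run; have -> : (x + 1 <= z) && (z < x + 1 + k%:Z) by lia.
    by rewrite orbT.
  - have -> : x + k%:Z - k%:Z = x by lia.
    by rewrite !mem_cat mem_run !negb_or; apply/and3P; split; apply/negP;
      [move=> /ha1|idtac|move=> /ha3]; lia.
have -> : insZ x (a1 ++ run (x + 1) k ++ a3) = a1 ++ x :: run (x + 1) k ++ a3.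
  apply: sort_perm (slide_a S) _.
  by rewrite -cat1s perm_catCA.
congr (Some (_, _)); rewrite run_rcons cat_rcons catA rem_mid ?catA //.
by rewrite mem_cat mem_run negb_or; apply/andP; split; apply/negP; [move=> /hb1|]; lia.
Qed.

(** * Insertion is invariant under the crystal operators *)

(** A counting condition of Hall type for pairing every letter of a sorted b. Unlike [matched], it
    is easily followed through row insertion. *)
Fixpoint dominated (a b : seq int) : bool :=
  if b is y :: b' then (size b' < count (fun x : int => (y < x)%R) a)%N && dominated a b' else true.

Lemma rmgt_count (y z : int) s : y < z -> has (fun x => z < x) s ->
  (count (fun x : int => (y < x)%R) (rmgt z s)).+1 = count (fun x : int => (y < x)%R) s.
Proof.
move=> yz; elim: s => //= x s IH; case: ifP => [zx _|_ /IH <-] /=.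
  by have -> : y < x by lia_clear.
by rewrite addnS.
Qed.

Lemma matched_count (y : int) a b : matched a b -> (forall z, z \in b -> y < z) ->
  (count (fun x : int => (y < x)%R) (pU a b) + size b = count (fun x : int => (y < x)%R) a)%N.
Proof.
elim: b => [|z b IH] /=; first by rewrite addn0.
move=> /andP[m h] H; rewrite addnS -addSn rmgt_count ?IH //.
  by move=> x xb; apply: H; rewrite inE xb orbT.
by apply: H; rewrite mem_head.
Qed.

Lemma matched_dominated a b : lt_sorted b -> matched a b -> dominated a b.
Proof.
elim: b => //= y b IH p /andP[m h].
move: p; rewrite lt_pathP => /andP[/allP p /IH -> //].
have h' : (0 < count (fun x : int => (y < x)%R) (pU a b))%N by rewrite -has_count.
by rewrite andbT; have := matched_count m p; lia_clear.
Qed.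

(** The number of entries above y can drop only if an entry above y is bumped by z, and then every
    entry above z is above y. *)
Lemma eg_count (y z : int) a : lt_sorted a -> z < y ->
  let c := count (fun x : int => (y < x)%R) in
  (c a <= c (eg a z).2)%N \/
  ((c (eg a z).2).+1 = c a /\ c a = count (fun x : int => (z < x)%R) a).
Proof.
elim: a => [|r a IH] p zy c; first by left.
have p2 := path_sorted p; move: p; rewrite /sorted lt_pathP => /andP[/allP p _].
rewrite [eg _ _]/=; case: (ltrgtP z r) => zr; last by left.
  have nyz : (y < z) = false by lia_clear.
  have [yr|ry] := ltrP y r; last by left; rewrite /c /= nyz; have -> : (y < r) = false by lia_clear.
  right; have H t : t < r -> count (fun x : int => (t < x)%R) a = size a.
    move=> tr; apply/eqP; rewrite -all_count; apply/allP => w /p /=; lia_clear.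
  by rewrite /c /= nyz yr zr !H.
have nyr : (y < r) = false by lia_clear.
have nzr : (z < r) = false by lia_clear.
by rewrite /c /= nyr nzr; apply: IH.
Qed.

Lemma count_last (z : int) a : lt_sorted a -> (0 < count (fun x : int => (z < x)%R) a)%N -> z < last z a.
Proof.
move=> p; rewrite -has_count => /hasP[x xa zx].
case: a p xa => // r a p xa; have := p; rewrite /sorted /= => q.
have : x <= last r a; last by rewrite /=; lia_clear.
elim: a r x q {p zx} xa => [|r2 a IH] r x /=; first by rewrite inE => _ /eqP->.
move=> /andP[rr q]; rewrite inE => /orP[/eqP->|h]; last exact: IH.
by have := IH r2 r2 q (mem_head _ _); lia_clear.
Qed.

(** Where a count drops, it was equal to the count above z, which exceeds the number of letters
    still to be inserted. *)
Lemma dominated_step a (z : int) b : lt_sorted a -> lt_sorted (z :: b) ->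
  dominated a (z :: b) -> z < last z a /\ dominated (eg a z).2 b.
Proof.
move=> sa; rewrite /sorted lt_pathP => /andP[/allP zb sb] /= /andP[h d].
split; first by apply: count_last => //; lia_clear.
have : forall b', (forall y, y \in b' -> z < y) -> (size b' <= size b)%N ->
    dominated a b' -> dominated (eg a z).2 b'.
  elim=> //= y b' IH H le /andP[h' d'].
  rewrite IH //; first 1 last.
  - by move=> x xb; apply: H; rewrite inE xb orbT.
  - lia_clear.
  have zy : z < y by apply: H; rewrite mem_head.
  by have := eg_count sa zy => /=; lia_clear.
by apply.
Qed.

Lemma eg_cat_l (a r : seq int) z : z < last z a -> eg (a ++ r) z = ((eg a z).1, (eg a z).2 ++ r).
Proof.
elim: a => [|x a IH] /=; first lia_clear.
case: (ltrgtP z x) => // zx h; rewrite IH //.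
by case: (a) h => //=; lia_clear.
Qed.

Lemma eg_cat_r (a r : seq int) z : (forall x, x \in a -> x < z) ->
  eg (a ++ r) z = ((eg r z).1, a ++ (eg r z).2).
Proof.
elim: a => [|x a IH] H /=; first by case: (eg r z).
have xz : x < z by apply: H; rewrite mem_head.
have -> : (z < x) = false by lia_clear.
have -> : (z == x) = false by lia_clear.
by rewrite IH // => y ya; apply: H; rewrite inE ya orbT.
Qed.

Lemma last_cat_gt (z : int) a r : lt_sorted (a ++ r) -> z < last z a -> z < last z (a ++ r).
Proof.
move=> /lt_sorted_cat[_ _ H]; rewrite last_cat; case/lastP: r H => // r x H h.
rewrite last_rcons; case/lastP: a H h => [|a y] H; first by rewrite /=; lia_clear.
rewrite last_rcons => h; have := H y x; rewrite !mem_rcons !inE !eqxx => /(_ isT isT); lia_clear.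
Qed.

Lemma eg_sorted_cat (z : int) a r : lt_sorted (a ++ r) -> z < last z a ->
  lt_sorted ((eg a z).2 ++ r).
Proof.
move=> p h; have := eg_sorted p (last_cat_gt p h); by rewrite eg_cat_l.
Qed.

(** Dominated letters bump inside a, so whatever stands to its right stays in place. *)
Lemma egs_low a b r : lt_sorted (a ++ r) -> lt_sorted b -> dominated a b ->
  [/\ bumping (a ++ r) b, egs (a ++ r) b = ((egs a b).1, (egs a b).2 ++ r)
    & lt_sorted ((egs a b).2 ++ r)].
Proof.
elim: b a => [|z b IH] a p sb d //.
have /lt_sorted_cat[sa _ _] := p.
have [zl d'] := dominated_step sa sb d.
have [h1 h2 h3] := IH (eg a z).2 (eg_sorted_cat p zl) (path_sorted sb) d'.
rewrite [bumping _ _]/= [egs _ _]/= (eg_cat_l r zl) /= h2; split=> //.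
by split=> //; apply: last_cat_gt.
Qed.

(** Carries insertability between rows that differ only to the right of a, so that reducedness of
    either of two words can be exploited. *)
Lemma insertable_low a b r r' : lt_sorted (a ++ r) -> lt_sorted (a ++ r') -> lt_sorted b ->
  dominated a b -> insertable (a ++ r) b -> insertable (a ++ r') b.
Proof.
elim: b a => [|z b IH] a p p' sb d //.
have /lt_sorted_cat[sa _ H] := p; have /lt_sorted_cat[_ _ H'] := p'.
have [zl d'] := dominated_step sa sb d.
rewrite /= !(eg_cat_l _ zl) /= => -[h1 h2 h3]; split.
- exact: last_cat_gt.
- have la : last z a \in a by case: (a) zl => [|y l _] /=; [lia_clear|apply: mem_last].
  rewrite mem_cat => /orP[za|zr]; last by have := H' _ _ la zr; lia_clear.
  have := h2; rewrite mem_cat za => /(_ isT).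
  rewrite !mem_cat => /orP[->//|zr]; have := H _ _ la zr; lia_clear.
- exact: (IH _ (eg_sorted_cat p zl) (eg_sorted_cat p' zl) (path_sorted sb) d' h3).
Qed.

Fixpoint aligned (a b : seq int) : bool :=
  match a, b with
  | [::], _ => true
  | r :: a', y :: b' => (y < r) && aligned a' b'
  | _, _ => false
  end.

Lemma pU_count (t : int) a b : (count (fun x : int => (x <= t)%R) a <=
  count (fun x : int => (x <= t)%R) (pU a b) + count (fun y : int => (y < t)%R) b)%N.
Proof.
elim: b => [|y b IH] /=; first by rewrite addn0.
suff : (count (fun x : int => (x <= t)%R) (pU a b) <=
    count (fun x : int => (x <= t)%R) (rmgt y (pU a b)) + (y < t)%R)%N by lia_clear.
by elim: (pU a b) => //= x s IH'; case: ifP => /= h; lia_clear.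
Qed.

Lemma pU_aligned a b : lt_sorted a -> lt_sorted b -> pU a b = [::] -> aligned a b.
Proof.
move=> sa sb E; have : forall t : int,
    (count (fun x : int => (x <= t)%R) a <= count (fun y : int => (y < t)%R) b)%N.
  by move=> t; have := pU_count t a b; rewrite E.
elim: a b sa sb {E} => // r a IH [|y b] sa sb H; first by have := H r; rewrite /= lexx.
have /andP[/allP ra _] : all (fun z => r < z) a && lt_sorted a by rewrite -lt_pathP.
have /andP[/allP yb _] : all (fun z => y < z) b && lt_sorted b by rewrite -lt_pathP.
have yr : y < r.
  have := H r; rewrite /= lexx; case: (ltrP y r) => // ry.
  suff -> : count (fun y : int => (y < r)%R) b = 0%N by [].
  apply/eqP; rewrite eqn0Ngt -has_count; apply/hasP => -[z /yb]; lia_clear.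
rewrite /= yr; apply: IH; [exact: path_sorted sa|exact: path_sorted sb|].
move=> t; have [tr|rt] := ltrP t r; last by have := H t; rewrite /=; lia_clear.
suff -> : count (fun x : int => (x <= t)%R) a = 0%N by [].
apply/eqP; rewrite eqn0Ngt -has_count; apply/hasP => -[z /ra]; lia_clear.
Qed.

Lemma aligned_size a b : aligned a b -> (size a <= size b)%N.
Proof. by elim: a b => // r a IH [|y b] //= /andP[_ /IH]. Qed.

Lemma aligned_take a b : aligned a b -> aligned a (take (size a) b).
Proof. by elim: a b => // r a IH [|y b] //= /andP[-> /IH]. Qed.

Lemma aligned_shift a (y : int) b : lt_sorted (y :: b) -> aligned a b -> aligned a (y :: b).
Proof.
elim: a y b => // r a IH y [|z b] //= /andP[yz p] /andP[zr /(IH z _ p)->].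
by rewrite andbT; lia_clear.
Qed.

Lemma last_ge (r : int) a : lt_sorted (r :: a) -> r <= last r a.
Proof.
move=> p; have [->//|n0] := eqVneq a [::]; exact/ltW/last_lt_path.
Qed.

(** Each letter of b bumps the corresponding letter of a: a leaves in order and b takes its
    place. *)
Lemma egs_aligned L a b : lt_sorted a -> lt_sorted (L ++ b) -> size b = size a ->
  (forall l x, l \in L -> x \in a -> l < x) -> aligned a b ->
  insertable (L ++ a) b /\ egs (L ++ a) b = (a, L ++ b).
Proof.
elim: a L b => [|r a IH] L [|y b] // sa sb [Sz] H /andP[yr al].
have /lt_sorted_cat[_ syb Lb] := sb.
have /andP[/allP yb _] : all (fun z => y < z) b && lt_sorted b by rewrite -lt_pathP.
have /andP[/allP ra _] : all (fun z => r < z) a && lt_sorted a by rewrite -lt_pathP.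
have Ly x : x \in L -> x < y by move=> xL; apply: Lb => //; rewrite mem_head.
have Ee : eg (L ++ r :: a) y = (r, L ++ y :: a) by rewrite eg_cat_r //= yr.
have [||i e] := IH (rcons L y) b (path_sorted sa) _ Sz _ al.
- by rewrite cat_rcons.
- move=> l x; rewrite mem_rcons inE => /orP[/eqP->|lL] xa; first by have := ra _ xa; lia_clear.
  by apply: H => //; rewrite inE xa orbT.
rewrite !cat_rcons in i e; rewrite /= Ee /= e; split=> //; split=> //.
  by rewrite last_cat /=; have := last_ge sa; lia_clear.
rewrite mem_cat inE => /or3P[/Ly|/eqP|/ra]; lia_clear.
Qed.

(** Each inserted letter meets an equal entry, so the row is unchanged and the successor is
    bumped. *)
Lemma run_egs L (x : int) k a3 : (forall z, z \in L -> z < x) ->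
  lt_sorted (L ++ x :: run (x + 1) k ++ a3) ->
  egs (L ++ x :: run (x + 1) k ++ a3) (run x k) =
    (run (x + 1) k, L ++ x :: run (x + 1) k ++ a3) /\
  insertable (L ++ x :: run (x + 1) k ++ a3) (run x k).
Proof.
elim: k L x => // k IH L x H p.
have Ee : eg (L ++ x :: run (x + 1) k.+1 ++ a3) x = (x + 1, L ++ x :: run (x + 1) k.+1 ++ a3).
  by rewrite eg_cat_r //= ltxx eqxx.
rewrite -[run x k.+1]/(x :: run (x + 1) k) [egs _ _]/= [insertable _ _]/= Ee.
have [||e b] := IH (rcons L x) (x + 1).
- by move=> z; rewrite mem_rcons inE => /orP[/eqP->|/H]; lia_clear.
- by rewrite cat_rcons.
rewrite !cat_rcons in e b; rewrite [fst _]/= [snd _]/= e; split=> //; split=> //.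
  rewrite last_cat /=; have /lt_sorted_cat[_ q _] := p.
  by have := @last_lt_path x _ q isT.
by move=> _; rewrite mem_cat !inE eqxx !orbT.
Qed.

(* Inserting x, x+1, ... into a row containing x leaves it unchanged, and
   reducedness forces x+1, x+2, ... to be in the row. *)
Lemma red_run u L (x : int) A k v : lt_sorted (L ++ x :: A) ->
  red (u ++ (L ++ x :: A) ++ run x k ++ v) -> exists a3, A = run (x + 1) k ++ a3.
Proof.
elim: k u L x A => [|k IH] u L x A p r; first by exists A.
have /lt_sorted_cat[_ q LA] := p.
have /andP[/allP xA sA] : all (fun z => x < z) A && lt_sorted A by rewrite -lt_pathP.
have : x + 1 \in L ++ x :: A.
  by apply: (red_row_succ p r); rewrite mem_cat mem_head orbT.
rewrite mem_cat inE => /or3P[h|/eqP|h]; [|lia_clear|].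
  by have := LA _ _ h (mem_head _ _); lia_clear.
case: A p r q LA xA sA h => [//|y A] p r q LA xA sA h.
have ey : y = x + 1.
  have := xA y (mem_head _ _); move: h; rewrite inE => /orP[/eqP->//|h].
  have /andP[/allP yA _] : all (fun z => y < z) A && lt_sorted A by rewrite -lt_pathP.
  by have := yA _ h; lia_clear.
subst y; have zl : x < last x (L ++ [:: x, x + 1 & A]).
  by rewrite last_cat; apply: (@last_lt_path x (x + 1 :: A)).
have ok : x \in L ++ [:: x, x + 1 & A] -> x + 1 \in L ++ [:: x, x + 1 & A].
  by move=> _; rewrite mem_cat !inE eqxx !orbT.
have := chain_red (eg_chain u (run (x + 1) k ++ v) p zl ok).
rewrite eg_cat_r ?ltxx ?eqxx //=; last by move=> z zL; apply: LA; rewrite ?mem_head.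
rewrite ltxx eqxx /= => E; rewrite [run x _]/= cat_cons E -cat_rcons in r.
have [||a3 ->] := IH (rcons u (x + 1)) (rcons L x) (x + 1) A.
- by rewrite cat_rcons.
- by rewrite -cat_rcons in r; move: r; rewrite !cat_rcons.
by exists a3.
Qed.

(** * Reducedness forces the shape of a slide *)

Lemma lt_cons_all (y : int) b : lt_sorted (y :: b) -> forall z, z \in b -> y < z.
Proof. by rewrite /sorted lt_pathP => /andP[/allP H _] z /H. Qed.

Lemma sorted_cut (x : int) b : lt_sorted b -> exists b1 B,
  [/\ b = b1 ++ B, forall y, y \in b1 -> y < x & forall y, y \in B -> x <= y].
Proof.
elim: b => [|y b IH] p; first by exists [::], [::].
have [yx|xy] := ltrP y x; last first.
  exists [::], (y :: b); split=> // z; rewrite inE => /orP[/eqP->//|h].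
  by have := lt_cons_all p h; lia_clear.
have [b1 [B [-> H1 H2]]] := IH (path_sorted p).
by exists (y :: b1), B; split=> // z; rewrite inE => /orP[/eqP->|/H1].
Qed.

Lemma run_front (x : int) B : lt_sorted B -> (forall y, y \in B -> x <= y) ->
  exists k b2, B = run x k ++ b2 /\ forall z, z \in b2 -> x + k%:Z < z.
Proof.
elim: B x => [|y B IH] x p H; first by exists 0%N, [::].
have yB := lt_cons_all p; have [e|ne] := eqVneq y x.
  have [|k [b2 [-> h]]] := IH (x + 1) (path_sorted p).
    by move=> z /yB; lia_clear.
  by exists k.+1, b2; rewrite e; split=> // z /h; lia_clear.
have xy := H y (mem_head _ _); exists 0%N, (y :: B); split=> // z.
by rewrite inE => /orP[/eqP->|/yB]; lia_clear.
Qed.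

Lemma run_back (y : int) a : lt_sorted a -> (forall z, z \in a -> z <= y) ->
  exists k a1, a = a1 ++ run (y - k%:Z + 1) k /\ forall z, z \in a1 -> z < y - k%:Z.
Proof.
elim/last_ind: a y => [|s z IH] y p H; first by exists 0%N, [::].
move: (p); rewrite -cats1 => /lt_sorted_cat[sp _ sz].
have sz' t : t \in s -> t < z by move=> /sz; apply; rewrite mem_head.
have zy := H z; rewrite mem_rcons mem_head in zy; have {}zy := zy isT.
have [e|ne] := eqVneq z y.
  have [|k [a1 [-> h]]] := IH (y - 1) sp; first by move=> t /sz'; lia_clear.
  exists k.+1, a1; split; last by move=> t /h; lia_clear.
  rewrite run_rcons e -catA -cats1; congr (_ ++ run _ _ ++ [:: _]); lia_clear.
exists 0%N, (rcons s z); rewrite -?cats1 /= ?cats0; split=> // t.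
by rewrite mem_cat inE => /orP[/sz'|/eqP->]; lia_clear.
Qed.

(** A letter of b1 without partner in a1 would take x, the next letter of the first word; as x
    survives, b1 is paired within a1. *)
Lemma keep_matched (x : int) a1 A b1 : (forall z, z \in a1 -> z < x) ->
  (forall z, z \in A -> x < z) -> (forall y, y \in b1 -> y < x) ->
  x \in pU (a1 ++ x :: A) b1 -> matched a1 b1.
Proof.
move=> H1 H2; elim: b1 => //= y b1 IH H3 xin.
have m : matched a1 b1.
  apply: IH; first by move=> z zb; apply: H3; rewrite inE zb orbT.
  by apply: mem_subseq xin; apply: rmgt_subseq.
have yx := H3 y (mem_head _ _).
rewrite m /=; apply/negPn/negP => /negbTE nh; move: xin.
have [-> _] := matched_part (x :: A) m.
rewrite rmgt_cat nh /= yx mem_cat => /orP[|/H2]; last lia_clear.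
by move=> /(mem_subseq (pU_subseq _ _))/H1; lia_clear.
Qed.

(** Cut both words at the largest unpaired letter x. Below x the second word pairs within a1, since
    x survives; above x the first word is completely paired. Once b1 has been inserted, the row
    still contains x and meets the run of b starting at x, so reducedness puts the shifted run into
    a. *)
Lemma f_slide u a b v : lt_sorted a -> lt_sorted b -> red (u ++ a ++ b ++ v) ->
  pU a b <> [::] -> exists a1 x k a3 b1 b2, [/\ slide a1 x k a3 b1 b2,
    a = a1 ++ x :: run (x + 1) k ++ a3 & b = b1 ++ run x k ++ b2].
Proof.
move=> sa sb r nU; pose x := last 0 (pU a b).
have xU : x \in pU a b by rewrite /x; case: (pU a b) nU => // y l _ /=; apply: mem_last.
have lx : last 0 (pU a b) = x by [].
have xa := mem_subseq (pU_subseq a b) xU; move: x xU lx xa => x xU lx xa.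
case/splitPr: xa sa r nU xU lx => a1 A sa r nU xU lx.
have /lt_sorted_cat[_ sxA Ha] := sa; have xA := lt_cons_all sxA.
have a1x z : z \in a1 -> z < x by move=> h; apply: Ha => //; rewrite mem_head.
have [b1 [B [eb hb1 hB]]] := sorted_cut x sb; subst b.
have /lt_sorted_cat[sb1 sB _] := sb.
have EU : pU (a1 ++ x :: A) (b1 ++ B) = pU (a1 ++ x :: pU A B) b1.
  rewrite pU_cat -cat_rcons; have [|-> _ _] := @low_part (rcons a1 x) A B.
    by move=> z y + /hB; rewrite mem_rcons inE => /orP[/eqP->|/a1x]; lia_clear.
  by rewrite cat_rcons.
have A'x z : z \in pU A B -> x < z by move=> /(mem_subseq (pU_subseq _ _))/xA.
rewrite EU in xU lx nU; have m := keep_matched a1x A'x hb1 xU.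
have UA : pU A B = [::].
  move: lx; have [-> _] := matched_part (x :: pU A B) m.
  rewrite last_cat /=; case: (pU A B) A'x => // y l H e.
  by have := H _ (mem_last y l); rewrite [last y l]e; lia_clear.
have [k [b2 [eB hb2]]] := run_front sB hB; subst B.
have d := matched_dominated sb1 m.
have [bu ee se] := egs_low sa sb1 d.
have i : insertable (a1 ++ x :: A) b1.
  by apply: (red_insertable sa bu); move: r; rewrite -!catA; apply.
have c := egs_chain u (run x k ++ b2 ++ v) sa i; rewrite -!catA in r c.
rewrite (chain_red c) ee catA in r.
have [a3 eA] := red_run se r.
exists a1, x, k, a3, b1, b2; split; rewrite -?eA //; split; rewrite -?eA //.
- apply/lt_sorted_cat; have /lt_sorted_cat[_ sb2 _] := sB; split=> //.
    apply/lt_sorted_cat; split=> //; first exact: sorted_run.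
    by move=> z y; rewrite mem_run => hz /hb2; lia_clear.
  move=> z y /hb1 zx; rewrite mem_cat mem_run => /orP[|/hb2]; lia_clear.
- move: UA; rewrite eA pU_cat; have [|-> _ _] := @low_part (run (x + 1) k) a3 b2.
    by move=> z y; rewrite mem_run => hz /hb2; lia_clear.
  have [//|E M] := @run_pair [::] x k.
  by have [-> _] := matched_part (pU a3 b2) M; rewrite E.
Qed.

Lemma pV_head a b (y : int) V : pV a b = y :: V -> exists b1 B,
  [/\ b = b1 ++ y :: B, matched (pU a B) b1 & has (fun x : int => y < x) (pU a B) = false].
Proof.
elim: b => //= z b IH; case: ifP => [h /IH[b1 [B [eb m nh]]]|nh [<- _]].
  exists (z :: b1), B; rewrite eb; split=> //=; rewrite m /=.
  move: h; rewrite eb pU_cat /=.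
  have -> // : rmgt y (pU a B) = pU a B.
  by elim: (pU a B) nh => //= t l IH'; case: ifP => //= _ /IH' ->.
by exists [::], b.
Qed.

Lemma word_perm_swap s t : (forall x y : int, x \in s -> y \in t -> (y + 1 < x) || (x + 1 < y)) ->
  word_perm (s ++ t) = word_perm (t ++ s).
Proof.
elim: s => [|x s IH] H; first by rewrite cats0.
rewrite cat_cons -cat_rcons (@word_perm_cons x _ (t ++ s)); last first.
  by apply: IH => z y zs; apply: H; rewrite inE zs orbT.
rewrite -cat_cons; apply: word_perm_catr; apply: word_perm_move => y yt.
by apply: H => //; rewrite mem_head.
Qed.

Lemma run_cat (x : int) i j : run x (i + j) = run x i ++ run (x + i%:Z) j.
Proof.
elim: i x => [|i IH] x; first by rewrite /= addr0.
by rewrite addSn /= IH; congr (_ :: _ ++ run _ _); lia_clear.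
Qed.

Lemma red_run_run u (x : int) k v : red (u ++ run x k.+1 ++ run x k.+1 ++ v) = false.
Proof.
apply/negP => r; have [|a3 E] := @red_run u [::] x (run (x + 1) k) k.+1 v _ r.
  exact: (sorted_run x k.+1).
by have := congr1 size E; rewrite size_cat !size_run; lia_clear.
Qed.

(** Cut at the least unpaired letter y of b. The maximal run of a that ends in y has some length k,
    the run of b that ends in y - 1 has some length i, and reducedness gives k <= i; then x = y -
    k. *)
Lemma e_slide u a b v : lt_sorted a -> lt_sorted b -> red (u ++ a ++ b ++ v) ->
  pV a b <> [::] -> exists a1 x k a3 b1 b2, [/\ slide a1 x k a3 b1 b2,
    a = a1 ++ run (x + 1) k ++ a3 & b = b1 ++ run x k.+1 ++ b2].
Proof.
move=> sa sb r nV; case EV : (pV a b) nV => [//|y V] _.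
have [b1 [B [eb m nh]]] := pV_head EV; subst b.
have /lt_sorted_cat[sb1 syB Hb] := sb; have yB := lt_cons_all syB.
have b1y z : z \in b1 -> z < y by move=> h; apply: Hb => //; rewrite mem_head.
have [aL [A [ea haL hA]]] := sorted_cut (y + 1) sa; subst a.
have /lt_sorted_cat[saL sA _] := sa; have sB := path_sorted syB.
have EU : pU (aL ++ A) B = aL ++ pU A B.
  by have [|-> _ _] := @low_part aL A B => // z t /haL + /yB; lia_clear.
have UA : pU A B = [::].
  move: nh; rewrite EU has_cat; case E : (pU A B) => [|z l] //= /negbT.
  rewrite !negb_or => /and3P[_ /negP[]].
  have : z \in A by apply: (mem_subseq (pU_subseq A B)); rewrite E mem_head.
  by move=> /hA; lia_clear.
rewrite EU UA cats0 in m.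
(* Completely paired letters of A exceed those of B entrywise, and B starts above y. *)
have hA2 z : z \in A -> y + 1 < z.
  have := pU_aligned sA sB UA; case: A B sA hA yB {EU UA r sa sb syB Hb EV nh sB} => // t A [|t' B] //= sA hA yB.
  move=> /andP[t't _]; have := yB t' (mem_head _ _).
  by rewrite inE => ? /orP[/eqP->|/(lt_cons_all sA)]; lia_clear.
have [|k [a1 [eaL ha1]]] := @run_back y aL saL; first by move=> z /haL; lia_clear.
have [|i [c [eb1 hc]]] := @run_back (y - 1) b1 sb1; first by move=> z /b1y; lia_clear.
(* Otherwise the run y - i, ..., y occurs in both factors, commutes past everything between its two
   copies, and yields an immediate repetition, which is not reduced. *)
have le : (k <= i)%N.
  rewrite leqNgt; apply/negP => lt; move: r; rewrite eaL eb1.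
  have -> : k = ((k - i.+1) + i.+1)%N by lia_clear.
  rewrite run_cat; set x1 := _ + _%:Z; have ex1 : x1 = y - i%:Z by rewrite /x1; lia_clear.
  have -> : y - 1 - i%:Z + 1 = x1 by lia_clear.
  have -> : (c ++ run x1 i) ++ y :: B = c ++ run x1 i.+1 ++ B.
    by rewrite run_rcons cat_rcons -catA; congr (_ ++ _ ++ _ :: _); lia_clear.
  set R0 := run (_ + 1) _; set R := run x1 i.+1 => r.
  have E : word_perm (R ++ A ++ c) = word_perm ((A ++ c) ++ R).
    by apply: word_perm_swap => z t; rewrite mem_run mem_cat => hz /orP[/hA2|/hc]; lia_clear.
  have EC := conj_fpf_P (u ++ a1 ++ R0) (R ++ B ++ v) E.
  have : red ((u ++ a1 ++ R0 ++ A ++ c) ++ R ++ R ++ B ++ v).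
    apply: (red_same_size r); last by rewrite !size_cat; lia_clear.
    by move: EC; rewrite -!catA => ->.
  by rewrite red_run_run.
pose x := y - k%:Z; pose b1' := c ++ run (y - i%:Z) (i - k).
have ey : y = x + k%:Z by rewrite /x; lia_clear.
have {}eb1 : b1 = b1' ++ run x k.
  have := run_cat (y - i%:Z) (i - k) k; rewrite subnK // eb1 /b1' -catA.
  have -> : y - 1 - i%:Z + 1 = y - i%:Z by lia_clear.
  have -> : y - i%:Z + (i - k)%N%:Z = x by rewrite /x; lia_clear.
  by move=> ->.
have {}eaL : aL = a1 ++ run (x + 1) k by [].
have EB : b1 ++ y :: B = b1' ++ run x k.+1 ++ B.
  by rewrite eb1 run_rcons cat_rcons ey catA.
have a1x z : z \in a1 -> z < x := ha1 z.
exists a1, x, k, A, b1', B; split => //; last by rewrite eaL catA.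
move: m; rewrite eb1 eaL matched_cat.
have [|-> M] := @run_pair a1 x k; first by move=> z /a1x; lia_clear.
move=> /andP[_ m']; split; rewrite -?EB //.
rewrite -cat_cons -[x :: _]/(run x k.+1).
have {}sa : lt_sorted (a1 ++ run (x + 1) k ++ A) by rewrite catA -eaL.
have /lt_sorted_cat[s1 /lt_sorted_cat[_ _ s3] s2] := sa.
apply/lt_sorted_cat; split=> //.
  apply/lt_sorted_cat; split=> //; first exact: sorted_run.
  by move=> z t; rewrite mem_run => hz /hA2; lia_clear.
by move=> z t /a1x zx; rewrite mem_cat mem_run => /orP[|/hA2]; lia_clear.
Qed.

Lemma dominated_size a b : dominated a b -> (size b <= size a)%N.
Proof. by case: b => //= y b /andP[h _]; apply: leq_trans h (count_size _ _). Qed.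

Lemma aligned_run (x : int) k a b : aligned a b -> aligned (run (x + 1) k ++ a) (run x k ++ b).
Proof. by elim: k x => //= k IH x al; rewrite IH // andbT; lia_clear. Qed.

(* Both words insert to the same word [T], which is what makes f a composite
   of Coxeter-Knuth moves. *)
Lemma slide_insertion u a1 x k a3 b1 b2 v :
  slide a1 x k a3 b1 b2 ->
  let a := a1 ++ x :: run (x + 1) k ++ a3 in
  let b := b1 ++ run x k ++ b2 in
  let w := u ++ a ++ b ++ v in
  let w' := u ++ (a1 ++ run (x + 1) k ++ a3) ++ (b1 ++ run x k.+1 ++ b2) ++ v in
  red w || red w' -> exists q, [/\ (q < size a)%N, insq (size u) (size a) (size b) w q &
    exists2 T, chain (ins_moves (size u) (size a) q) w T &
      chain (ins_moves (size u) (size a).-1 q) w' T].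
Proof.
move=> S a b w w' r; have [ha1 ha3 hb1 hb2] := slide_bounds S.
have sa : lt_sorted a := slide_a S; have sa' := slide_a' S.
have sb : lt_sorted b := slide_b' S; have sb' := slide_b S.
have /lt_sorted_cat[sb1 /lt_sorted_cat[_ sb2 _] _] := sb.
have /lt_sorted_cat[_ sBf _] := sb'.
have /lt_sorted_cat[_ sA _] := sa'; have /lt_sorted_cat[_ sa3 _] := sA.
have d := matched_dominated sb1 (slide_low S).
have [bu1 e1 s1] := egs_low sa sb1 d.
have [bu1' e1' s1'] := egs_low sa' sb1 d.
move: (egs a1 b1).1 (egs a1 b1).2 e1 s1 e1' s1' => cs a1' e1 s1 e1' s1'.
have a1'x z : z \in a1' -> z < x.
  by move=> h; have /lt_sorted_cat[_ _] := s1; apply=> //; rewrite mem_head.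
have [e2 ib2] := run_egs a1'x s1.
have al := pU_aligned sa3 sb2 (slide_high S).
pose b2' := take (size a3) b2; pose b2'' := drop (size a3) b2.
have eb2 : b2 = b2' ++ b2'' by rewrite cat_take_drop.
have Sb2' : size b2' = size a3 by rewrite size_takel // aligned_size.
pose L := a1' ++ run x k.+1.
have Lx z : z \in L -> z <= x + k%:Z.
  by rewrite mem_cat mem_run => /orP[/a1'x|]; lia_clear.
have sLb2 : lt_sorted (L ++ b2).
  apply/lt_sorted_cat; split=> //.
  - apply/lt_sorted_cat; have /lt_sorted_cat[? _ _] := s1; split=> //; first exact: sorted_run.
    by move=> z t /a1'x; rewrite mem_run; lia_clear.
  - by move=> z t /Lx + /hb2; lia_clear.
have [||i3 e3] := @egs_aligned L a3 b2' sa3 _ Sb2' _ (aligned_take al).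
- by move: sLb2; rewrite eb2 catA => /lt_sorted_cat[].
- by move=> z t /Lx + /ha3; lia_clear.
(* The part of b that bumps: b1 acts within a1, the run bumps its own shift, and b2' replaces a3. *)
pose bs := b1 ++ run x k ++ b2'.
have EL : L ++ a3 = a1' ++ x :: run (x + 1) k ++ a3 by rewrite /L -catA.
have Eegs : egs a bs = (cs ++ run (x + 1) k ++ a3, L ++ b2').
  by rewrite /bs !egs_cat /a e1 /= e2 /= -EL e3.
have Eb : b = bs ++ b2'' by rewrite /b /bs eb2 -!catA.
(* Only one of the two words is known to be reduced; if it is w', successors are found in the
   shorter row and carried over to the longer one. *)
have i1 : insertable a b1.
  case/orP: r => r'.
    by apply: (red_insertable (u := u) (v := (run x k ++ b2) ++ v) sa bu1);
       move: r'; rewrite /w /b -!catA.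
  apply: (insertable_low sa' sa sb1 d).
  by apply: (red_insertable (u := u) (v := (run x k.+1 ++ b2) ++ v) sa' bu1');
     move: r'; rewrite /w' -!catA.
have i : insertable a bs.
  apply/insertable_cat; split=> //; rewrite /a e1 /=; apply/insertable_cat; split=> //.
  by rewrite e2 /= -EL.
have Sbs : size bs = (size b1 + k + size a3)%N by rewrite !size_cat size_run Sb2'; lia_clear.
have Sa : size a = (size a1 + k + size a3).+1 by rewrite size_cat /= size_cat size_run; lia_clear.
exists (size bs); split.
- by have := dominated_size d; rewrite Sbs Sa; lia_clear.
- rewrite /w Eb; apply: insq_intro => //; first by case: (a) Sa.
  rewrite Eegs /=; case E : b2'' => [|z l] //= _.
  have : lt_sorted ((L ++ b2') ++ z :: l) by rewrite -E -catA -eb2.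
  move=> /lt_sorted_cat[_ _]; apply; last exact: mem_head.
  have : L ++ b2' != [::] by rewrite /L; case: (a1').
  by case: (L ++ b2') => // t s _ /=; apply: mem_last.
(* In w' the row is one letter shorter. The same number of insertions bumps the same letters, and
   the final row together with what follows it spells the same word. *)
pose A := run (x + 1) k ++ a3; pose Bf := run x k.+1 ++ b2.
have alB : aligned A Bf.
  rewrite /Bf run_rcons cat_rcons; apply: aligned_run; apply: aligned_shift => //.
  by rewrite /sorted lt_pathP sb2 andbT; apply/allP => z /hb2.
pose B' := take (size A) Bf; pose B'' := drop (size A) Bf.
have eBf : Bf = B' ++ B'' by rewrite cat_take_drop.
have SB' : size B' = size A by rewrite size_takel // aligned_size.
have i1' : insertable (a1 ++ A) b1 := insertable_low sa sa' sb1 d i1.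
have sLB : lt_sorted (a1' ++ Bf).
  by move: sLb2; rewrite /L /Bf -catA.
have [||i2' e2'] := @egs_aligned a1' A B' sA _ SB' _ (aligned_take alB).
- by move: sLB; rewrite eBf catA => /lt_sorted_cat[].
- by have /lt_sorted_cat[_ _] := s1'.
have i' : insertable (a1 ++ A) (b1 ++ B') by apply/insertable_cat; rewrite /A e1'.
have Eegs' : egs (a1 ++ A) (b1 ++ B') = (cs ++ A, a1' ++ B').
  by rewrite egs_cat /A e1' /= e2'.
exists (u ++ (egs a bs).1 ++ (egs a bs).2 ++ b2'' ++ v).
  by have := @egs_chain u a bs (b2'' ++ v) sa i; rewrite /w Eb -!catA.
have := @egs_chain u (a1 ++ A) (b1 ++ B') (B'' ++ v) sa' i'.
have -> : size (b1 ++ B') = size bs.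
  by rewrite Sbs size_cat SB' /A size_cat size_run; lia_clear.
have -> : size (a1 ++ A) = (size a).-1.
  by rewrite Sa size_cat /A size_cat size_run; lia_clear.
rewrite Eegs Eegs' [fst _]/= [snd _]/=.
have -> : u ++ (a1 ++ A) ++ (b1 ++ B') ++ B'' ++ v = w'.
  by rewrite /w' -/Bf eBf -!catA.
have E : B' ++ B'' ++ v = run x k.+1 ++ b2' ++ b2'' ++ v.
  by rewrite catA -eBf /Bf {1}eb2 -!catA.
have -> : u ++ (cs ++ A) ++ (a1' ++ B') ++ B'' ++ v =
    u ++ (cs ++ run (x + 1) k ++ a3) ++ (L ++ b2') ++ b2'' ++ v; last by [].
by rewrite -!catA E /L /A -?catA.
Qed.

(** * The operators e_i and f_i *)

(** The value q = size a is the signature of f = 0: otherwise [slide_insertion] gives q < size a. *)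
Lemma insq_full u a b v : lt_sorted a -> lt_sorted b -> a != [::] -> pU a b = [::] ->
  insq (size u) (size a) (size b) (u ++ a ++ b ++ v) (size a).
Proof.
move=> sa sb a0 E; have al := pU_aligned sa sb E.
pose b1 := take (size a) b; pose b2 := drop (size a) b.
have eb : b = b1 ++ b2 by rewrite cat_take_drop.
have S1 : size b1 = size a by rewrite size_takel // aligned_size.
have sb1 : lt_sorted ([::] ++ b1) by apply: take_sorted sb.
have [//|i e] := @egs_aligned [::] a b1 sa sb1 S1 _ (aligned_take al).
rewrite -[X in insq _ _ _ _ X]S1 {1 2}eb; apply: insq_intro => //; rewrite e /=.
case Eb2 : b2 => [|z l] //= _; move: sb; rewrite eb Eb2 => /lt_sorted_cat[_ _].
apply; last exact: mem_head.
by move: S1; case: (b1) => [|t s _] /=; [case: (a) a0|apply: mem_last].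
Qed.

Lemma f_pair_cases u a b v : lt_sorted a -> lt_sorted b -> red (u ++ a ++ b ++ v) ->
  (pU a b = [::] /\ f_pair a b = None) \/
  exists a' b' q, [/\ f_pair a b = Some (a', b'), size a = (size a').+1 /\ size b' = (size b).+1,
    (q < size a)%N, insq (size u) (size a) (size b) (u ++ a ++ b ++ v) q &
    exists2 T, chain (ins_moves (size u) (size a) q) (u ++ a ++ b ++ v) T &
      chain (ins_moves (size u) (size a).-1 q) (u ++ a' ++ b' ++ v) T].
Proof.
move=> sa sb r; case E : (pU a b) => [|y l].
  by left; split=> //; rewrite /f_pair unpairedE //= E.
right; have [|a1 [x [k [a3 [b1 [b2 [S ea eb]]]]]]] := f_slide sa sb r; first by rewrite E.
have := slide_insertion (u := u) (v := v) S; cbv zeta; rewrite -ea -eb r => /(_ isT)[q [lt iq c]].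
exists (a1 ++ run (x + 1) k ++ a3), (b1 ++ run x k.+1 ++ b2), q.
split=> //; first by rewrite ea eb (slide_f S).
by rewrite ea eb !(size_cat, size_run) /= !(size_cat, size_run); split; lia_clear.
Qed.

(** A word and its bump have the same q, which decides whether f vanishes. If it does not, the two
    chains to the meeting word have positions fixed by the sizes and q; bumping them and running
    determinism forwards and then backwards identifies the image. *)
Lemma f_pair_fb pi u a b v u1 a1 b1 v1 : red (u ++ a ++ b ++ v) ->
  fb pi (u ++ a ++ b ++ v) = u1 ++ a1 ++ b1 ++ v1 ->
  lt_sorted a -> lt_sorted b -> lt_sorted a1 -> lt_sorted b1 ->
  size u1 = size u -> size a1 = size a -> size b1 = size b ->
  match f_pair a b with
  | None => f_pair a1 b1 = None
  | Some (a', b') => exists a1' b1', [/\ f_pair a1 b1 = Some (a1', b1'),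
      size a1' = size a', size b1' = size b' &
      u1 ++ a1' ++ b1' ++ v1 = fb pi (u ++ a' ++ b' ++ v)]
  end.
Proof.
move=> r Ef sa sb sa1 sb1 Su Sa Sb; have r1 := fb_red pi r; rewrite Ef in r1.
have [a0|a0] := eqVneq a [::].
  have a10 : a1 = [::] by apply: size0nil; rewrite Sa a0.
  have N c : pU [::] c = [::] by elim: c => //= y c ->.
  by rewrite a0 a10 /f_pair !unpairedE // !N.
have sizes : (size u + size a + size b <= size (u ++ a ++ b ++ v))%N.
  by rewrite !size_cat; lia_clear.
have pa : (0 < size a)%N by case: (a) a0.
have U q q1 : insq (size u) (size a) (size b) (u ++ a ++ b ++ v) q ->
    insq (size u1) (size a1) (size b1) (u1 ++ a1 ++ b1 ++ v1) q1 -> q = q1.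
  by rewrite Su Sa Sb -Ef; apply: insq_fb_le.
have a10 : a1 != [::] by move: pa; rewrite -Sa; case: (a1).
case: (f_pair_cases sa sb r) (f_pair_cases sa1 sb1 r1)
    => [[E ->]|[a' [b' [q [-> [Sa' Sb'] lt iq [T c c']]]]]]
    [[E1 E1']|[a1' [b1' [q1 [E1 [Sa1' Sb1'] lt1 iq1 [T1 c1 c1']]]]]].
- by [].
- by have := U _ _ (insq_full u v sa sb a0 E) iq1; lia_clear.
- by have := U _ _ iq (insq_full u1 v1 sa1 sb1 a10 E1); lia_clear.
have eq := U _ _ iq iq1; subst q1.
exists a1', b1'; split=> //; first lia_clear; first lia_clear.
have rT : red (u ++ a' ++ b' ++ v) by rewrite (chain_red c') -(chain_red c).
have cf := chain_fb pi r c; have cf' := chain_fb pi rT c'.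
rewrite Ef in cf; rewrite Su Sa in c1 c1'.
have ET := chain_det c1 cf; rewrite ET in c1'.
exact: chain_det_r c1' cf'.
Qed.

Lemma f_pair_props u a b v a' b' : lt_sorted a -> lt_sorted b ->
  red (u ++ a ++ b ++ v) -> f_pair a b = Some (a', b') ->
  [/\ lt_sorted a', lt_sorted b', red (u ++ a' ++ b' ++ v) & e_pair a' b' = Some (a, b)].
Proof.
move=> sa sb r E.
have [|a1 [x [k [a3 [b1 [b2 [S ea eb]]]]]]] := f_slide sa sb r.
  by move=> E0; move: E; rewrite /f_pair unpairedE //= E0.
move: E; rewrite ea eb (slide_f S) => -[<- <-].
have := slide_insertion (u := u) (v := v) S; cbv zeta; rewrite -ea -eb r => /(_ isT)[q [_ _ [T c c']]].
split; [exact: slide_a' S|exact: slide_b S| |by rewrite (slide_e S) ea eb].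
by rewrite (chain_red c') -(chain_red c).
Qed.

Lemma e_pair_props u a b v a' b' : lt_sorted a -> lt_sorted b ->
  red (u ++ a ++ b ++ v) -> e_pair a b = Some (a', b') ->
  [/\ lt_sorted a', lt_sorted b', red (u ++ a' ++ b' ++ v) & f_pair a' b' = Some (a, b)].
Proof.
move=> sa sb r E.
have [|a1 [x [k [a3 [b1 [b2 [S ea eb]]]]]]] := e_slide sa sb r.
  by move=> E0; move: E; rewrite /e_pair unpairedE //= E0.
move: E; rewrite ea eb (slide_e S) => -[<- <-].
have := slide_insertion (u := u) (v := v) S; cbv zeta; rewrite -ea -eb r orbT.
move=> /(_ isT)[q [_ _ [T c c']]].
split; [exact: slide_a S|exact: slide_b' S| |by rewrite (slide_f S) ea eb].
by rewrite (chain_red c) -(chain_red c').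
Qed.

Lemma set_nth_mid (T : Type) (x0 : T) s x y t : set_nth x0 (s ++ x :: t) (size s) y = s ++ y :: t.
Proof. by elim: s => //= z s ->. Qed.

Lemma nth_mid (T : Type) (x0 : T) s x t : nth x0 (s ++ x :: t) (size s) = x.
Proof. by elim: s. Qed.

Lemma upd_pair (s : seq (seq int)) a b t a' b' :
  upd (upd (s ++ a :: b :: t) (size s) a') (size s).+1 b' = s ++ a' :: b' :: t.
Proof.
rewrite /upd set_nth_mid -(@cat_rcons _ a' s (b :: t)) -(size_rcons s a').
by rewrite set_nth_mid cat_rcons.
Qed.

Lemma upd_pair' (s : seq (seq int)) a b t a' b' :
  upd (upd (s ++ a :: b :: t) (size s).+1 b') (size s) a' = s ++ a' :: b' :: t.
Proof.
rewrite /upd -(@cat_rcons _ a s (b :: t)) -(size_rcons s a) set_nth_mid.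
by rewrite cat_rcons set_nth_mid.
Qed.

Definition put (s t : seq (seq int)) (p : seq int * seq int) := s ++ p.1 :: p.2 :: t.

Lemma nth_pair (s : seq (seq int)) a b t :
  nth [::] (s ++ a :: b :: t) (size s) = a /\ nth [::] (s ++ a :: b :: t) (size s).+1 = b.
Proof.
by rewrite nth_mid -(@cat_rcons _ a s (b :: t)) -(size_rcons s a) nth_mid.
Qed.

Lemma f_opE s a b t :
  f_op (size s).+1 (s ++ a :: b :: t) = omap (put s t) (f_pair a b).
Proof.
have [E1 E2] := nth_pair s a b t; rewrite /f_op /f_pair [_.+1.-1]/= E1 E2.
by case: (unpaired a b).1 => // y l; rewrite upd_pair.
Qed.

Lemma e_opE s a b t :
  e_op (size s).+1 (s ++ a :: b :: t) = omap (put s t) (e_pair a b).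
Proof.
have [E1 E2] := nth_pair s a b t; rewrite /e_op /e_pair [_.+1.-1]/= E1 E2.
by case: (unpaired a b).2 => // y l; rewrite upd_pair'.
Qed.

(** * Factorizations and the bump on them *)

Lemma in_Ifpf_C w : in_Ifpf (conj_fpf w).
Proof.
exists (word_perm w), (word_perm (rev w)); split; last by move=> x; rewrite /conj_fpf conjwE.
split; first exact: word_perm_revK.
split; first by move=> x; rewrite -{1}(revK w) word_perm_revK.
have [B B0 H] := word_bound w; exists `|(B + 1)%R|%N => x lt.
by apply: word_perm_fix => y /H; lia_clear.
Qed.

Lemma RSpE n ws : RSp_union n ws <->
  [/\ size ws = n, all (fun s => lt_sorted s) ws & red (flatten ws)].
Proof.
split=> [[sg [_ [S [A /fpf_inv_wordE[r _]]]]]|[S A r]]; first by split.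
exists (conj_fpf (flatten ws)); split; first exact: in_Ifpf_C.
by split=> //; split=> //; apply/fpf_inv_wordE.
Qed.

Lemma flatten_fbn pi ws : red (flatten ws) -> flatten (fbn pi ws) = fb pi (flatten ws).
Proof. by move=> r; rewrite /fbn reshapeKr // size_fb // size_flatten. Qed.

Lemma shape_fbn pi ws : red (flatten ws) -> map size (fbn pi ws) = map size ws.
Proof. by move=> r; rewrite /fbn -/(shape _) reshapeKl // size_fb // size_flatten. Qed.

Lemma reshape_eq pi ws vs : map size vs = map size ws ->
  flatten vs = fb pi (flatten ws) -> fbn pi ws = vs.
Proof. by move=> S F; rewrite /fbn -F -S -/(shape vs) flattenK. Qed.

(** Increasing factors are a condition on ascents of the concatenation inside blocks of given
    lengths. *)
Lemma same_asc_sorted ws vs : map size vs = map size ws ->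
  (forall k, (k.+1 < size (flatten ws))%N ->
    (nthZ (flatten vs) k < nthZ (flatten vs) k.+1) =
    (nthZ (flatten ws) k < nthZ (flatten ws) k.+1)) ->
  all (fun s => lt_sorted s) ws -> all (fun s => lt_sorted s) vs.
Proof.
elim: ws vs => [|a ws IH] [|b vs] //= [Sb S] H /andP[sa sw].
have Sf : size (flatten vs) = size (flatten ws) by rewrite !size_flatten /shape S.
apply/andP; split.
  apply/(sortedP 0) => k lt; have lt' : (k.+1 < size a)%N by rewrite -Sb.
  have := H k; rewrite size_cat !nth_cat lt lt' (ltnW lt) (ltnW lt') => ->; last lia_clear.
  by have /(sortedP 0) := sa; apply.
apply: IH => // k lt; have := H (size a + k)%N; rewrite size_cat -addnS !nth_cat Sb.
rewrite !ltnNge !leq_addr /= !addKn; apply; lia_clear.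
Qed.

Lemma RSp_fbn pi n ws : RSp_union n ws -> RSp_union n (fbn pi ws).
Proof.
move=> /RSpE[S A r]; apply/RSpE; rewrite flatten_fbn //; split.
- by rewrite -S -(size_map size) shape_fbn // size_map.
- apply: (same_asc_sorted (ws := ws)) => //; first exact: shape_fbn.
  by move=> k lt; rewrite flatten_fbn //; apply: fb_asc.
- exact: fb_red.
Qed.

Lemma fbn_inj pi n ws ws' : RSp_union n ws -> RSp_union n ws' ->
  fbn pi ws = fbn pi ws' -> ws = ws'.
Proof.
move=> /RSpE[_ _ r] /RSpE[_ _ r'] E.
rewrite -(flattenK ws) -(flattenK ws') /shape -(shape_fbn pi r) E shape_fbn //.
by congr reshape; apply: (@fb_inj pi) => //; rewrite -!flatten_fbn // E.
Qed.

Lemma fbn_surj pi n vs : RSp_union n vs -> exists2 ws, RSp_union n ws & fbn pi ws = vs.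
Proof.
move=> /RSpE[S A r]; have [u ru Eu] := fb_surj pi r.
have Su : size u = size (flatten vs) by rewrite -Eu size_fb.
pose ws := reshape (map size vs) u.
have Fw : flatten ws = u by rewrite /ws reshapeKr // Su size_flatten.
have Sw : map size ws = map size vs.
  by rewrite /ws -/(shape _) reshapeKl // Su size_flatten.
exists ws; last by apply: reshape_eq; rewrite ?Sw ?Fw.
apply/RSpE; rewrite Fw; split=> //; first by rewrite -S -(size_map size) Sw size_map.
apply: (same_asc_sorted (ws := vs)) => // k lt; rewrite Fw -Eu fb_asc //.
by rewrite Su.
Qed.

(** If e (F w) is some v, write v = F u. Then F carries f u to F w, so f u = w by injectivity, and e
    w is defined after all. *)
Lemma commute_partial_inverse (T : Type) (X : T -> Prop) (F : T -> T) (f e : T -> option T) :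
  (forall w, X w -> X (F w)) ->
  (forall w w', X w -> X w' -> F w = F w' -> w = w') ->
  (forall v, X v -> exists2 w, X w & F w = v) ->
  (forall w v, X w -> f w = Some v -> X v /\ e v = Some w) ->
  (forall w v, X w -> e w = Some v -> X v /\ f v = Some w) ->
  (forall w, X w -> omap F (f w) = f (F w)) ->
  forall w, X w -> omap F (e w) = e (F w).
Proof.
move=> XF Finj Fsurj fe ef H w Xw; case Ew : (e w) => [v|] /=.
  have [Xv Ev] := ef _ _ Xw Ew; have := H v Xv; rewrite Ev /= => Ef.
  by have [_ ->] := fe _ _ (XF _ Xv) (esym Ef).
case Ef : (e (F w)) => [v|] //; have [Xv Ev] := ef _ _ (XF _ Xw) Ef.
have [u Xu Eu] := Fsurj v Xv; have := H u Xu; rewrite Eu Ev.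
case Eu' : (f u) => [u'|] //= [E]; have [Xu' Eu2] := fe _ _ Xu Eu'.
by rewrite -(Finj _ _ Xu' Xw E) Eu2 in Ew.
Qed.

Lemma split_pair (T : Type) (ws : seq T) i : (0 < i < size ws)%N ->
  exists s a b t, ws = s ++ a :: b :: t /\ i = (size s).+1.
Proof.
elim: ws i => [|a ws IH] [|[|i]] //=.
  by case: ws {IH} => // b t _; exists [::], a, b, t.
move=> lt; have [//|s [c [d [t [-> ->]]]]] := IH i.+1.
by exists (a :: s), c, d, t.
Qed.

Lemma flatten_put s a b t : flatten (s ++ a :: b :: t) =
  flatten s ++ a ++ b ++ flatten t :> seq int.
Proof. by rewrite flatten_cat. Qed.

Lemma RSp_put n s a b t : RSp_union n (s ++ a :: b :: t) ->
  [/\ lt_sorted a, lt_sorted b & red (flatten s ++ a ++ b ++ flatten t)].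
Proof.
by move=> /RSpE[_ A r]; move: A r; rewrite all_cat flatten_put /= => /and4P[_ -> -> _].
Qed.

Lemma RSp_replace n s a b t a' b' : RSp_union n (s ++ a :: b :: t) ->
  lt_sorted a' -> lt_sorted b' -> red (flatten s ++ a' ++ b' ++ flatten t) ->
  RSp_union n (s ++ a' :: b' :: t).
Proof.
move=> /RSpE[S A _] sa sb r; apply/RSpE; rewrite flatten_put; split=> //.
  by rewrite -S !size_cat.
by move: A; rewrite !all_cat /= => /and4P[-> _ _ ->]; rewrite sa sb.
Qed.

Lemma fbn_put pi n s a b t : RSp_union n (s ++ a :: b :: t) ->
  exists s1 a1 b1 t1, [/\ fbn pi (s ++ a :: b :: t) = s1 ++ a1 :: b1 :: t1,
    map size s1 = map size s, size a1 = size a /\ size b1 = size b,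
    map size t1 = map size t &
    fb pi (flatten s ++ a ++ b ++ flatten t) = flatten s1 ++ a1 ++ b1 ++ flatten t1].
Proof.
move=> X; have /RSpE[S1 _ _] := RSp_fbn pi X; have /RSpE[S0 _ r] := X.
have lt : (0 < (size s).+1 < size (fbn pi (s ++ a :: b :: t)))%N.
  by rewrite S1 -S0 size_cat /=; lia_clear.
have [s1 [a1 [b1 [t1 [E [es]]]]]] := split_pair lt.
have := shape_fbn pi r; rewrite E !map_cat /= => /eqP.
rewrite eqseq_cat ?size_map // => /andP[/eqP E1 /eqP[E2 E3 E4]].
exists s1, a1, b1, t1; split=> //.
by rewrite -!flatten_put -E flatten_fbn.
Qed.

Theorem fbn_f_op pi n i ws : (1 <= i < n)%N -> RSp_union n ws ->
  omap (fbn pi) (f_op i ws) = f_op i (fbn pi ws).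
Proof.
move=> lt X; have Sw : size ws = n by have /RSpE[] := X.
rewrite -Sw in lt; have [s [a [b [t [ew ei]]]]] := split_pair lt; subst ws i.
have [sa sb r] := RSp_put X.
have [s1 [a1 [b1 [t1 [Ef Es [Ea Eb] Et Efb]]]]] := fbn_put pi X.
have X1 := RSp_fbn pi X; rewrite Ef in X1; have [sa1 sb1 _] := RSp_put X1.
have Ss : size s1 = size s by rewrite -(size_map size) Es size_map.
have Sf : size (flatten s1) = size (flatten s) by rewrite !size_flatten /shape Es.
rewrite Ef f_opE -[in RHS]Ss f_opE.
have := f_pair_fb r Efb sa sb sa1 sb1 Sf Ea Eb.
case E : (f_pair a b) => [[a' b']|]; last by move=> ->.
move=> [a1' [b1' [-> Sa' Sb' E']]] /=; congr Some; apply: reshape_eq.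
  by rewrite /put !map_cat /= Es Et Sa' Sb'.
by rewrite /put !flatten_put.
Qed.

Lemma f_op_inv n i ws vs : (1 <= i < n)%N -> RSp_union n ws -> f_op i ws = Some vs ->
  RSp_union n vs /\ e_op i vs = Some ws.
Proof.
move=> lt X; have Sw : size ws = n by have /RSpE[] := X.
rewrite -Sw in lt; have [s [a [b [t [ew ei]]]]] := split_pair lt; subst ws i.
have [sa sb r] := RSp_put X; rewrite f_opE.
case E : (f_pair a b) => [[a' b']|] //= -[<-].
have [sa' sb' r' E'] := f_pair_props sa sb r E.
by split; [apply: RSp_replace X _ _ _|rewrite /put e_opE E'].
Qed.

Lemma e_op_inv n i ws vs : (1 <= i < n)%N -> RSp_union n ws -> e_op i ws = Some vs ->
  RSp_union n vs /\ f_op i vs = Some ws.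
Proof.
move=> lt X; have Sw : size ws = n by have /RSpE[] := X.
rewrite -Sw in lt; have [s [a [b [t [ew ei]]]]] := split_pair lt; subst ws i.
have [sa sb r] := RSp_put X; rewrite e_opE.
case E : (e_pair a b) => [[a' b']|] //= -[<-].
have [sa' sb' r' E'] := e_pair_props sa sb r E.
by split; [apply: RSp_replace X _ _ _|rewrite /put f_opE E'].
Qed.

(** * The operators with index bar 1 *)

Definition fbar_pair (a b : seq int) : option (seq int * seq int) :=
  if a is [::] then None else
  if (b != [::]) && (minZ b <= minZ a) then None else
  let x := minZ a in
  if x + 1 \notin a then Some (rem x a, x :: b)
  else Some (rem (x + 1) a, (x - 1) :: b).

Definition ebar_pair (a b : seq int) : option (seq int * seq int) :=
  if b is [::] then None else
  if (a != [::]) && (minZ a <= minZ b) then None else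
  let x := minZ b in
  if (2 %| x)%Z then Some (insZ x a, rem x b) else Some (insZ (x + 2) a, rem x b).

Lemma f_barE a b t : f_bar (a :: b :: t) = omap (put [::] t) (fbar_pair a b).
Proof.
rewrite /f_bar /fbar_pair /=; case: a => // x a; case: ifP => // _.
by case: ifP.
Qed.

Lemma e_barE a b t : e_bar (a :: b :: t) = omap (put [::] t) (ebar_pair a b).
Proof.
rewrite /e_bar /ebar_pair /=; case: b => // x b; case: ifP => // _.
by case: ifP.
Qed.

Lemma red_head_even (x : int) w : red (x :: w) -> (2 %| x)%Z.
Proof.
move=> /andP[+ _]; case: (boolP (2 %| x)%Z) => // /negbTE ox.
by rewrite /one_fpf ox; move: ox; rewrite !dvd2E; splits; lia.
Qed.

Lemma red_P u w w' v : red (u ++ w ++ v) -> word_perm w = word_perm w' -> size w' = size w ->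
  red (u ++ w' ++ v).
Proof.
move=> r E S; apply: (red_same_size r); first by symmetry; apply: conj_fpf_P.
by rewrite !size_cat S.
Qed.

(** The letter y commutes to the front, where a reduced word has an even letter. *)
Lemma red_second_even (x y : int) w : red (x :: y :: w) -> x + 1 < y -> (2 %| y)%Z.
Proof.
move=> r xy; apply: (@red_head_even y (x :: w)).
by apply: (@red_P [::] [:: x; y] [:: y; x] w r) => //; apply: word_perm_comm; lia.
Qed.

(** The small letter z is carried to the right; the larger letter on its left is the witness for
    each move h z d to h d z. *)
Lemma pass_chain u (h z : int) s v : z < h -> lt_sorted (h :: s) ->
  chain (iota (size u) (size s)) (u ++ h :: z :: s ++ v) (u ++ (h :: s) ++ z :: v).
Proof.
elim: s u h => [//|d s IH] u h zh p; have hd : h < d by case/andP: p.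
exists (rcons u h ++ d :: z :: s ++ v).
  exists u, [:: h; z; d], [:: h; d; z], [:: 0; 2; 1]%N, (s ++ v).
  by split; rewrite ?cat_rcons //; apply: BlkBac.
have := IH (rcons u h) d _ (path_sorted p).
by rewrite size_rcons !cat_rcons; apply; lia.
Qed.

(** The path of f_bar through a first factor of m letters; its positions depend on m alone, and a
    single letter is already at the boundary of the factors. *)
Definition bchain (m : nat) (w W : seq int) : Prop :=
  if (m <= 1)%N then w = W else
  exists2 w0, moved false 0 w w0 & chain (iota 0 (m - 2)) w0 W.

Lemma bchain_red m w W : bchain m w W -> red w = red W.
Proof.
by rewrite /bchain; case: ifP => _; [move=> ->|case=> w0 /moved_red -> /chain_red].
Qed.

Lemma bchain_det m w W1 W2 : bchain m w W1 -> bchain m w W2 -> W1 = W2.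
Proof.
rewrite /bchain; case: ifP => _; first by move=> -> ->.
by case=> w0 m0 c [w1 m1 c1]; rewrite -(moved_det m0 m1) in c1; apply: chain_det c c1.
Qed.

Lemma bchain_fb pi m w W : red w -> bchain m w W -> bchain m (fb pi w) (fb pi W).
Proof.
rewrite /bchain => r; case: ifP => _; first by move=> ->.
case=> w0 m0 c; exists (fb pi w0); first exact: fb_moved.
by apply: chain_fb => //; rewrite -(moved_red m0).
Qed.

Lemma bchain_far (x : int) a v : lt_sorted (x :: a) -> (2 %| x)%Z -> x + 1 \notin a ->
  (a != [::] -> (2 %| head 0 a)%Z) -> bchain (size a).+1 (x :: a ++ v) (a ++ x :: v).
Proof.
case: a => [|y a] p ex nx ey //; rewrite /bchain [(_ <= 1)%N]/=.
have xy : x < y by case/andP: p.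
exists (y :: x :: a ++ v).
  exists [::], [:: x; y], [:: y; x], [:: 1; 0]%N, (a ++ v).
  by split=> //; split=> //; apply: BlkXY; [|exact: ey|lia].
by have := @pass_chain [::] y x a v xy (path_sorted p); rewrite !subSS subn0.
Qed.

Lemma bchain_near (x : int) a v : lt_sorted [:: x, x + 1 & a] -> (2 %| x)%Z ->
  bchain (size a).+2 [:: x, x + 1 & a ++ v] (x :: a ++ (x - 1) :: v).
Proof.
move=> p ex; rewrite /bchain [(_ <= 1)%N]/=.
exists [:: x, x - 1 & a ++ v].
  exists [::], [:: x; x + 1], [:: x; x - 1], [:: 0; 1]%N, (a ++ v).
  by split=> //; split=> //; apply: BlkUp.
have px : lt_sorted (x :: a).
  by apply: lt_subseq p; rewrite /= eqxx; apply: subseq_cons.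
have lx : x - 1 < x by lia.
by have := @pass_chain [::] x (x - 1) a v lx px; rewrite !subSS subn0.
Qed.

(** Commuting a away and replacing x, x - 1, x by x - 1, x, x - 1 puts an odd letter in front. *)
Lemma red_no_updown (x : int) a v : (2 %| x)%Z -> (forall y, y \in a -> x + 1 < y) ->
  red (x :: a ++ [:: x - 1, x & v]) = false.
Proof.
move=> ex H; apply/negP => r.
have r1 : red ([:: x] ++ ([:: x - 1; x] ++ a) ++ v).
  apply: (@red_P [:: x] (a ++ [:: x - 1; x])); first by rewrite -catA.
    by apply: word_perm_swap => y z /H hy; rewrite !inE => /orP[]/eqP->; lia.
  by rewrite !size_cat addnC.
have r2 : red ([::] ++ [:: x - 1; x; x - 1] ++ a ++ v).
  apply: (@red_P [::] [:: x; x - 1; x]) => //.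
  by have := word_perm_braid (x - 1); rewrite subrK => ->.
by have := red_head_even r2; move: ex; rewrite !dvd2E; lia.
Qed.

Lemma near_cons (x : int) a : lt_sorted (x :: a) -> x + 1 \in a -> a = (x + 1) :: behead a.
Proof.
case: a => // y a p; rewrite inE => /orP[/eqP->//|h].
have xy : x < y by case/andP: p.
by have := lt_cons_all (path_sorted p) h; lia.
Qed.

(** Both branches of f_bar follow the same list of positions and carry a letter z, equal to x or x -
    1, to the end of the first factor. The test on the minima becomes the ascent from z to the
    second factor, a property that bumps preserve. *)
Lemma fbar_spec a b v : a != [::] -> lt_sorted a -> lt_sorted b -> red (a ++ b ++ v) ->
  exists am z, [/\ size a = (size am).+1 /\ lt_sorted am,
    bchain (size a) (a ++ b ++ v) (am ++ z :: b ++ v),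
    fbar_pair a b = if (b == [::]) || (z < head 0 b) then Some (am, z :: b) else None &
    (b == [::]) || (z < head 0 b) -> ebar_pair am (z :: b) = Some (a, b)].
Proof.
case: a => // x a _ sa sb r; have ex := red_head_even r.
have xa := lt_cons_all sa.
have Hmin : (b != [::]) && (minZ b <= x) = ~~ ((b == [::]) || (x < head 0 b)).
  by case: b sb {r} => //= y b sb; rewrite minZ_sorted // leNgt.
have szb z : (b == [::]) || (z < head 0 b) -> lt_sorted (z :: b).
  by case: (b) sb => //= y b' -> ->.
case: (boolP (x + 1 \in a)) => [xin|nx]; last first.
  have ey : a != [::] -> (2 %| head 0 a)%Z.
    case: a sa r xa nx => // y a sa r xa nx _ /=; apply: red_second_even r _.
    by have := xa y (mem_head _ _); move: nx; rewrite inE negb_or; lia.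
  exists a, x; split; first by split=> //; apply: path_sorted sa.
  - exact: bchain_far.
  - have nx' : x + 1 \notin x :: a by rewrite inE negb_or nx andbT; apply/eqP; lia.
    by rewrite /fbar_pair minZ_sorted // Hmin nx' if_neg /= eqxx.
  - move=> H; rewrite /ebar_pair minZ_sorted ?szb // ex /= eqxx.
    have -> : (a != [::]) && (minZ a <= x) = false.
      case: a sa xa {r nx ey} => // y a sa xa.
      rewrite minZ_sorted; last exact: path_sorted sa.
      by have := xa y (mem_head _ _); rewrite /=; lia.
    by rewrite /insZ sort_id.
have ea := near_cons sa xin; move: (behead a) ea => a'' ea; subst a.
have ha : forall z, z \in a'' -> x + 1 < z := lt_cons_all (path_sorted sa).
have sxa : lt_sorted (x :: a'').
  by apply: lt_subseq sa; rewrite /= eqxx; apply: subseq_cons.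
have bc : bchain (size [:: x, x + 1 & a'']) ([:: x, x + 1 & a''] ++ b ++ v)
   ((x :: a'') ++ x - 1 :: b ++ v) by apply: bchain_near.
(* The two tests differ only if the second factor begins with x, which reducedness forbids. *)
have Ez : (b == [::]) || (x < head 0 b) = ((b == [::]) || (x - 1 < head 0 b)).
  case: b sb r Hmin szb bc => //= y b sb r _ _ bc.
  have ne : y <> x.
    move=> e; have : red (x :: a'' ++ [:: x - 1, y & b ++ v]).
      by rewrite -[red _](bchain_red bc).
    by rewrite e red_no_updown.
  by apply/idP/idP; lia.
exists (x :: a''), (x - 1); split=> //.
- rewrite /fbar_pair minZ_sorted // Hmin Ez !inE eqxx orbT if_neg /=.
  have -> : (x == x + 1) = false by apply/eqP; lia.
  by rewrite eqxx; case: ifP.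
- move=> H; rewrite /ebar_pair !minZ_sorted ?szb //.
  have -> : (x <= x - 1) = false by lia.
  have -> : (2 %| x - 1)%Z = false by move: ex; rewrite !dvd2E; lia.
  rewrite /= eqxx; congr (Some (_, _)); have -> : x - 1 + 2 = x + 1 by lia.
  by apply: sort_perm => //; rewrite -cat1s -[x :: a'']cat1s perm_catCA.
Qed.

(** An even z returns to the front as smallest letter. For an odd z reducedness makes the first
    factor start with z + 1 and omit z + 2, so inserting z + 2 gives exactly the second case of
    f_bar. *)
Lemma ebar_spec a b v a' b' : lt_sorted a -> lt_sorted b -> red (a ++ b ++ v) ->
  ebar_pair a b = Some (a', b') ->
  [/\ lt_sorted a', lt_sorted b', red (a' ++ b' ++ v) & fbar_pair a' b' = Some (a, b)].
Proof.
case: b => // z b sa sb r; have zb := lt_cons_all sb.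
rewrite /ebar_pair minZ_sorted // [rem _ _]/= eqxx; case: ifP => // Hza.
have za y : y \in a -> z < y.
  case: a sa Hza {r} => // h a sa /= /negbT; rewrite minZ_sorted // -ltNge => zh.
  by rewrite inE => /orP[/eqP->//|/(lt_cons_all sa)]; lia.
have sza : lt_sorted (z :: a) by rewrite /sorted lt_pathP sa andbT; apply/allP.
have Hzb : (b != [::]) && (minZ b <= z) = false.
  case: b sb zb {r} => // y b sb zb; rewrite minZ_sorted; last exact: path_sorted sb.
  by have := zb y (mem_head _ _); rewrite /=; lia.
have szb := path_sorted sb; case: ifP => ez -[<- <-].
  have -> : insZ z a = z :: a by apply: sort_id.
  have nz : z + 1 \notin a.
    apply/negP => h; have := near_cons sza h => ea; rewrite ea in r.
    by have := red_head_even r; move: ez; rewrite !dvd2E; lia.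
  have ea : a != [::] -> (2 %| head 0 a)%Z.
    by case: a r {sa sza za Hza nz} => // y a /red_head_even.
  have bc := bchain_far (b ++ v) sza ez nz ea.
  split=> //; first by rewrite /= (bchain_red bc).
  have nz' : z + 1 \notin z :: a by rewrite inE negb_or nz andbT; apply/eqP; lia.
  by rewrite /fbar_pair minZ_sorted // Hzb nz' /= eqxx.
have a0 : a != [::].
  by apply/eqP => e; rewrite e in r; move: ez; rewrite (red_head_even r).
case: a a0 sa r za sza {Hza} => // h a _ sa r za sza.
have ha := lt_cons_all sa; have eh := red_head_even r.
have zh : z < h by apply: za; rewrite mem_head.
(* The odd letter z must not be able to commute to the front. *)
have front c w : (forall y, y \in c -> z + 1 < y) -> red (c ++ z :: w) -> False.
  move=> H r'; have r2 : red ([::] ++ (z :: c) ++ w).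
    apply: (@red_P [::] (rcons c z)); first by rewrite /= cat_rcons.
      by symmetry; apply: word_perm_move => y /H; lia.
    by rewrite size_rcons.
  by move: ez; rewrite (red_head_even r2).
have eh1 : h = z + 1.
  have [//|/eqP ne] := eqVneq h (z + 1); case: (front (h :: a) (b ++ v)) => //.
  by move=> y; rewrite inE => /orP[/eqP->|/ha]; lia.
(* If z + 2 followed z + 1, commuting z forward would give z + 1, z, z + 2; the initial move
   replaces z by z + 2 and produces a square. *)
subst h; have nz2 y : y \in a -> z + 2 < y.
  move=> ya; have := ha _ ya => h1; have [e|/eqP ne] := eqVneq y (z + 2); last lia.
  have ea : a = (z + 1 + 1) :: behead a.
    by apply: near_cons => //; move: ya; rewrite e; have -> : z + 2 = z + 1 + 1 by lia.
  move: (behead a) ea => a2 ea; subst a.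
  have h2 : forall t, t \in a2 -> z + 1 + 1 < t := lt_cons_all (path_sorted sa).
  have r1 : red ([:: z + 1; z + 1 + 1] ++ (z :: a2) ++ b ++ v).
    apply: (@red_P _ (rcons a2 z)); first by rewrite /= cat_rcons.
      by symmetry; apply: word_perm_move => t /h2; lia.
    by rewrite size_rcons.
  have r2 : red ([:: z + 1] ++ ([:: z; z + 1 + 1] ++ a2 ++ b ++ v)).
    apply: (@red_P [:: z + 1] [:: z + 1 + 1; z]) => //.
    by apply: word_perm_comm; lia.
  have r3 : red ([::] ++ [:: z + 1; z + 1 + 1] ++ z + 1 + 1 :: a2 ++ b ++ v).
    apply: (red_same_size r2) => //; rewrite /=.
    rewrite -[in LHS](cat0s [:: z + 1, z + 1 + 1 & _]).
    have E : conj_fpf [:: z + 1; z + 1 + 1] = conj_fpf [:: z + 1; z].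
      by apply: conj_fpf_updown => //; lia.
    rewrite -[LHS]/(conj_fpf ([:: z + 1; z + 1 + 1] ++ z + 1 + 1 :: a2 ++ b ++ v)) conj_fpf_cat E.
    by rewrite -conj_fpf_cat.
  by have := red_no_square [:: z + 1] (z + 1 + 1) (a2 ++ b ++ v); rewrite -[_ ++ _]/(_ :: _) r3.
have s2 : lt_sorted [:: z + 1, z + 1 + 1 & a].
  rewrite /sorted /= lt_pathP (path_sorted sa) andbT.
  by apply/andP; split; [lia|apply/allP => y /nz2; lia].
have Ei : insZ (z + 2) (z + 1 :: a) = [:: z + 1, z + 1 + 1 & a].
  have -> : z + 2 = z + 1 + 1 by lia.
  by apply: sort_perm s2 _; rewrite -cat1s -[z + 1 :: a]cat1s perm_catCA.
have ev1 : (2 %| z + 1)%Z := eh.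
have bc := bchain_near (b ++ v) s2 ev1.
have ez1 : z + 1 - 1 = z by lia.
rewrite ez1 in bc; rewrite Ei; split=> //.
  by rewrite /= (bchain_red bc).
have nb : (b != [::]) && (minZ b <= z + 1) = false.
  case: b sb zb r szb {bc Hzb} => // y b sb zb r syb.
  rewrite minZ_sorted //; have zy := zb y (mem_head _ _).
  have ny : y <> z + 1; last by rewrite /=; lia.
  move=> e; have := @red_no_updown (z + 1) a (b ++ v) ev1.
  have nz3 : forall t, t \in a -> z + 1 + 1 < t by move=> t /nz2; lia.
  by rewrite ez1 => /(_ nz3); move: r; rewrite e /= => ->.
rewrite /fbar_pair minZ_sorted // nb !inE eqxx orbT /=.
have -> : (z + 1 == z + 1 + 1) = false by apply/eqP; lia.
by rewrite eqxx ez1.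
Qed.

Lemma lt_head_nth am (z : int) b v : b != [::] ->
  (z < head 0 b) = (nthZ (am ++ z :: b ++ v) (size am) < nthZ (am ++ z :: b ++ v) (size am).+1).
Proof.
case: b => // y b _; rewrite nth_mid -cat_rcons -(size_rcons am z) /=.
by rewrite nth_mid.
Qed.

(** The carried letter lands at a position fixed by the sizes, where the vanishing test is an ascent
    of the carried word and hence invariant under the bump. *)
Lemma fbar_fb pi a b v a1 b1 v1 : red (a ++ b ++ v) ->
  fb pi (a ++ b ++ v) = a1 ++ b1 ++ v1 ->
  lt_sorted a -> lt_sorted b -> lt_sorted a1 -> lt_sorted b1 ->
  size a1 = size a -> size b1 = size b ->
  match fbar_pair a b with
  | None => fbar_pair a1 b1 = None
  | Some (a', b') => exists a1' b1', [/\ fbar_pair a1 b1 = Some (a1', b1'),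
      size a1' = size a', size b1' = size b' &
      a1' ++ b1' ++ v1 = fb pi (a' ++ b' ++ v)]
  end.
Proof.
move=> r Ef sa sb sa1 sb1 Sa Sb; have r1 := fb_red pi r; rewrite Ef in r1.
have [a0|a0] := eqVneq a [::].
  by have -> : a1 = [::]; [apply: size0nil; rewrite Sa a0|rewrite a0].
have a10 : a1 != [::] by rewrite -size_eq0 Sa size_eq0.
have [am [z [[Sm sm] bc -> _]]] := fbar_spec a0 sa sb r.
have [am1 [z1 [[Sm1 sm1] bc1 E1 _]]] := fbar_spec a10 sa1 sb1 r1.
have EW : am1 ++ z1 :: b1 ++ v1 = fb pi (am ++ z :: b ++ v).
  by apply: (bchain_det bc1); rewrite Sa -Ef; apply: bchain_fb.
have Eb : (b1 == [::]) = (b == [::]) by rewrite -!size_eq0 Sb.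
have Ez : (b1 == [::]) || (z1 < head 0 b1) = ((b == [::]) || (z < head 0 b)).
  rewrite Eb; case: eqVneq => //= b0; have b10 : b1 != [::] by rewrite Eb.
  rewrite (lt_head_nth am1 z1 v1 b10) (lt_head_nth am z v b0) EW.
  have -> : size am1 = size am by apply: succn_inj; rewrite -Sm -Sm1.
  apply: fb_asc; first by rewrite -(bchain_red bc).
  by rewrite size_cat /= size_cat; case: (b) b0 => //= *; lia.
rewrite E1 Ez; case: ifP => // _; exists am1, (z1 :: b1).
have Eam : size am1 = size am by apply: succn_inj; rewrite -Sm -Sm1.
by split=> //=; rewrite Sb.
Qed.

Lemma RSp_head2 n ws : (2 <= n)%N -> RSp_union n ws -> exists a b t, ws = [::] ++ a :: b :: t.
Proof.
move=> n2 /RSpE[S _ _]; case: ws S => [|a [|b t]] S; try (move: n2; rewrite -S //).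
by exists a, b, t.
Qed.

Theorem fbn_f_bar pi n ws : (2 <= n)%N -> RSp_union n ws ->
  omap (fbn pi) (f_bar ws) = f_bar (fbn pi ws).
Proof.
move=> n2 X; have [a [b [t ew]]] := RSp_head2 n2 X; subst ws.
have [sa sb r] := RSp_put X.
have [s1 [a1 [b1 [t1 [Ef Es [Ea Eb] Et Efb]]]]] := fbn_put pi X.
have s10 : s1 = [::] by case: (s1) Es.
subst s1; have X1 := RSp_fbn pi X; rewrite Ef in X1; have [sa1 sb1 _] := RSp_put X1.
rewrite /= in r Efb; rewrite Ef /= !f_barE; have := fbar_fb r Efb sa sb sa1 sb1 Ea Eb.
case E : (fbar_pair a b) => [[a' b']|]; last by move=> ->.
move=> [a1' [b1' [-> Sa' Sb' E']]] /=; congr Some; apply: reshape_eq.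
  by rewrite /put /= Et Sa' Sb'.
by rewrite /put !flatten_put.
Qed.

Lemma f_bar_inv n ws vs : (2 <= n)%N -> RSp_union n ws -> f_bar ws = Some vs ->
  RSp_union n vs /\ e_bar vs = Some ws.
Proof.
move=> n2 X; have [a [b [t ew]]] := RSp_head2 n2 X; subst ws.
have [sa sb r] := RSp_put X; rewrite /= in r; rewrite /= f_barE; have [a0|a0] := eqVneq a [::].
  by rewrite a0.
have [am [z [[Sm sm] bc -> He]]] := fbar_spec a0 sa sb r.
case: ifP => // H [<-]; have Ee := He H; split; last by rewrite /put /= e_barE Ee.
apply: (RSp_replace X) => //=; last by rewrite -(bchain_red bc).
by case: (b) sb H => //= y b' -> ->.
Qed.

Lemma e_bar_inv n ws vs : (2 <= n)%N -> RSp_union n ws -> e_bar ws = Some vs ->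
  RSp_union n vs /\ f_bar vs = Some ws.
Proof.
move=> n2 X; have [a [b [t ew]]] := RSp_head2 n2 X; subst ws.
have [sa sb r] := RSp_put X; rewrite /= in r; rewrite /= e_barE.
case E : (ebar_pair a b) => [[a' b']|] //= -[<-].
have [sa' sb' r' E'] := ebar_spec sa sb r E.
by split; [apply: (RSp_replace X)|rewrite /put /= f_barE E'].
Qed.

Theorem theorem4p24 (n : nat) (pi : int -> int) :
  (0 < n)%N -> in_Ifpf pi ->
  (* fb_pi maps the disjoint union into itself *)
  (forall ws, RSp_union n ws -> RSp_union n (fbn pi ws)) /\
  (* and bijectively *)
  (forall vs, RSp_union n vs ->
     exists! ws, RSp_union n ws /\ fbn pi ws = vs) /\
  (* it preserves weights *)
  (forall ws, RSp_union n ws -> wt (fbn pi ws) = wt ws) /\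
  (* it commutes with e_i, f_i for i in [n-1] *)
  (forall (i : nat) ws, (1 <= i < n)%N -> RSp_union n ws ->
     omap (fbn pi) (f_op i ws) = f_op i (fbn pi ws) /\
     omap (fbn pi) (e_op i ws) = e_op i (fbn pi ws)) /\
  (* and with e_{bar 1}, f_{bar 1} *)
  (forall ws, (2 <= n)%N -> RSp_union n ws ->
     omap (fbn pi) (f_bar ws) = f_bar (fbn pi ws) /\
     omap (fbn pi) (e_bar ws) = e_bar (fbn pi ws)).
Proof.
move=> _ _; split; first exact: RSp_fbn.
split.
  move=> vs X; have [ws Xw E] := fbn_surj pi X; exists ws; split=> // ws' [Xw' E'].
  by apply: (@fbn_inj pi n _ _ Xw Xw'); rewrite E E'.
split; first by move=> ws /RSpE[_ _ r]; apply: shape_fbn.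
split.
  move=> i ws lt X; split; first exact: fbn_f_op lt X.
  apply: (@commute_partial_inverse _ (RSp_union n) (fbn pi) (f_op i) (e_op i)) X.
  - exact: RSp_fbn.
  - exact: fbn_inj.
  - exact: fbn_surj.
  - by move=> w v; apply: f_op_inv.
  - by move=> w v; apply: e_op_inv.
  - by move=> w; apply: fbn_f_op.
move=> ws n2 X; split; first exact: fbn_f_bar n2 X.
apply: (@commute_partial_inverse _ (RSp_union n) (fbn pi) f_bar e_bar) X.
- exact: RSp_fbn.
- exact: fbn_inj.
- exact: fbn_surj.
- by move=> w v; apply: f_bar_inv.
- by move=> w v; apply: e_bar_inv.
- by move=> w; apply: fbn_f_bar.
Qed.
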